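(* Let $d,\ell,k$ be positive integers with $k\le\ell$, and let $a\in\mathbb{R}^d$ have positive coordinates with $\sum_{j=1}^d a_j=d$. Assume the function $\Omega\colon S^{d-1}\to G(\ell,k)$ is Hölder continuous and canceling in the sense that $$\bigcap_{\zeta\in S^{d-1}}\Omega(\zeta)=\{0\}.$$ Then the $a$-homogeneous Riesz potential $\mathrm{I}_{d/2}$ maps the $a$-homogeneous space $W_1^{\Omega,a}$ to $L_2$ continuously; that is, there is a constant $C$ such that for every $f\in W_1^{\Omega,a}$ one has $\mathrm{I}_{d/2}[f]\in L_2(\mathbb{R}^d,\mathbb{C}^\ell)$ and $\|\mathrm{I}_{d/2}[f]\|_{L_2(\mathbb{R}^d,\mathbb{C}^\ell)}\le C\|f\|_{L_1(\mathbb{R}^d,\mathbb{C}^\ell)}$.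
   Context: $S^{d-1}$ is the unit sphere in $\mathbb{R}^d$. $G(\ell,k)$ is the complex Grassmannian of all $k$-dimensional linear subspaces of $\mathbb{C}^\ell$, with the metric $\mathrm{dist}(L_1,L_2)=\|\pi_{L_1}-\pi_{L_2}\|_{\mathrm{HS}}$, where $\pi_L$ is the orthogonal projection of $\mathbb{C}^\ell$ onto $L$ and $\|\cdot\|_{\mathrm{HS}}$ is the Hilbert--Schmidt norm on $\ell\times\ell$ complex matrices. A map $F\colon M\to N$ between metric spaces is called Hölder continuous if there are $\alpha>0$ and $C$ such that $\mathrm{dist}_N(F(x),F(y))\le C\,\mathrm{dist}_M(x,y)^\alpha$ for all $x,y\in M$ with $\mathrm{dist}_M(x,y)\le 1$. The vector $a$ is called a pattern of homogeneity. The $a$-dilations are $\mathrm{Dil}_t(\xi)=(t^{-a_1}\xi_1,\dots,t^{-a_d}\xi_d)$, $t>0$. For $\xi\in\mathbb{R}^d\setminus\{0\}$, $\eta(\xi)>0$ is the unique number defined by $\sum_{j=1}^d \xi_j^2\,\eta(\xi)^{-2a_j}=1$, so that $\mathrm{Dil}_{\eta(\xi)}(\xi)\in S^{d-1}$. The space $W_1^{\Omega,a}$ is $$W_1^{\Omega,a}=\Big\{f\in L_1(\mathbb{R}^d,\mathbb{C}^\ell)\ \Big|\ \hat f(\xi)\in\Omega\big(\mathrm{Dil}_{\eta(\xi)}(\xi)\big)\ \text{ for all }\xi\in\mathbb{R}^d\setminus\{0\}\Big\},$$ with the norm inherited from $L_1(\mathbb{R}^d,\mathbb{C}^\ell)$.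 Here $\hat f$ is the Fourier transform (any fixed normalization), taken coordinatewise. For $\beta\in(0,d)$, the $a$-homogeneous Riesz potential is $\mathrm{I}_\beta[f]=\mathcal{F}^{-1}\big[\hat f(\xi)\,\eta(\xi)^{-\beta}\big]$, understood as a tempered distribution (applied coordinatewise). *)

(* Defs.v *)
From HB Require Import structures.
From mathcomp Require Import all_boot all_order all_algebra.
From mathcomp Require Import sesquilinear spectral complex.
From mathcomp Require Import all_classical all_reals all_analysis.

Set Implicit Arguments.
Unset Strict Implicit.
Unset Printing Implicit Defensive.

Import Order.TTheory GRing.Theory Num.Theory.
Import numFieldTopology.Exports numFieldNormedType.Exports.

Local Open Scope classical_set_scope.
Local Open Scope ring_scope.

Section row_vector_measurable.
Context (R : realType) (n : nat).

Let coord (i : 'I_n) (x : 'rV[R]_n) : R := x ord0 i.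

Let rv_set0 : g_sigma_preimage coord set0.
Proof. exact: sigma_algebra0. Qed.

Let rv_setC A : g_sigma_preimage coord A -> g_sigma_preimage coord (~` A).
Proof. exact: sigma_algebraC. Qed.

Let rv_bigcup (F : _^nat) : (forall i, g_sigma_preimage coord (F i)) ->
  g_sigma_preimage coord (\bigcup_i (F i)).
Proof. exact: sigma_algebra_bigcup. Qed.

(* The Borel sigma-algebra of R^n, as the product sigma-algebra. *)
HB.instance Definition _ := @isMeasurable.Build default_measure_display
  'rV[R]_n (g_sigma_preimage coord) rv_set0 rv_setC rv_bigcup.

End row_vector_measurable.

Section row_vector_measurable_theory.
Context (R : realType).

Lemma measurable_coord n (i : 'I_n) :
  measurable_fun [set: 'rV[R]_n] (fun x => x ord0 i).
Proof.
move=> _ Y mY; rewrite setTI; apply: sub_sigma_algebra => /=.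
rewrite -bigcup_seq/=; exists i => /=; first by rewrite mem_index_enum.
by exists Y => //; rewrite setTI.
Qed.

Lemma measurable_fun_coord d (T : measurableType d) n (f : T -> 'rV[R]_n) :
  (forall i, measurable_fun [set: T] (fun x => f x ord0 i)) ->
  measurable_fun [set: T] f.
Proof.
move=> mf.
have prefS : g_sigma_preimage (fun (i : 'I_n) => (fun x : 'rV[R]_n => x ord0 i) \o f)
    `<=` measurable.
  apply: smallest_sub; first exact: sigma_algebra_measurable.
  case: n => [|n] in f mf *; first by rewrite big_ord0.
  rewrite -bigcup_mkord_ord; apply: bigcup_sub => i Ii.
  by move=> A [B mB <-]; exact: mf.
move=> _ A mA; apply: prefS; rewrite g_sigma_preimage_comp.
by exists A.
Qed.

End row_vector_measurable_theory.

Section lebesgue_succ.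
Context (R : realType) (n : nat).
Context (m : {sigma_finite_measure set 'rV[R]_n -> \bar R}).

Local Notation T1 := (measurableTypeR R).
Local Notation mu :=
  (lebesgue_measure : {sigma_finite_measure set T1 -> \bar R}).

Let rv_cons (p : T1 * 'rV[R]_n) : 'rV[R]_n.+1 :=
  \row_i oapp (p.2 ord0) p.1 (unlift ord0 i).

Let rv_uncons (x : 'rV[R]_n.+1) : T1 * 'rV[R]_n :=
  (x ord0 ord0, \row_j x ord0 (lift ord0 j)).

Let rv_consK : cancel rv_cons rv_uncons.
Proof.
move=> [t x]; rewrite /rv_uncons /rv_cons mxE unlift_none; congr pair.
by apply/rowP => j; rewrite !mxE liftK.
Qed.

Let rv_unconsK : cancel rv_uncons rv_cons.
Proof.
move=> x; apply/rowP => i; rewrite mxE.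
by have [j ->|->] := unliftP ord0 i; rewrite ?liftK ?unlift_none/= ?mxE.
Qed.

Let measurable_rv_cons : measurable_fun [set: T1 * 'rV[R]_n] rv_cons.
Proof.
apply: measurable_fun_coord => i; under eq_fun do rewrite mxE.
have [j _|_] //= := unliftP ord0 i.
  exact: (measurableT_comp (measurable_coord j)).
exact: measurable_fst.
Qed.

Let measurable_rv_uncons : measurable_fun [set: 'rV[R]_n.+1] rv_uncons.
Proof.
apply: measurable_fun_pair => /=; first exact: measurable_coord.
apply: measurable_fun_coord => j; under eq_fun do rewrite mxE.
exact: measurable_coord.
Qed.

(* The product of the Lebesgue measure on R and m, transported along the
   isomorphism of R * R^n with R^(n+1). *)
Definition lebesgue_succ : set 'rV[R]_n.+1 -> \bar R :=
  pushforward (mu \x m)%E rv_cons.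

HB.instance Definition _ := Measure.copy lebesgue_succ
  (measure_function_pushforward__canonical__measure_function_Measure
    (mu \x m)%E measurable_rv_cons).

Let lebesgue_succ_sigma_finite : sigma_finite setT lebesgue_succ.
Proof.
have /sigma_finiteP[F [TF ndF Foo]] := sigma_finiteT mu.
have /sigma_finiteP[G [TG ndG Goo]] := sigma_finiteT m.
exists (fun k => rv_uncons @^-1` (F k `*` G k)).
  rewrite -preimage_bigcup (_ : \bigcup_k _ = setT) ?preimage_setT//.
  apply/seteqP; split => // -[t x] _.
  have [i _ Fit] : (\bigcup_k F k) t by rewrite -TF.
  have [j _ Gjx] : (\bigcup_k G k) x by rewrite -TG.
  exists (maxn i j) => //; split.
    by move: t Fit; exact/subsetPset/ndF/leq_maxl.
  by move: x Gjx; exact/subsetPset/ndG/leq_maxr.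
move=> k; have [mF Fk] := Foo k; have [mG Gk] := Goo k; split.
  rewrite -[X in measurable X]setTI; apply: measurable_rv_uncons => //.
  exact: measurableX.
rewrite /lebesgue_succ /pushforward -comp_preimage.
rewrite (_ : rv_uncons \o rv_cons = id); last exact/funext.
by rewrite preimage_id product_measure1E// lte_mul_pinfty// ge0_fin_numE.
Qed.

HB.instance Definition _ := Measure_isSigmaFinite.Build _ _ _
  lebesgue_succ lebesgue_succ_sigma_finite.

Lemma lebesgue_succE (A : 'I_n.+1 -> set R) :
  (forall i, measurable (A i)) ->
  lebesgue_succ [set x : 'rV[R]_n.+1 | forall i, A i (x ord0 i)] =
  (mu (A ord0) *
   m [set x : 'rV[R]_n | forall i : 'I_n, A (lift ord0 i) (x ord0 i)])%E.
Proof.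
move=> mA; set B := (B in (_ * m B)%E).
have mB : measurable B.
  rewrite (_ : B = \bigcap_(i in [set: 'I_n])
      ((fun x : 'rV[R]_n => x ord0 i) @^-1` A (lift ord0 i))).
    apply: fin_bigcap_measurable => [|i _]; first exact: finite_finset.
    by rewrite -[X in measurable X]setTI; exact: measurable_coord.
  by apply/seteqP; split => x Bx i => [_|]; exact: Bx.
rewrite /lebesgue_succ -product_measure1E//; last exact: (mA ord0).
rewrite /pushforward; congr (product_measure1 _ _ _); apply/seteqP; split => [[t x] /= Ax|[t x] /= [At Bx] i].
  split; first by have := Ax ord0; rewrite mxE unlift_none.
  by move=> i; have := Ax (lift ord0 i); rewrite mxE liftK.
by rewrite mxE; have [j ->|->] := unliftP ord0 i; [exact: Bx|exact: At].
Qed.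

End lebesgue_succ.

Fixpoint lebesgue_rv (R : realType) (n : nat) :
    {sigma_finite_measure set 'rV[R]_n -> \bar R} :=
  match n with
  | 0 => dirac (0 : 'rV[R]_0)
  | n'.+1 => lebesgue_succ (lebesgue_rv R n')
  end.

(* The defining property of the Lebesgue measure on R^n. *)
Lemma lebesgue_rv_box (R : realType) n (A : 'I_n -> set R) :
  (forall i, measurable (A i)) ->
  lebesgue_rv R n [set x : 'rV[R]_n | forall i, A i (x ord0 i)] =
  (\prod_(i < n) lebesgue_measure (A i))%E.
Proof.
elim: n A => [|n ih] A mA.
  by rewrite big_ord0 /= diracE mem_set// => -[].
by rewrite big_ord_recl /= lebesgue_succE//; congr (_ * _)%E; exact: ih.
Qed.

Section euclidean.
Context (R : realType).

Definition dotp d (x y : 'rV[R]_d) : R := \sum_j x ord0 j * y ord0 j.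

Definition enorm d (x : 'rV[R]_d) : R := Num.sqrt (dotp x x).

Definition unit_sphere d : set 'rV[R]_d := [set x | enorm x = 1].

(* On C^l = 'rV[R[i]]_l this is the Hermitian norm. *)
Definition hs_norm m n (A : 'M[R[i]]_(m, n)) : R :=
  Num.sqrt (\sum_i \sum_j (complex.Re (A i j) ^+ 2 + complex.Im (A i j) ^+ 2)).

End euclidean.

Definition hoelder_continuous (R : realType) (M N : Type)
    (distM : M -> M -> R) (distN : N -> N -> R) (D : set M) (F : M -> N) :=
  exists2 alpha : R, 0 < alpha & exists C : R, forall x y, D x -> D y ->
    distM x y <= 1 -> distN (F x) (F y) <= C * distM x y `^ alpha.

Section grassmannian.
Context (R : realType) (l : nat).
Implicit Types L : {vspace 'rV[R[i]]_l}.

Definition grassmannian (k : nat) : set {vspace 'rV[R[i]]_l} :=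
  [set L | \dim L = k].

(* Acts on row vectors, v |-> v *m ortho_proj L. *)
Definition ortho_proj L : 'M[R[i]]_l :=
  proj_ortho (\matrix_(i < \dim L) (vbasis L)`_i).

Definition grass_dist L1 L2 : R := hs_norm (ortho_proj L1 - ortho_proj L2).

End grassmannian.

Section homogeneity.
Context (R : realType) (d : nat).
Implicit Types a xi : 'rV[R]_d.

Definition dil a (t : R) xi : 'rV[R]_d :=
  \row_j (t `^ (- a ord0 j) * xi ord0 j).

(* For positive a and nonzero xi this set is a singleton, the sum decreasing
   from +oo to 0 as t ranges over ]0, +oo[. *)
Definition eta a xi : R := xget 1
  [set t : R | 0 < t /\
    \sum_j xi ord0 j ^+ 2 * t `^ (- (2 * a ord0 j)) = 1].

End homogeneity.

Section lebesgue_spaces.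
Context (R : realType) (d l : nat).
Implicit Types f : 'rV[R]_d -> 'rV[R[i]]_l.

Definition measurable_cvect f := forall j,
  measurable_fun setT (fun x => complex.Re (f x ord0 j)) /\
  measurable_fun setT (fun x => complex.Im (f x ord0 j)).

Definition Lp_norm (p : \bar R) f : \bar R :=
  'N[lebesgue_rv R d]_p[EFin \o (hs_norm (n:=l) \o f)].

(* Elements are Borel functions, not classes modulo a.e. equality; each class of
   Lebesgue measurable functions has such a representative. *)
Definition Lp (p : \bar R) : set ('rV[R]_d -> 'rV[R[i]]_l) :=
  [set f | measurable_cvect f /\ (Lp_norm p f < +oo)%E].

End lebesgue_spaces.

Section fourier.
Context (R : realType) (d : nat).

Definition cintegral (h : 'rV[R]_d -> R[i]) : R[i] :=
  Complex (\int[lebesgue_rv R d]_x complex.Re (h x))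
          (\int[lebesgue_rv R d]_x complex.Im (h x)).

Definition cexpi (t : R) : R[i] := Complex (cos t) (sin t).

Definition fourier (h : 'rV[R]_d -> R[i]) (xi : 'rV[R]_d) : R[i] :=
  cintegral (fun x => h x * cexpi (- (2 * pi * dotp x xi))).

Definition inv_fourier (h : 'rV[R]_d -> R[i]) (x : 'rV[R]_d) : R[i] :=
  cintegral (fun xi => h xi * cexpi (2 * pi * dotp x xi)).

Definition vect_fourier l (f : 'rV[R]_d -> 'rV[R[i]]_l) (xi : 'rV[R]_d) :
  'rV[R[i]]_l := \row_j fourier (fun x => f x ord0 j) xi.

End fourier.

Section distributions.
Context (R : realType) (d : nat).

Definition partial (j : 'I_d) (h : 'rV[R]_d -> R) : 'rV[R]_d -> R :=
  fun x => 'D_(delta_mx ord0 j) h x.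

Definition partials (s : seq 'I_d) (h : 'rV[R]_d -> R) : 'rV[R]_d -> R :=
  foldr partial h s.

Definition real_schwartz (h : 'rV[R]_d -> R) := forall s : seq 'I_d,
  (forall x, differentiable (partials s h) x) /\
  (forall N : nat, exists M : R, forall x,
     (1 + enorm x) ^+ N * `|partials s h x| <= M).

Definition schwartz (phi : 'rV[R]_d -> R[i]) :=
  real_schwartz (fun x => complex.Re (phi x)) /\
  real_schwartz (fun x => complex.Im (phi x)).

(* C^l-valued tempered distributions, as functionals of which only the values
   at Schwartz functions matter (see eq_distr). The pairing is bilinear, without
   conjugation, so that F^-1 is its own transpose. *)
Definition distr l := ('rV[R]_d -> R[i]) -> 'rV[R[i]]_l.

Definition eq_distr l (u v : distr l) :=
  forall phi, schwartz phi -> u phi = v phi.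

Definition regular_distr l (f : 'rV[R]_d -> 'rV[R[i]]_l) :
  distr l := fun phi => \row_j cintegral (fun x => f x ord0 j * phi x).

Definition inv_fourier_distr l (u : distr l) : distr l :=
  fun phi => u (inv_fourier phi).

(* eta ^ -beta is locally integrable for 0 <= beta < d when the coordinates of a
   are positive and sum to d; its value at xi = 0 is irrelevant. *)
Definition riesz_potential l (a : 'rV[R]_d) (beta : R)
    (f : 'rV[R]_d -> 'rV[R[i]]_l) : distr l :=
  inv_fourier_distr (regular_distr
    (fun xi => Complex (eta a xi `^ (- beta)) 0 *: vect_fourier f xi)).

End distributions.

Definition W1 (R : realType) (d l : nat)
    (Omega : 'rV[R]_d -> {vspace 'rV[R[i]]_l}) (a : 'rV[R]_d) :
    set ('rV[R]_d -> 'rV[R[i]]_l) :=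
  [set f | Lp 1 f /\
    forall xi, xi != 0 -> vect_fourier f xi \in Omega (dil a (eta a xi) xi)].

(* Main.v *)
Require Import Defs.
From mathcomp Require Import all_boot all_order all_algebra.
From mathcomp Require Import sesquilinear spectral complex.
From mathcomp Require Import all_classical all_reals all_analysis.
From mathcomp Require Import measurable_realfun ring lra.

Set Implicit Arguments.
Unset Strict Implicit.
Unset Printing Implicit Defensive.

Import Order.TTheory GRing.Theory Num.Theory.
Import numFieldTopology.Exports numFieldNormedType.Exports.

Local Open Scope classical_set_scope.
Local Open Scope ring_scope.

(** Let [w] be a radial cutoff of a shell, [theta xi := Dil_(eta xi) xi], and
    [P xi] the projection off [Omega (theta xi)].  Cancellation makes
    [A := \int w P] invertible, so [M := w (1 - (\int w) P A^-1)] is Hoelder,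
    compactly supported and of mean zero, while [v M xi = w xi v] for [v] in
    [Omega (theta xi)].  Mean zero and Hoelder continuity make the Fourier
    transform of [M] of size [x / (1 + x)^2] with [x = |z|^b], so that the sum
    over dyadic dilations [\sum_i 2^(-i d) M (Dil_(2^i) xi)], whose associated
    weight is comparable to [eta^-d], has a bounded Fourier transform.  Pairing
    it with [f] and [conj f] turns [\int |fhat|^2 eta^-d] into a double integral
    of [f(x) conj f(y)] against a bounded kernel, which is [O(||f||_1^2)].
    The potential itself is then recovered by extending the inverse Fourier
    transform from truncations to [L_2]. *)

(** The estimate is critical. Each dyadic dilate carries exactly its own Jacobian, so its Fourier
    transform is that of the profile at a moved point, with no factor depending on the scale. For
    the scalar profile [w] every sufficiently small scale therefore contributes about [\int w] to
    the kernel at a given [z]: the sum over scales is unbounded, and pairing it with [L_1] functions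
    gives nothing. The transform of [f] takes its values in [Omega], so the scalar weight may be
    exchanged for any matrix symbol that acts in the same way on [Omega]. Making the mean vanish
    removes the constant contribution of the small scales, and this is exactly what cancellation
    allows; Hoelder regularity makes the large scales summable. Sums over scales stay finite
    throughout, with bounds uniform in their length, and Fatou's lemma recovers the full weight.
    Plancherel's theorem enters only as a one-sided bound with an unspecified constant, obtained
    from Schur's test for an explicit window. *)

(** * Lebesgue integration on [R^n]: slices, affine changes of variables, tensors *)

Section product_coordinates.
Context (R : realType).

(** Repeats the map behind [lebesgue_succ], which is local to its section, so that [lebesgue_rvS]
    holds by conversion. *)
Definition rvcons n (p : measurableTypeR R * 'rV[R]_n) : 'rV[R]_n.+1 :=
  \row_i oapp (p.2 ord0) p.1 (unlift ord0 i).

Lemma rvcons0 n t (x : 'rV[R]_n) : rvcons (t, x) ord0 ord0 = t.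
Proof. by rewrite mxE unlift_none. Qed.

Lemma rvconsS n t (x : 'rV[R]_n) i : rvcons (t, x) ord0 (lift ord0 i) = x ord0 i.
Proof. by rewrite mxE liftK. Qed.

Lemma measurable_rvcons n : measurable_fun setT (@rvcons n).
Proof.
apply: measurable_fun_coord => i; under eq_fun do rewrite mxE.
have [j _|_] //= := unliftP ord0 i.
  exact: (measurableT_comp (measurable_coord j)).
exact: measurable_fst.
Qed.

Lemma lebesgue_rvS n :
  (lebesgue_rv R n.+1 : set _ -> \bar R) =
  pushforward (@lebesgue_measure R \x lebesgue_rv R n)%E (@rvcons n).
Proof. by []. Qed.

Lemma ge0_integral_rvS n (f : 'rV[R]_n.+1 -> \bar R) :
  measurable_fun setT f -> (forall x, 0 <= f x)%E ->
  (\int[lebesgue_rv R n.+1]_x f x =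
   \int[lebesgue_measure]_t \int[lebesgue_rv R n]_x f (rvcons (t, x)))%E.
Proof.
move=> mf f0; rewrite lebesgue_rvS.
rewrite (ge0_integral_pushforward (@measurable_rvcons n))//.
rewrite preimage_setT fubini_tonelli1//.
  exact: measurableT_comp mf (@measurable_rvcons n).
by move=> p; exact: f0.
Qed.

Lemma integrable_rvS n (f : 'rV[R]_n.+1 -> \bar R) :
  measurable_fun setT f ->
  (lebesgue_measure \x lebesgue_rv R n)%E.-integrable setT (f \o @rvcons n) ->
  (lebesgue_rv R n.+1).-integrable setT f.
Proof.
move=> mf fi.
apply: (@integrable_pushforward _ _ _ _ R _ (@measurable_rvcons n)) => //.
Qed.

Lemma integral_rvS n (f : 'rV[R]_n.+1 -> \bar R) :
  measurable_fun setT f ->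
  (lebesgue_measure \x lebesgue_rv R n)%E.-integrable setT (f \o @rvcons n) ->
  (\int[lebesgue_rv R n.+1]_x f x =
   \int[lebesgue_measure]_t \int[lebesgue_rv R n]_x f (rvcons (t, x)))%E.
Proof.
move=> mf fi; rewrite lebesgue_rvS.
rewrite (integral_pushforward (@measurable_rvcons n))//.
by rewrite preimage_setT -integral12_prod_meas1.
Qed.

End product_coordinates.

Section change_of_variables.
Context (R : realType).
Local Notation leb := (@lebesgue_measure R).

Let aff1 (c h t : R) : measurableTypeR R := c * t + h.

Let measurable_aff1 c h : measurable_fun setT (aff1 c h : measurableTypeR R -> _).
Proof. by apply: measurable_funD => //; exact: measurable_funM. Qed.

Lemma ge0_integral_affine1 (c h : R) (f : measurableTypeR R -> \bar R) : 0 < c ->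
  measurable_fun setT f -> (forall x, 0 <= f x)%E ->
  (\int[leb]_t f t = c%:E * \int[leb]_t f (c * t + h)%R)%E.
Proof.
move=> c0 mf f0.
pose mu' := measure_function_pushforward__canonical__measure_function_Measure
  leb (@measurable_aff1 c h).
pose nu := mscale (NngNum (ltW c0)) mu'.
(* [nu] is [c] times the image of Lebesgue measure under [t |-> c * t + h]; it gives half-open
   intervals their length, so uniqueness of Lebesgue measure identifies the two. *)
have nuE A : measurable A -> nu A = leb A.
  move=> mA; symmetry.
  apply: (@lebesgue_measure_unique R nu) => //= _ [[a b]] _ <-.
  rewrite /nu /= /mscale /= /pushforward.
  have -> : aff1 c h @^-1` `]a, b] = `](a - h) / c, (b - h) / c]%classic.
    apply/seteqP; split => x /=; rewrite !in_itv/= /aff1 ltr_pdivrMr// ler_pdivlMr//;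
     by rewrite ltrBlDr lerBrDr (mulrC x).
  rewrite !lebesgue_measure_itv/= !lte_fin ltr_pM2r ?invr_gt0// ltrD2r.
  case: ifPn => _; last by rewrite mule0.
  rewrite -!EFinD -EFinM; congr EFin.
  by field; rewrite gt_eqF.
transitivity (\int[nu]_t f t)%E.
  by apply: eq_measure_integral => A mA _; exact: esym (nuE A mA).
rewrite ge0_integral_mscale//; congr (_ * _)%E.
by rewrite (ge0_integral_pushforward (@measurable_aff1 c h)).
Qed.

(** A diagonal scaling with a shift: one change of variables covers anisotropic dilations, isotropic
    rescalings of windows and translations. *)
Definition affine n (c h x : 'rV[R]_n) : 'rV[R]_n :=
  \row_j (c ord0 j * x ord0 j + h ord0 j).

Lemma measurable_affine n (c h : 'rV[R]_n) : measurable_fun setT (affine c h).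
Proof.
apply: measurable_fun_coord => i; under eq_fun do rewrite mxE.
by apply: measurable_funD => //; apply: measurable_funM => //; exact: measurable_coord.
Qed.

Lemma affine_rvcons n (c h : 'rV[R]_n.+1) t x :
  affine c h (rvcons (t, x)) = rvcons (c ord0 ord0 * t + h ord0 ord0,
    affine (\row_j c ord0 (lift ord0 j)) (\row_j h ord0 (lift ord0 j)) x).
Proof.
apply/rowP => i; rewrite mxE.
have [j ->|->] := unliftP ord0 i; first by rewrite !rvconsS !mxE.
by rewrite !rvcons0.
Qed.

(** Induction on the dimension: Tonelli splits off the first coordinate, where the one-dimensional
    formula applies, and the inner integral falls under the induction hypothesis. *)
Lemma ge0_integral_affine n (c h : 'rV[R]_n) (f : 'rV[R]_n -> \bar R) :
  (forall j, 0 < c ord0 j) ->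
  measurable_fun setT f -> (forall x, 0 <= f x)%E ->
  (\int[lebesgue_rv R n]_x f x =
   (\prod_j c ord0 j)%:E * \int[lebesgue_rv R n]_x f (affine c h x))%E.
Proof.
elim: n c h f => [|n ih] c h f c0 mf f0.
  rewrite big_ord0 mul1e; apply: eq_integral => x _; congr f.
  by apply/rowP => -[].
have mfa : measurable_fun setT (f \o affine c h).
  exact: measurableT_comp mf (measurable_affine c h).
rewrite ge0_integral_rvS// [in RHS]ge0_integral_rvS//.
rewrite big_ord_recl EFinM.
set c' := \row_j c ord0 (lift ord0 j); set h' := \row_j h ord0 (lift ord0 j).
have mF : measurable_fun setT
    (fun t : measurableTypeR R => \int[lebesgue_rv R n]_x f (rvcons (t, x)))%E.
  apply: (measurable_fun_fubini_tonelli_F (f \o @rvcons R n)).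
    exact: measurableT_comp mf (@measurable_rvcons R n).
  by move=> p; exact: f0.
rewrite [LHS](@ge0_integral_affine1 (c ord0 ord0) (h ord0 ord0) _ (c0 ord0) mF); last first.
  by move=> t; exact: integral_ge0.
rewrite -muleA; congr (_ * _)%E.
rewrite -ge0_integralZl//; last 3 first.
- apply: (measurable_fun_fubini_tonelli_F (f \o affine c h \o @rvcons R n)).
    exact: measurableT_comp mfa (@measurable_rvcons R n).
  by move=> p; exact: f0.
- by move=> t _; exact: integral_ge0.
- by rewrite lee_fin; apply: prodr_ge0 => i _; exact: ltW.
apply: eq_integral => t _.
rewrite (ih c' h' (fun x => f (rvcons (_, x))))//; last 2 first.
- by move=> j; rewrite mxE.
- apply: (measurableT_comp mf); apply: (measurableT_comp (@measurable_rvcons R n)).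
  exact: pair1_measurable.
congr (_ * _)%E; first by congr EFin; apply: eq_bigr => j _; rewrite mxE.
by apply: eq_integral => x _; rewrite affine_rvcons.
Qed.

End change_of_variables.

Section tensor.
Context (R : realType).
Local Notation leb := (@lebesgue_measure R).

Lemma ge0_integral_tensor n (g : 'I_n -> R -> R) :
  (forall j, measurable_fun setT (g j)) -> (forall j t, 0 <= g j t) ->
  (\int[lebesgue_rv R n]_x (\prod_j g j (x ord0 j))%:E =
   \prod_j \int[leb]_t (g j t)%:E)%E.
Proof.
elim: n g => [|n ih] g mg g0.
  rewrite big_ord0 (_ : (fun x => _) = cst 1%E); last first.
    by apply/funext => x; rewrite big_ord0.
  by rewrite integral_cst//= diracT mule1.
have mp m (k : 'I_m -> R -> R) : (forall j, measurable_fun setT (k j)) ->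
    measurable_fun setT (fun x : 'rV[R]_m => \prod_j k j (x ord0 j)).
  move=> mk; apply: measurable_prod => j _.
  exact: measurableT_comp (mk j) (measurable_coord j).
rewrite ge0_integral_rvS//; last 2 first.
- by apply/measurable_EFinP; exact: mp.
- by move=> x; rewrite lee_fin; apply: prodr_ge0.
rewrite big_ord_recl -(ih (fun j => g (lift ord0 j)))//.
rewrite -ge0_integralZr//; last 3 first.
- by apply/measurable_EFinP; exact: mg.
- by move=> t _; rewrite lee_fin.
- by apply: integral_ge0 => x _; rewrite lee_fin; apply: prodr_ge0.
apply: eq_integral => t _.
rewrite -ge0_integralZl//.
- apply: eq_integral => x _; rewrite big_ord_recl rvcons0 EFinM; congr (_ * _)%E.
  by congr EFin; apply: eq_bigr => j _; rewrite rvconsS.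
- by apply/measurable_EFinP; exact: (mp n (fun j => g (lift ord0 j))).
- by move=> x _; rewrite lee_fin; apply: prodr_ge0.
- by rewrite lee_fin.
Qed.

End tensor.

(** * Complex-valued functions: modulus, measurability, integrals *)

Section complex_modulus.
Context (R : realType).
Implicit Types z w : R[i].

(* Equivalent to the modulus; used because it is submultiplicative and free of
   square roots. *)
Definition cnorm1 z : R := `|complex.Re z| + `|complex.Im z|.

Lemma cnorm1_ge0 z : 0 <= cnorm1 z.
Proof. by rewrite addr_ge0. Qed.

Lemma cnorm1_0 : cnorm1 0 = 0.
Proof. by rewrite /cnorm1 /= normr0 addr0. Qed.

Lemma cnorm1D z w : cnorm1 (z + w) <= cnorm1 z + cnorm1 w.
Proof.
case: z w => [a b] [c e]; rewrite /cnorm1 /= addrACA.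
by rewrite lerD// ler_normD.
Qed.

Lemma cnorm1N z : cnorm1 (- z) = cnorm1 z.
Proof. by case: z => a b; rewrite /cnorm1 /= !normrN. Qed.

Lemma cnorm1B z w : cnorm1 (z - w) <= cnorm1 z + cnorm1 w.
Proof. by rewrite (le_trans (cnorm1D _ _))// cnorm1N. Qed.

Lemma cnorm1M z w : cnorm1 (z * w) <= cnorm1 z * cnorm1 w.
Proof.
case: z w => [a b] [c e]; rewrite /cnorm1 /=.
have := ler_normB (a * c) (b * e); have := ler_normD (a * e) (b * c).
by rewrite !normrM; nra.
Qed.

Lemma cnorm1J z : cnorm1 (conjc z) = cnorm1 z.
Proof. by case: z => a b; rewrite /cnorm1 /= normrN. Qed.

Lemma cnorm1_sum I (r : seq I) (P : pred I) (F : I -> R[i]) :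
  cnorm1 (\sum_(i <- r | P i) F i) <= \sum_(i <- r | P i) cnorm1 (F i).
Proof.
elim/big_ind2 : _ => //; first by rewrite cnorm1_0.
by move=> x1 x2 y1 y2 h1 h2; rewrite (le_trans (cnorm1D _ _))// lerD.
Qed.

Lemma cnorm1_cexpi t : cnorm1 (cexpi t) <= 2.
Proof. by rewrite /cnorm1 /= -[2]/(1 + 1) lerD// ler_norml ?cos_le1 ?cos_geN1 ?sin_le1 ?sin_geN1. Qed.

Lemma cnorm1_real (x : R) : cnorm1 (x%:C)%C = `|x|.
Proof. by rewrite /cnorm1 /= normr0 addr0. Qed.

Definition cnormsq z : R := complex.Re z ^+ 2 + complex.Im z ^+ 2.

Lemma cnormsq_ge0 z : 0 <= cnormsq z.
Proof. by rewrite addr_ge0 ?sqr_ge0. Qed.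

Lemma cnormsq_le z : cnormsq z <= cnorm1 z ^+ 2.
Proof.
rewrite /cnormsq /cnorm1 -(real_normK (num_real (complex.Re z))) -(real_normK (num_real (complex.Im z))).
have := normr_ge0 (complex.Re z); have := normr_ge0 (complex.Im z); nra.
Qed.

Lemma cnorm1_sqr_le z : cnorm1 z ^+ 2 <= 2 * cnormsq z.
Proof.
rewrite /cnormsq /cnorm1 -(real_normK (num_real (complex.Re z))) -(real_normK (num_real (complex.Im z))).
by have := sqr_ge0 (`|complex.Re z| - `|complex.Im z|); nra.
Qed.

Lemma mulcJ z : z * conjc z = ((cnormsq z)%:C)%C.
Proof. by case: z => a b; apply/eqP; rewrite eq_complex /= /cnormsq /=; apply/andP; split; apply/eqP; ring. Qed.

Lemma conjcM z w : conjc (z * w) = conjc z * conjc w.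
Proof. exact: rmorphM. Qed.

Lemma conjcD z w : conjc (z + w) = conjc z + conjc w.
Proof. exact: rmorphD. Qed.

Lemma Re_add z w : complex.Re (z + w) = complex.Re z + complex.Re w.
Proof. by case: z w => [a b] []. Qed.

Lemma Im_add z w : complex.Im (z + w) = complex.Im z + complex.Im w.
Proof. by case: z w => [a b] []. Qed.

Lemma Re_mul z w : complex.Re (z * w) =
  complex.Re z * complex.Re w - complex.Im z * complex.Im w.
Proof. by case: z w => [a b] []. Qed.

Lemma Im_mul z w : complex.Im (z * w) =
  complex.Re z * complex.Im w + complex.Im z * complex.Re w.
Proof. by case: z w => [a b] [c e] /=; rewrite [in RHS]addrC [in RHS]addrC. Qed.

Lemma cexpiD s t : cexpi (s + t) = cexpi s * cexpi t :> R[i].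
Proof.
apply/eqP; rewrite eq_complex /= cosD sinD; apply/andP; split; apply/eqP => //.
by rewrite addrC.
Qed.

Lemma conjc_cexpi t : conjc (cexpi t) = cexpi (- t) :> R[i].
Proof. by apply/eqP; rewrite eq_complex /= cosN sinN !eqxx. Qed.

Lemma cexpi0 : cexpi 0 = 1 :> R[i].
Proof. by apply/eqP; rewrite eq_complex /= cos0 sin0 !eqxx. Qed.

(** The mean value theorem, applied to cosine and sine separately; each contributes [|t|] to
    [cnorm1]. *)
Lemma cexpi_sub1_le t : cnorm1 (cexpi t - 1 : R[i]) <= 2 * `|t|.
Proof.
have key (f : R -> R) (f' : R -> R) : (forall x : R, is_derive x (1 : R) f (f' x)) ->
    (forall x, `|f' x| <= 1) -> `|f t - f 0| <= `|t|.
  move=> df f1.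
  have cf u v : {within `[u, v], continuous f}.
    by apply: derivable_within_continuous => x _; case: (df x).
  have [t0|t0] := leP 0 t.
    have [c _ ->] : exists2 c, c \in `[0, t]%R & f t - f 0 = f' c * (t - 0).
      by apply: MVT_segment.
    by rewrite subr0 normrM ler_piMl.
  have [c _ e] : exists2 c, c \in `[t, 0]%R & f 0 - f t = f' c * (0 - t).
    by apply: MVT_segment => //; exact: ltW.
  by rewrite distrC e normrM sub0r normrN ler_piMl.
have /= := key cos (fun x => - sin x) (fun x => is_derive_cos x).
have /= := key sin cos (fun x => is_derive_sin x).
rewrite cos0 sin0 subr0 => hs hc.
have {}hs := hs (fun x => _); have {}hc := hc (fun x => _).
rewrite /cnorm1 /= oppr0 addr0 mulr2n mulrDl mul1r addrC lerD//.
  by apply: hs => x; rewrite ler_norml cos_le1 cos_geN1.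
by apply: hc => x; rewrite normrN ler_norml sin_le1 sin_geN1.
Qed.

End complex_modulus.

Section complex_measurable.
Context (R : realType) d (T : measurableType d).
Implicit Types f g : T -> R[i].

Definition cmeasurable f :=
  measurable_fun setT (fun x => complex.Re (f x)) /\
  measurable_fun setT (fun x => complex.Im (f x)).

Lemma cmeasurable_cst z : cmeasurable (fun=> z).
Proof. by split; exact: measurable_cst. Qed.

Lemma cmeasurableD f g : cmeasurable f -> cmeasurable g ->
  cmeasurable (fun x => f x + g x).
Proof.
move=> [f1 f2] [g1 g2]; split.
  by under eq_fun do rewrite Re_add; exact: measurable_funD.
by under eq_fun do rewrite Im_add; exact: measurable_funD.
Qed.

Lemma cmeasurableM f g : cmeasurable f -> cmeasurable g ->
  cmeasurable (fun x => f x * g x).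
Proof.
move=> [f1 f2] [g1 g2]; split.
  under eq_fun do rewrite Re_mul.
  by apply: measurable_funB; exact: measurable_funM.
under eq_fun do rewrite Im_mul.
by apply: measurable_funD; exact: measurable_funM.
Qed.

Lemma cmeasurableJ f : cmeasurable f -> cmeasurable (fun x => conjc (f x)).
Proof.
move=> [f1 f2]; split.
  by rewrite (_ : (fun x => _) = (fun x => complex.Re (f x)))//; apply/funext => x; case: (f x).
rewrite (_ : (fun x => _) = (fun x => - complex.Im (f x))).
  exact: measurableT_comp.
by apply/funext => x; case: (f x).
Qed.

Lemma cmeasurableN f : cmeasurable f -> cmeasurable (fun x => - f x).
Proof.
move=> mf; rewrite (_ : (fun x => _) = (fun x => (-1) * f x)).
  by apply: cmeasurableM => //; exact: cmeasurable_cst.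
by apply/funext => x; rewrite mulN1r.
Qed.

Lemma cmeasurableB f g : cmeasurable f -> cmeasurable g ->
  cmeasurable (fun x => f x - g x).
Proof. by move=> mf mg; apply: cmeasurableD => //; exact: cmeasurableN. Qed.

Lemma cmeasurable_real (f : T -> R) : measurable_fun setT f ->
  cmeasurable (fun x => ((f x)%:C)%C).
Proof. by move=> mf; split => //=; exact: measurable_cst. Qed.

Lemma cmeasurable_cexpi (f : T -> R) : measurable_fun setT f ->
  cmeasurable (fun x => cexpi (f x)).
Proof.
move=> mf; split => /=; apply: measurableT_comp mf.
  by apply: continuous_measurable_fun; exact: continuous_cos.
by apply: continuous_measurable_fun; exact: continuous_sin.
Qed.

Lemma cmeasurable_cnorm1 f : cmeasurable f -> measurable_fun setT (fun x => cnorm1 (f x)).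
Proof.
by move=> [f1 f2]; apply: measurable_funD; apply: measurableT_comp.
Qed.

Lemma cmeasurable_cnormsq f : cmeasurable f -> measurable_fun setT (fun x => cnormsq (f x)).
Proof.
by move=> [f1 f2]; apply: measurable_funD; apply: measurable_funX.
Qed.

End complex_measurable.

Lemma cmeasurable_comp (R : realType) d (T : measurableType d)
    d' (T' : measurableType d') (f : T -> R[i]) (g : T' -> T) :
  cmeasurable f -> measurable_fun setT g -> cmeasurable (f \o g).
Proof. by move=> [f1 f2] mg; split; [exact: measurableT_comp f1 mg|exact: measurableT_comp f2 mg]. Qed.

Section complex_integral.
Context (R : realType) d (T : measurableType d) (mu : {measure set T -> \bar R}).
Implicit Types f g : T -> R[i].

(** Convertible to [cintegral] for Lebesgue measure on [R^d]; the general measure also covers the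
    one-dimensional factors of a tensor product. *)
Definition cint f : R[i] :=
  Complex (\int[mu]_x complex.Re (f x)) (\int[mu]_x complex.Im (f x)).

Definition cintegrable f :=
  mu.-integrable setT (fun x => (complex.Re (f x))%:E) /\
  mu.-integrable setT (fun x => (complex.Im (f x))%:E).

Lemma cintegrable_cmeasurable f : cintegrable f -> cmeasurable f.
Proof.
by move=> [/integrableP[f1 _] /integrableP[f2 _]]; split; exact/measurable_EFinP.
Qed.

Lemma cintegrable_dominated f (g : T -> R) : cmeasurable f ->
  mu.-integrable setT (EFin \o g) -> (forall x, cnorm1 (f x) <= g x) -> cintegrable f.
Proof.
move=> [m1 m2] ig fg; split.
  apply: (le_integrable measurableT _ _ ig); first exact/measurable_EFinP.
  move=> x _ /=; rewrite lee_fin (le_trans _ (ler_norm _))// (le_trans _ (fg x))//.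
  by rewrite /cnorm1 lerDl.
apply: (le_integrable measurableT _ _ ig); first exact/measurable_EFinP.
move=> x _ /=; rewrite lee_fin (le_trans _ (ler_norm _))// (le_trans _ (fg x))//.
by rewrite /cnorm1 lerDr.
Qed.

Lemma cintegrable_cnorm1 f : cintegrable f ->
  mu.-integrable setT (fun x => (cnorm1 (f x))%:E).
Proof.
move=> [f1 f2].
rewrite (_ : (fun x => _) = (fun x => `|(complex.Re (f x))%:E| + `|(complex.Im (f x))%:E|)%E)//.
by apply: integrableD => //; exact: integrable_abse.
Qed.

Lemma cintegrableP f : cmeasurable f ->
  (\int[mu]_x (cnorm1 (f x))%:E < +oo)%E -> cintegrable f.
Proof.
move=> mf fo; apply: (cintegrable_dominated (g := fun x => cnorm1 (f x))) => //.
apply/integrableP; split.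
  by apply/measurable_EFinP; exact: cmeasurable_cnorm1.
by under eq_integral do rewrite /= ger0_norm ?cnorm1_ge0//.
Qed.

Lemma cintegrableD f g : cintegrable f -> cintegrable g ->
  cintegrable (fun x => f x + g x).
Proof.
move=> [f1 f2] [g1 g2]; split.
  by under eq_fun do rewrite Re_add EFinD; exact: integrableD.
by under eq_fun do rewrite Im_add EFinD; exact: integrableD.
Qed.

Lemma integrableZl_EFin (r : R) (h : T -> R) :
  mu.-integrable setT (EFin \o h) -> mu.-integrable setT (EFin \o (fun x => r * h x)).
Proof.
move=> ih; rewrite (_ : _ \o _ = fun x => (r%:E * (h x)%:E)%E); last first.
  by apply/funext => x /=; rewrite EFinM.
exact: integrableZl.
Qed.

Lemma cintegrableZ c f : cintegrable f -> cintegrable (fun x => c * f x).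
Proof.
move=> fi; apply: (cintegrable_dominated (g := fun x => cnorm1 c * cnorm1 (f x))).
- apply: cmeasurableM; [exact: cmeasurable_cst|exact: cintegrable_cmeasurable].
- by apply: integrableZl_EFin => //; exact: cintegrable_cnorm1.
- by move=> x; exact: cnorm1M.
Qed.

Lemma cintegrableJ f : cintegrable f -> cintegrable (fun x => conjc (f x)).
Proof.
move=> fi; apply: (cintegrable_dominated (g := fun x => cnorm1 (f x))).
- exact/cmeasurableJ/cintegrable_cmeasurable.
- exact: cintegrable_cnorm1.
- by move=> x; rewrite cnorm1J.
Qed.

Lemma cintegrable_bounded_mul f g (M : R) : cintegrable f -> cmeasurable g ->
  (forall x, cnorm1 (g x) <= M) -> cintegrable (fun x => f x * g x).
Proof.
move=> fi mg gM; apply: (cintegrable_dominated (g := fun x => M * cnorm1 (f x))).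
- apply: cmeasurableM => //; exact: cintegrable_cmeasurable.
- by apply: integrableZl_EFin => //; exact: cintegrable_cnorm1.
- move=> x; rewrite (le_trans (cnorm1M _ _))// mulrC ler_wpM2r//.
  exact: cnorm1_ge0.
Qed.

Lemma eq_cint f g : f =1 g -> cint f = cint g.
Proof. by move=> /funext ->. Qed.

Lemma cintD f g : cintegrable f -> cintegrable g ->
  cint (fun x => f x + g x) = cint f + cint g.
Proof.
move=> [f1 f2] [g1 g2]; rewrite /cint.
under eq_Rintegral do rewrite Re_add.
under [X in Complex _ X]eq_Rintegral do rewrite Im_add.
by rewrite !RintegralD.
Qed.

Lemma cintZ c f : cintegrable f -> cint (fun x => c * f x) = c * cint f.
Proof.
move=> [f1 f2]; rewrite /cint.
under eq_Rintegral do rewrite Re_mul.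
under [X in Complex _ X]eq_Rintegral do rewrite Im_mul.
rewrite RintegralB//; [|exact: integrableZl_EFin..].
rewrite RintegralD//; [|exact: integrableZl_EFin..].
rewrite !RintegralZl//.
by apply/eqP; rewrite eq_complex Re_mul Im_mul !eqxx.
Qed.

Lemma cintJ f : cintegrable f -> cint (fun x => conjc (f x)) = conjc (cint f).
Proof.
move=> [f1 f2]; rewrite /cint /=.
congr Complex; first by apply: eq_Rintegral => x _; case: (f x).
rewrite -mulN1r -RintegralZl//.
by apply: eq_Rintegral => x _; rewrite mulN1r; case: (f x).
Qed.

Lemma cint0 : cint (fun=> 0) = 0.
Proof. by rewrite /cint /Rintegral !integral0. Qed.

Lemma cintegrable0 : cintegrable (fun=> 0).
Proof. by split; exact: integrable0. Qed.

Lemma cintegrable_sum I (r : seq I) (P : pred I) (F : I -> T -> R[i]) :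
  (forall i, P i -> cintegrable (F i)) -> cintegrable (fun x => \sum_(i <- r | P i) F i x).
Proof.
move=> mF; elim: r => [|i r ih].
  under eq_fun do rewrite big_nil; exact: cintegrable0.
under eq_fun do rewrite big_cons.
case Pi : (P i) => //; apply: cintegrableD => //; exact: mF.
Qed.

Lemma cint_sum I (r : seq I) (P : pred I) (F : I -> T -> R[i]) :
  (forall i, P i -> cintegrable (F i)) ->
  cint (fun x => \sum_(i <- r | P i) F i x) = \sum_(i <- r | P i) cint (F i).
Proof.
move=> mF; elim: r => [|i r ih].
  by under eq_cint do rewrite big_nil; rewrite big_nil cint0.
under eq_cint do rewrite big_cons.
rewrite big_cons; case Pi : (P i) => //; rewrite cintD ?ih//; first exact: mF.
exact: cintegrable_sum.
Qed.

Lemma cnorm1_cint f : cintegrable f -> cnorm1 (cint f) <= \int[mu]_x cnorm1 (f x).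
Proof.
move=> [f1 f2]; rewrite /cnorm1 /=.
rewrite RintegralD//; try exact: integrable_norm.
by rewrite lerD// le_normr_Rintegral.
Qed.

Lemma cnorm1_cint_le f (g : T -> R) : cmeasurable f ->
  mu.-integrable setT (EFin \o g) -> (forall x, cnorm1 (f x) <= g x) ->
  cnorm1 (cint f) <= \int[mu]_x g x.
Proof.
move=> mf ig fg; have fi := cintegrable_dominated mf ig fg.
rewrite (le_trans (cnorm1_cint fi))//; apply: le_Rintegral => //.
exact: cintegrable_cnorm1.
Qed.

Lemma EFin_cnorm1_cint f : cintegrable f ->
  ((cnorm1 (cint f))%:E <= \int[mu]_x (cnorm1 (f x))%:E)%E.
Proof.
move=> fi; rewrite (_ : integral _ _ _ = (\int[mu]_x cnorm1 (f x))%:E).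
  by rewrite lee_fin; exact: cnorm1_cint.
rewrite /Rintegral fineK//; apply: integrable_fin_num => //.
exact: cintegrable_cnorm1.
Qed.

End complex_integral.

(** * Euclidean norm *)

Section euclidean_norm.
Context (R : realType) (d : nat).
Implicit Types x y z : 'rV[R]_d.

Lemma dotpC x y : dotp x y = dotp y x.
Proof. by apply: eq_bigr => j _; rewrite mulrC. Qed.

Lemma dotpDl x y z : dotp (x + y) z = dotp x z + dotp y z.
Proof. by rewrite -big_split; apply: eq_bigr => j _ /=; rewrite mxE mulrDl. Qed.

Lemma dotpDr x y z : dotp z (x + y) = dotp z x + dotp z y.
Proof. by rewrite dotpC dotpDl !(dotpC z). Qed.

Lemma dotpNl x y : dotp (- x) y = - dotp x y.
Proof. by rewrite /dotp -sumrN; apply: eq_bigr => j _ /=; rewrite mxE mulNr. Qed.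

Lemma dotpNr x y : dotp x (- y) = - dotp x y.
Proof. by rewrite dotpC dotpNl dotpC. Qed.

Lemma dotpZl (c : R) x y : dotp (c *: x) y = c * dotp x y.
Proof. by rewrite /dotp mulr_sumr; apply: eq_bigr => j _ /=; rewrite mxE mulrA. Qed.

Lemma dotp_ge0 x : 0 <= dotp x x.
Proof. by apply: sumr_ge0 => j _; rewrite -expr2 sqr_ge0. Qed.

Lemma enorm_ge0 x : 0 <= enorm x.
Proof. exact: sqrtr_ge0. Qed.

Lemma sqr_enorm x : enorm x ^+ 2 = dotp x x.
Proof. by rewrite sqr_sqrtr// dotp_ge0. Qed.

Lemma sqr_enormE x : enorm x ^+ 2 = \sum_j x ord0 j ^+ 2.
Proof. by rewrite sqr_enorm; apply: eq_bigr => j _; rewrite expr2. Qed.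

Lemma coord_le_enorm x j : `|x ord0 j| <= enorm x.
Proof.
rewrite -(@ler_pXn2r _ 2) ?nnegrE ?enorm_ge0//.
rewrite sqr_enormE (bigD1 j)//= real_normK ?num_real// lerDl.
by apply: sumr_ge0 => i _; exact: sqr_ge0.
Qed.

Lemma enorm_eq0 x : enorm x = 0 -> x = 0.
Proof.
move=> x0; apply/rowP => j; rewrite mxE; apply/eqP; rewrite -normr_le0.
by rewrite -x0 coord_le_enorm.
Qed.

Lemma enorm0 : enorm (0 : 'rV[R]_d) = 0.
Proof. by rewrite /enorm /dotp big1 ?sqrtr0// => j _; rewrite mxE mul0r. Qed.

Lemma enorm_gt0 x : x != 0 -> 0 < enorm x.
Proof.
move=> x0; rewrite lt_def enorm_ge0 andbT; apply: contra_neq x0; exact: enorm_eq0.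
Qed.

Lemma enormN x : enorm (- x) = enorm x.
Proof. by rewrite /enorm dotpNl dotpNr opprK. Qed.

Lemma enormB x y : enorm (x - y) = enorm (y - x).
Proof. by rewrite -enormN opprB. Qed.

Lemma enormZ (c : R) x : enorm (c *: x) = `|c| * enorm x.
Proof.
rewrite /enorm dotpZl dotpC dotpZl mulrA -expr2 sqrtrM ?sqr_ge0//.
by rewrite sqrtr_sqr.
Qed.

Lemma cauchy_schwarz x y : `|dotp x y| <= enorm x * enorm y.
Proof.
have [->|x0] := eqVneq x 0.
  rewrite enorm0 mul0r /dotp big1 ?normr0// => j _; by rewrite mxE mul0r.
have xp := enorm_gt0 x0.
rewrite -(@ler_pXn2r _ 2) ?nnegrE ?mulr_ge0 ?enorm_ge0//.
rewrite real_normK ?num_real// exprMn.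
(* The squared norm of [|x|^2 y - <x, y> x] expands to [|x|^2 (|x|^2 |y|^2 - <x, y>^2)]. *)
have := dotp_ge0 ((dotp x x) *: y - (dotp x y) *: x).
rewrite !(dotpDl, dotpDr, dotpNl, dotpNr, dotpZl).
rewrite !(dotpC _ (_ *: _)) !dotpZl -!sqr_enorm (dotpC y x) => h.
have X0 : 0 < enorm x ^+ 2 by rewrite exprn_gt0.
rewrite -subr_ge0 -(pmulr_rge0 _ X0); apply: le_trans h _.
by rewrite le_eqVlt; apply/orP; left; apply/eqP; ring.
Qed.

Lemma enormD x y : enorm (x + y) <= enorm x + enorm y.
Proof.
rewrite -(@ler_pXn2r _ 2) ?nnegrE ?addr_ge0 ?enorm_ge0//.
rewrite sqr_enorm dotpDl !dotpDr -!sqr_enorm (dotpC y x).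
have := le_trans (ler_norm _) (cauchy_schwarz x y); nra.
Qed.

Lemma enorm_le_sum x : enorm x <= \sum_j `|x ord0 j|.
Proof.
rewrite -(@ler_pXn2r _ 2) ?nnegrE ?enorm_ge0 ?sumr_ge0//.
rewrite sqr_enormE expr2 mulr_suml; apply: ler_sum => j _.
rewrite -(real_normK (num_real (x ord0 j))) expr2 ler_wpM2l//.
by rewrite (bigD1 j)//= lerDl sumr_ge0.
Qed.

Lemma ler_dist_enorm x y : `|enorm x - enorm y| <= enorm (x - y).
Proof.
rewrite ler_norml; apply/andP; split.
  have := enormD (y - x) x; rewrite subrK (enormB y x); lra.
by have := enormD (x - y) y; rewrite subrK; lra.
Qed.

Lemma measurable_dotp dd (T : measurableType dd) (f g : T -> 'rV[R]_d) :
  measurable_fun setT f -> measurable_fun setT g ->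
  measurable_fun setT (fun t => dotp (f t) (g t)).
Proof.
move=> mf mg; apply: measurable_sum => j; apply: measurable_funM.
  exact: measurableT_comp (measurable_coord j) mf.
exact: measurableT_comp (measurable_coord j) mg.
Qed.

Lemma measurable_enorm : measurable_fun setT (@enorm R d).
Proof.
apply: measurableT_comp; last exact: measurable_dotp.
exact: continuous_measurable_fun (@sqrt_continuous R).
Qed.

End euclidean_norm.

(** * Fubini and changes of variables for signed and complex integrals *)

Section fubini_real_complex.
Context (R : realType) d1 d2 (T1 : measurableType d1) (T2 : measurableType d2).
Context (m1 : {sigma_finite_measure set T1 -> \bar R})
        (m2 : {sigma_finite_measure set T2 -> \bar R}).

Lemma integrable_prod (a : T1 -> R) (b : T2 -> R) :
  m1.-integrable setT (EFin \o a) -> m2.-integrable setT (EFin \o b) ->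
  (m1 \x m2)%E.-integrable setT (fun p => (a p.1 * b p.2)%:E).
Proof.
move=> ia ib.
have /integrableP[/measurable_EFinP ma foo] := ia.
have /integrableP[/measurable_EFinP mb goo] := ib.
apply/integrable12ltyP.
  apply/measurable_EFinP/measurable_funM.
    exact: measurableT_comp ma measurable_fst.
  exact: measurableT_comp mb measurable_snd.
have E x : (\int[m2]_y `|(a (x, y).1 * b (x, y).2)%:E| =
    `|(a x)%:E| * \int[m2]_y `|(b y)%:E|)%E.
  rewrite -ge0_integralZl//.
    by apply: eq_integral => y _; rewrite -abseM -EFinM.
  by apply: measurableT_comp => //; exact/measurable_EFinP.
under eq_integral do rewrite E.
rewrite ge0_integralZr//.
- by rewrite lte_mul_pinfty// ?integral_ge0// ge0_fin_numE// integral_ge0.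
- by apply: measurableT_comp => //; exact/measurable_EFinP.
- exact: integral_ge0.
Qed.

(** The majorant [a x * b y] holds at every point, so every slice is integrable and the real-valued
    inner integrals hide no infinite value. *)
Lemma Rintegral_fubini (F : T1 * T2 -> R) (a : T1 -> R) (b : T2 -> R) :
  measurable_fun setT F ->
  m1.-integrable setT (EFin \o a) -> m2.-integrable setT (EFin \o b) ->
  (forall x y, `|F (x, y)| <= a x * b y) ->
  \int[m1]_x \int[m2]_y F (x, y) = \int[m2]_y \int[m1]_x F (x, y).
Proof.
move=> mF ia ib Fab.
have i12 : (m1 \x m2)%E.-integrable setT (EFin \o F).
  apply: (le_integrable measurableT _ _ (integrable_prod ia ib)).
    exact/measurable_EFinP.
  by move=> [x y] _ /=; rewrite lee_fin (le_trans (Fab _ _))// ler_norm.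
have i2 x : m2.-integrable setT (fun y => (F (x, y))%:E).
  apply: (le_integrable measurableT _ _ (integrableZl_EFin (a x) ib)).
    by apply/measurable_EFinP; exact: measurableT_comp mF (pair1_measurable x).
  by move=> y _ /=; rewrite lee_fin (le_trans (Fab _ _))// ler_norm.
have i1 y : m1.-integrable setT (fun x => (F (x, y))%:E).
  apply: (le_integrable measurableT _ _ (integrableZl_EFin (b y) ia)).
    by apply/measurable_EFinP; exact: measurableT_comp mF (pair2_measurable y).
  by move=> x _ /=; rewrite lee_fin mulrC (le_trans (Fab _ _))// ler_norm.
rewrite /Rintegral.
under eq_integral do rewrite fineK ?integrable_fin_num//.
under [in RHS]eq_integral do rewrite fineK ?integrable_fin_num//.
by congr fine; exact: (Fubini i12).
Qed.

Lemma cint_fubini (F : T1 * T2 -> R[i]) (a : T1 -> R) (b : T2 -> R) :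
  cmeasurable F ->
  m1.-integrable setT (EFin \o a) -> m2.-integrable setT (EFin \o b) ->
  (forall x y, cnorm1 (F (x, y)) <= a x * b y) ->
  cint m1 (fun x => cint m2 (fun y => F (x, y))) =
  cint m2 (fun y => cint m1 (fun x => F (x, y))).
Proof.
move=> [m'1 m'2] ia ib Fab; rewrite /cint /=; congr Complex.
  apply: (@Rintegral_fubini (fun p => complex.Re (F p)) a b) => // x y.
  by rewrite (le_trans _ (Fab x y))// lerDl.
apply: (@Rintegral_fubini (fun p => complex.Im (F p)) a b) => // x y.
by rewrite (le_trans _ (Fab x y))// lerDr.
Qed.

(** The integrals of the positive and negative parts are measurable by Tonelli, and [fine] of their
    difference is measurable even where a slice is not integrable. *)
Lemma measurable_cint_param (F : T1 * T2 -> R[i]) : cmeasurable F ->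
  cmeasurable (fun x => cint m2 (fun y => F (x, y))).
Proof.
have key (G : T1 * T2 -> R) : measurable_fun setT G ->
    measurable_fun setT (fun x => \int[m2]_y G (x, y)).
  move=> mG; have mEG : measurable_fun setT (EFin \o G) by exact/measurable_EFinP.
  apply: measurableT_comp; first exact: fine_measurable.
  rewrite (_ : (fun x => _) = fun x =>
    (fubini_F m2 (EFin \o G)^\+ x - fubini_F m2 (EFin \o G)^\- x)%E).
    apply: emeasurable_funB.
      by apply: measurable_fun_fubini_tonelli_F => //; exact: measurable_funepos.
    by apply: measurable_fun_fubini_tonelli_F => //; exact: measurable_funeneg.
  apply/funext => x; rewrite [LHS]integralE /fubini_F.
  by congr (_ - _)%E; apply: eq_integral => y _; rewrite ?funeposE ?funenegE.
by move=> [F1 F2]; split; [exact: (key _ F1)|exact: (key _ F2)].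
Qed.

End fubini_real_complex.

Section affine_complex.
Context (R : realType) (d : nat).
Local Notation mu := (lebesgue_rv R d).
Variables (c h : 'rV[R]_d).
Hypothesis c0 : forall j, 0 < c ord0 j.

Let C := \prod_j c ord0 j.
Let C0 : 0 < C. Proof. by apply: prodr_gt0. Qed.

Lemma integrable_affine (f : 'rV[R]_d -> R) : measurable_fun setT f ->
  mu.-integrable setT (EFin \o f) ->
  mu.-integrable setT (fun x => (f (affine c h x))%:E).
Proof.
move=> mf /integrableP[_ fi]; apply/integrableP; split.
  by apply/measurable_EFinP; exact: measurableT_comp mf (measurable_affine c h).
move: fi; rewrite (ge0_integral_affine h c0)//; last first.
  by apply: measurableT_comp => //; exact/measurable_EFinP.
rewrite -/C => fi.
have [//|] := ltP (\int[mu]_x `|(f (affine c h x))%:E|)%E +oo%E.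
rewrite leye_eq => /eqP fy; move: fi.
by rewrite fy gt0_muley ?lte_fin// ltxx.
Qed.

Lemma Rintegral_affine (f : 'rV[R]_d -> R) : measurable_fun setT f ->
  mu.-integrable setT (EFin \o f) ->
  \int[mu]_x f x = C * \int[mu]_x f (affine c h x).
Proof.
move=> mf fi; have mef : measurable_fun setT (EFin \o f) by exact/measurable_EFinP.
have fi' := integrable_affine mf fi.
rewrite -RintegralZl// /Rintegral; congr fine.
under [RHS]eq_integral do rewrite EFinM.
rewrite integralZl// integralE [in RHS]integralE.
rewrite (ge0_integral_affine h c0 (measurable_funepos mef))//.
rewrite (ge0_integral_affine h c0 (measurable_funeneg mef))//.
have Ep : (\int[mu]_x (EFin \o f)^\+ (affine c h x) =
    \int[mu]_x (fun x => (f (affine c h x))%:E)^\+ x)%E.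
  by apply: eq_integral => x _; rewrite !funeposE.
have En : (\int[mu]_x (EFin \o f)^\- (affine c h x) =
    \int[mu]_x (fun x => (f (affine c h x))%:E)^\- x)%E.
  by apply: eq_integral => x _; rewrite !funenegE.
rewrite Ep En -/C -muleBr//.
by rewrite fin_num_adde_defl// fin_numN integrable_neg_fin_num.
Qed.

Lemma cintegrable_affine (f : 'rV[R]_d -> R[i]) :
  cintegrable mu f -> cintegrable mu (fun x => f (affine c h x)).
Proof.
move=> fi; have [mf1 mf2] := cintegrable_cmeasurable fi; case: fi => f1 f2.
by split; [exact: (integrable_affine mf1 f1)|exact: (integrable_affine mf2 f2)].
Qed.

Lemma cint_affine (f : 'rV[R]_d -> R[i]) : cintegrable mu f ->
  cint mu f = (C%:C)%C * cint mu (fun x => f (affine c h x)).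
Proof.
move=> fi; have [mf1 mf2] := cintegrable_cmeasurable fi; case: fi => f1 f2.
rewrite /cint (Rintegral_affine mf1 f1) (Rintegral_affine mf2 f2).
by apply/eqP; rewrite eq_complex Re_mul Im_mul /= !mul0r subr0 addr0 !eqxx.
Qed.

End affine_complex.

Section translation.
Context (R : realType) (d : nat).
Local Notation mu := (lebesgue_rv R d).

Lemma affine_translation (h x : 'rV[R]_d) : affine (const_mx 1) h x = x + h.
Proof. by apply/rowP => j; rewrite !mxE mul1r. Qed.

Lemma ge0_integral_translation (h : 'rV[R]_d) (f : 'rV[R]_d -> \bar R) :
  measurable_fun setT f -> (forall x, 0 <= f x)%E ->
  (\int[mu]_x f (x + h)%R = \int[mu]_x f x)%E.
Proof.
move=> mf f0; rewrite [RHS](@ge0_integral_affine _ _ (const_mx 1) h)//; last first.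
  by move=> j; rewrite mxE.
rewrite big1 ?mul1e; last by move=> j _; rewrite mxE.
by under [RHS]eq_integral do rewrite affine_translation.
Qed.

Lemma cint_translation (h : 'rV[R]_d) (f : 'rV[R]_d -> R[i]) :
  cintegrable mu f -> cint mu (fun x => f (x + h)) = cint mu f.
Proof.
move=> fi; rewrite [RHS](@cint_affine _ _ (const_mx 1) h)//; last first.
  by move=> j; rewrite mxE.
rewrite big1 ?mul1r; last by move=> j _; rewrite mxE.
by apply: eq_cint => x; rewrite affine_translation.
Qed.

Lemma cintegrable_translation (h : 'rV[R]_d) (f : 'rV[R]_d -> R[i]) :
  cintegrable mu f -> cintegrable mu (fun x => f (x + h)).
Proof.
move=> fi; have := @cintegrable_affine _ _ (const_mx 1) h _ _ fi.
rewrite (_ : (fun x => f (affine _ _ _)) = fun x => f (x + h)).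
  by apply => j; rewrite mxE.
by apply/funext => x; rewrite affine_translation.
Qed.

End translation.

(** * The Fourier transform of integrable functions *)

Section fourier_transform.
Context (R : realType) (d : nat).
Local Notation mu := (lebesgue_rv R d).
Implicit Types f g : 'rV[R]_d -> R[i].

Definition wave (x xi : 'rV[R]_d) : R[i] := cexpi (- (2 * pi * dotp x xi)).

Lemma fourierE f xi : fourier f xi = cint mu (fun x => f x * wave x xi).
Proof. by []. Qed.

Lemma waveC x xi : wave x xi = wave xi x.
Proof. by rewrite /wave dotpC. Qed.

Lemma waveD x y xi : wave (x + y) xi = wave x xi * wave y xi.
Proof. by rewrite /wave dotpDl mulrDr opprD cexpiD. Qed.

Lemma waveJ x xi : conjc (wave x xi) = wave (- x) xi.
Proof. by rewrite /wave conjc_cexpi dotpNl mulrN. Qed.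

Lemma cnorm1_wave x xi : cnorm1 (wave x xi) <= 2.
Proof. exact: cnorm1_cexpi. Qed.

Lemma cmeasurable_wave dd (T : measurableType dd) (f g : T -> 'rV[R]_d) :
  measurable_fun setT f -> measurable_fun setT g ->
  cmeasurable (fun t => wave (f t) (g t)).
Proof.
move=> mf mg; apply: cmeasurable_cexpi; apply: measurableT_comp => //.
by apply: measurable_funM => //; exact: measurable_dotp.
Qed.

Lemma cintegrable_wave f xi : cintegrable mu f ->
  cintegrable mu (fun x => f x * wave x xi).
Proof.
move=> fi; apply: (cintegrable_bounded_mul fi).
  exact: cmeasurable_wave.
move=> x; exact: cnorm1_wave.
Qed.

(** Reduces the inverse transform to the direct one, so that bounds and the multiplication formula
    need proof only once. *)
Lemma inv_fourierE f x : cintegrable mu f ->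
  inv_fourier f x = conjc (fourier (fun y => conjc (f y)) x).
Proof.
move=> fi; rewrite fourierE -cintJ; last first.
  by apply: cintegrable_wave; exact: cintegrableJ.
apply: eq_cint => y; rewrite conjcM conjcK /wave conjc_cexpi opprK dotpC.
by [].
Qed.

Lemma cmeasurable_fourier f : cmeasurable f -> cmeasurable (fourier f).
Proof.
move=> mf; have mF : cmeasurable (fun p : 'rV[R]_d * 'rV[R]_d => f p.2 * wave p.2 p.1).
  apply: cmeasurableM; first exact: cmeasurable_comp mf measurable_snd.
  exact: cmeasurable_wave.
exact: (measurable_cint_param mu mF).
Qed.

Lemma cnorm1_fourier f xi : cintegrable mu f ->
  cnorm1 (fourier f xi) <= 2 * \int[mu]_x cnorm1 (f x).
Proof.
move=> fi; have nfi := cintegrable_cnorm1 fi.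
rewrite -RintegralZl//; apply: cnorm1_cint_le.
- by apply: cintegrable_cmeasurable; exact: cintegrable_wave.
- exact: integrableZl_EFin.
- move=> x; rewrite (le_trans (cnorm1M _ _))// mulrC ler_wpM2r ?cnorm1_ge0//.
  exact: cnorm1_wave.
Qed.

Lemma multiplication_formula f g : cintegrable mu f -> cintegrable mu g ->
  cint mu (fun xi => fourier f xi * g xi) = cint mu (fun x => f x * fourier g x).
Proof.
move=> fi gi; have mf := cintegrable_cmeasurable fi; have mg := cintegrable_cmeasurable gi.
transitivity (cint mu (fun xi => cint mu (fun x => g xi * (f x * wave x xi)))).
  by apply: eq_cint => xi; rewrite cintZ 1?mulrC//; exact: cintegrable_wave.
transitivity (cint mu (fun x => cint mu (fun xi => f x * (g xi * wave xi x)))); last first.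
  by apply: eq_cint => x; rewrite cintZ//; exact: cintegrable_wave.
rewrite (@cint_fubini _ _ _ _ _ mu mu (fun p => g p.1 * (f p.2 * wave p.2 p.1))
  (fun xi => cnorm1 (g xi)) (fun x => 2 * cnorm1 (f x))).
- by apply: eq_cint => x; apply: eq_cint => y /=; rewrite waveC; ring.
- apply: cmeasurableM; first exact: cmeasurable_comp mg measurable_fst.
  apply: cmeasurableM; first exact: cmeasurable_comp mf measurable_snd.
  exact: cmeasurable_wave.
- exact: cintegrable_cnorm1.
- by apply: integrableZl_EFin; exact: cintegrable_cnorm1.
- move=> xi x /=; rewrite (le_trans (cnorm1M _ _))// ler_wpM2l ?cnorm1_ge0//.
  rewrite (le_trans (cnorm1M _ _))// mulrC ler_wpM2r ?cnorm1_ge0//.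
  exact: cnorm1_wave.
Qed.

End fourier_transform.

(** * A compactly supported window with integrable Fourier transform *)

Section one_dimensional_window.
Context (R : realType).
Local Notation leb := (@lebesgue_measure R).

(* The Fourier transform of this window decays like [1 / z^2], hence is
   integrable. *)
Definition bump (t : R) : R := Num.max 0 (1 - t ^+ 2).

Lemma bump_ge0 t : 0 <= bump t.
Proof. by rewrite le_max lexx. Qed.

Lemma bump_le1 t : bump t <= 1.
Proof. by rewrite ge_max ler01 gerBl sqr_ge0. Qed.

Lemma bump_in t : t \in `[-1, 1]%R -> bump t = 1 - t ^+ 2.
Proof.
rewrite in_itv/= => /andP[h1 h2]; apply/max_idPr; nra.
Qed.

Lemma bump_out t : t \notin `[-1, 1]%R -> bump t = 0.
Proof.
rewrite in_itv/= => h; apply/max_idPl.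
have : 1 < `|t| by rewrite ltNge ler_norml.
rewrite -(real_normK (num_real t)); nra.
Qed.

Lemma measurable_bump : measurable_fun setT bump.
Proof.
apply: (@measurable_maxr _ _ R setT (fun=> 0) (fun t : R => 1 - t ^+ 2)) => //.
by apply: measurable_funB => //; exact: measurable_funX.
Qed.

Lemma Rintegral_bump (u : R -> R) :
  \int[leb]_t (bump t * u t) = \int[leb]_(t in `[-1, 1]) ((1 - t ^+ 2) * u t).
Proof.
rewrite [RHS]Rintegral_mkcond; apply: eq_Rintegral => t _.
rewrite patchE; case: ifPn; rewrite ?inE//= => h.
  by rewrite bump_in.
by rewrite bump_out ?mul0r//; apply/negP => h'; case/negP: h; rewrite inE.
Qed.

Lemma continuous_FTC_bump (u F : R -> R) :
  continuous u -> (forall t : R, is_derive t (1 : R) F ((1 - t ^+ 2) * u t)) ->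
  \int[leb]_t (bump t * u t) = F 1 - F (-1).
Proof.
move=> cu dF; rewrite Rintegral_bump.
rewrite /Rintegral (@continuous_FTC2 _ _ F)//.
- apply: continuous_subspaceT => t; apply: cvgM; last exact: cu.
  by apply: cvgB; [exact: cvg_cst|exact: exprn_continuous].
- have cF t : F x @[x --> t] --> F t.
    by apply/differentiable_continuous/derivable1_diffP; case: (dF t).
  split.
  + by move=> t _; case: (dF t).
  + exact/cvg_at_right_filter.
  + exact/cvg_at_left_filter.
- by move=> t _; rewrite derive1E; case: (dF t).
Qed.

Lemma bump_cos_integral (c : R) : c != 0 ->
  \int[leb]_t (bump t * cos (c * t)) = - 4 * cos c / c ^+ 2 + 4 * sin c / c ^+ 3.
Proof.
move=> c0.
(* The antiderivative comes from repeated integration by parts. Its [1 / c] term carries the factor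
   [1 - t ^+ 2], which vanishes at both endpoints; hence the decay [1 / c ^+ 2]. *)
have dF (t : R) : is_derive t (1 : R) (fun t => (1 - t ^+ 2) * (sin (c * t) / c) -
   2 * t * (cos (c * t) / c ^+ 2) + 2 * sin (c * t) / c ^+ 3) ((1 - t ^+ 2) * cos (c * t)).
  by apply: is_derive_eq; rewrite /GRing.scale /=; field.
rewrite (continuous_FTC_bump _ dF); first by rewrite mulr1 mulrN1 cosN sinN; field.
by move=> t; apply: continuous_comp; [exact: mulrl_continuous|exact: continuous_cos].
Qed.

Lemma bump_sin_integral (c : R) : c != 0 ->
  \int[leb]_t (bump t * sin (c * t)) = 0.
Proof.
move=> c0.
have dF (t : R) : is_derive t (1 : R) (fun t => - (1 - t ^+ 2) * (cos (c * t) / c) -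
   2 * t * (sin (c * t) / c ^+ 2) - 2 * cos (c * t) / c ^+ 3) ((1 - t ^+ 2) * sin (c * t)).
  by apply: is_derive_eq; rewrite /GRing.scale /=; field.
rewrite (continuous_FTC_bump _ dF); first by rewrite mulr1 mulrN1 cosN sinN; field.
by move=> t; apply: continuous_comp; [exact: mulrl_continuous|exact: continuous_sin].
Qed.

Lemma integrable_bump : leb.-integrable setT (EFin \o bump).
Proof.
have ii : leb.-integrable setT (EFin \o (\1_(`[-1, 1]%classic) : R -> R)).
  exact: integrable_indic_itv.
apply: (le_integrable measurableT _ _ ii).
  by apply/measurable_EFinP; exact: measurable_bump.
move=> t _ /=; rewrite lee_fin indicE ger0_norm ?bump_ge0//.
case: (boolP (t \in `[-1, 1]%R)) => h; first by rewrite mem_set//= normr1 bump_le1.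
by rewrite bump_out.
Qed.

Lemma Rintegral_bump_bounded (u : R -> R) : measurable_fun setT u ->
  (forall t, `|u t| <= 1) -> `|\int[leb]_t (bump t * u t)| <= 2.
Proof.
move=> mu u1.
have le1 t : `|bump t * u t| <= (\1_(`[-1, 1]%classic) : R -> R) t.
  rewrite normrM indicE ger0_norm ?bump_ge0//.
  case: (boolP (t \in `[-1, 1]%R)) => h.
    by rewrite mem_set//= mulr_ile1 ?bump_ge0 ?bump_le1.
  by rewrite bump_out// mul0r.
have ii : leb.-integrable setT (EFin \o (\1_(`[-1, 1]%classic) : R -> R)).
  exact: integrable_indic_itv.
have ib : leb.-integrable setT (EFin \o (fun t => bump t * u t)).
  apply: (le_integrable measurableT _ _ ii).
    by apply/measurable_EFinP; apply: measurable_funM => //; exact: measurable_bump.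
  by move=> t _ /=; rewrite lee_fin (le_trans (le1 t))// ler_norm.
rewrite (le_trans (le_normr_Rintegral measurableT ib))//.
rewrite (@le_trans _ _ (\int[leb]_t (\1_(`[-1, 1]%classic) : R -> R) t))//.
  apply: le_Rintegral => //.
  exact: integrable_norm.
rewrite /Rintegral integral_indic// setIT.
have e : (lebesgue_measure (`[(-1)%R, 1%R]%classic : set R) = 2%:E)%E.
  by rewrite lebesgue_measure_itv/= lte_fin gtrN// -EFinB opprK.
by rewrite -[X in fine X]/(lebesgue_measure (`[(-1)%R, 1%R]%classic : set R)) e.
Qed.

(** With [c = 2 pi z] one has [z ^+ 2 <= c ^+ 2]. For [|c| < 1] the trivial bound [2 + 2] and
    [1 + z ^+ 2 <= 2] give 8. For [|c| >= 1] the explicit integral is at most [8 / c ^+ 2] and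
    [1 + z ^+ 2 <= 2 * c ^+ 2], which gives 16. *)
Lemma bump_fourier_le (z : R) :
  cnorm1 (cint leb (fun t => Complex (bump t) 0 * cexpi (- (2 * pi * (t * z))))) <=
  16 / (1 + z ^+ 2).
Proof.
rewrite /cint /cnorm1 /=.
pose c := 2 * pi * z.
have -> : \int[leb]_t (bump t * cos (- (2 * pi * (t * z))) - 0 * sin (- (2 * pi * (t * z))))
    = \int[leb]_t (bump t * cos (c * t)).
  apply: eq_Rintegral => t _; rewrite mul0r subr0 cosN; congr (_ * cos _).
  by rewrite /c; ring.
have -> : \int[leb]_t (bump t * sin (- (2 * pi * (t * z))) + 0 * cos (- (2 * pi * (t * z))))
    = \int[leb]_t (bump t * - sin (c * t)).
  apply: eq_Rintegral => t _; rewrite mul0r addr0 sinN; congr (_ * - sin _).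
  by rewrite /c; ring.
have zc : z ^+ 2 <= c ^+ 2.
  rewrite /c exprMn ler_peMl ?sqr_ge0//; have := @pi_ge2 R; nra.
have z1 : 0 < 1 + z ^+ 2 by have := sqr_ge0 z; lra.
rewrite ler_pdivlMr//.
have ms : measurable_fun setT (fun t : R => cos (c * t)).
  apply: continuous_measurable_fun => t.
  by apply: continuous_comp; [exact: mulrl_continuous|exact: continuous_cos].
have mc : measurable_fun setT (fun t : R => - sin (c * t)).
  apply: continuous_measurable_fun => t; apply: cvgN.
  by apply: continuous_comp; [exact: mulrl_continuous|exact: continuous_sin].
have [c1|c1] := ltP (`|c|) 1.
  have b1 : `|\int[leb]_t (bump t * cos (c * t))| <= 2.
    by apply: Rintegral_bump_bounded => // t; rewrite ler_norml cos_le1 cos_geN1.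
  have b2 : `|\int[leb]_t (bump t * - sin (c * t))| <= 2.
    by apply: Rintegral_bump_bounded => // t; rewrite normrN ler_norml sin_le1 sin_geN1.
  have : c ^+ 2 <= 1 by rewrite -(real_normK (num_real c)); have := normr_ge0 c; nra.
  move: zc b1 b2 (sqr_ge0 z); nra.
have c0 : c != 0 by rewrite -normr_gt0; apply: lt_le_trans c1.
have -> : \int[leb]_t (bump t * - sin (c * t)) = 0.
  rewrite -[RHS]oppr0 -(bump_sin_integral c0) -mulN1r -RintegralZl//.
    by apply: eq_Rintegral => t _; rewrite mulrN mulN1r.
  apply: (le_integrable measurableT _ _ integrable_bump).
    apply/measurable_EFinP; apply: measurable_funM; first exact: measurable_bump.
    rewrite (_ : (fun t => _) = -%R \o (fun t : R => - sin (c * t))).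
      exact: measurableT_comp.
    by apply/funext => t /=; rewrite opprK.
  move=> t _ /=; rewrite lee_fin normrM ler_piMr//.
  by rewrite ler_norml sin_le1 sin_geN1.
rewrite normr0 addr0 bump_cos_integral//.
have cc : `|cos c| <= 1 by rewrite ler_norml cos_le1 cos_geN1.
have ss : `|sin c| <= 1 by rewrite ler_norml sin_le1 sin_geN1.
have cp : 0 < c ^+ 2 by rewrite exprn_even_gt0.
have c2 : 1 <= c ^+ 2 by rewrite -(real_normK (num_real c)); nra.
rewrite (@le_trans _ _ (8 / c ^+ 2 * (1 + z ^+ 2)))//; last first.
  by rewrite mulrAC ler_pdivrMr//; nra.
rewrite ler_wpM2r ?(ltW z1)// (le_trans (ler_normD _ _))//.
rewrite (_ : 8 / c ^+ 2 = 4 / c ^+ 2 + 4 / c ^+ 2); last by field.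
rewrite !normrM !normrV ?unitfE ?expf_neq0// !normrX normrN !(@ger0_norm _ 4)//.
have ac : `|c| ^+ 2 = c ^+ 2 by rewrite real_normK ?num_real.
have i3 : (`|c| ^+ 3)^-1 <= (c ^+ 2)^-1.
  by rewrite -ac lef_pV2 ?posrE ?exprn_gt0 ?normr_gt0// ler_weXn2l//.
rewrite ac lerD//.
  by rewrite ler_wpM2r ?invr_ge0 ?(ltW cp)// ler_piMr.
rewrite (@le_trans _ _ (4 * 1 / `|c| ^+ 3))//.
  by rewrite ler_wpM2r ?invr_ge0 ?exprn_ge0// ler_wpM2l.
by rewrite mulr1 ler_wpM2l.
Qed.

Lemma integral_oneDsqrV :
  (\int[leb]_t (1 / (1 + t ^+ 2))%:E < +oo)%E.
Proof.
have -> : (\int[leb]_t (1 / (1 + t ^+ 2))%:E = \int[leb]_t ((oneDsqr t)^-1)%:E)%E.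
  by apply: eq_integral => t _; rewrite div1r.
rewrite ge0_symfun_integralT.
- rewrite -set_itvcy.
  by rewrite integral0y_oneDsqr -EFinM ltry.
- by move=> t; rewrite invr_ge0 ltW// ltr_pwDl// sqr_ge0.
- exact: continuous_oneDsqrV.
- by move=> t; rewrite /= /oneDsqr sqrrN.
Qed.

End one_dimensional_window.

Section complex_tensor.
Context (R : realType).
Local Notation leb := (@lebesgue_measure R).

Lemma cmeasurable_tensor n (phi : 'I_n -> R -> R[i]) :
  (forall j, cmeasurable (phi j)) ->
  cmeasurable (fun x : 'rV[R]_n => \prod_j phi j (x ord0 j)).
Proof.
elim: n phi => [|n ih] phi mphi.
  by under eq_fun do rewrite big_ord0; exact: cmeasurable_cst.
rewrite (_ : (fun x => _) = fun x : 'rV[R]_n.+1 => phi ord0 (x ord0 ord0) *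
   \prod_j phi (lift ord0 j) ((\row_j x ord0 (lift ord0 j)) ord0 j)); last first.
  by apply/funext => x; rewrite big_ord_recl; congr (_ * _); apply: eq_bigr => j _; rewrite mxE.
apply: cmeasurableM; first exact: cmeasurable_comp (mphi _) (measurable_coord _).
apply: (cmeasurable_comp (f := fun x : 'rV[R]_n => \prod_j phi (lift ord0 j) (x ord0 j))
   (g := fun x : 'rV[R]_n.+1 => \row_j x ord0 (lift ord0 j))).
  by apply: (ih (fun j => phi (lift ord0 j))) => j; exact: mphi.
apply: measurable_fun_coord => j; under eq_fun do rewrite mxE.
exact: measurable_coord.
Qed.

Lemma cint_rvS n (f : 'rV[R]_n.+1 -> R[i]) (a : R -> R) (b : 'rV[R]_n -> R) :
  cmeasurable f -> leb.-integrable setT (EFin \o a) ->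
  (lebesgue_rv R n).-integrable setT (EFin \o b) ->
  (forall t x, cnorm1 (f (rvcons (t, x))) <= a t * b x) ->
  cintegrable (lebesgue_rv R n.+1) f /\
  cint (lebesgue_rv R n.+1) f =
  cint leb (fun t => cint (lebesgue_rv R n) (fun x => f (rvcons (t, x)))).
Proof.
move=> mf ia ib fab.
have key (g : 'rV[R]_n.+1 -> R) : measurable_fun setT g ->
    (forall t x, `|g (rvcons (t, x))| <= a t * b x) ->
    (lebesgue_rv R n.+1).-integrable setT (EFin \o g) /\
    \int[lebesgue_rv R n.+1]_x g x =
    \int[leb]_t \int[lebesgue_rv R n]_x g (rvcons (t, x)).
  move=> mg gab.
  have mgc : measurable_fun setT (g \o @rvcons R n).
    exact: measurableT_comp mg (@measurable_rvcons R n).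
  have i12 : (leb \x lebesgue_rv R n)%E.-integrable setT ((EFin \o g) \o @rvcons R n).
    apply: (le_integrable measurableT _ _ (integrable_prod ia ib)).
      exact/measurable_EFinP.
    by move=> [x y] _ /=; rewrite lee_fin (le_trans (gab _ _))// ler_norm.
  have mEg : measurable_fun setT (EFin \o g) by exact/measurable_EFinP.
  split; first exact: integrable_rvS.
  rewrite [LHS]/Rintegral (integral_rvS mEg)// [RHS]/Rintegral; congr fine.
  apply: eq_integral => t _; rewrite /Rintegral fineK//.
  apply: integrable_fin_num => //.
  apply: (le_integrable measurableT _ _ (integrableZl_EFin (a t) ib)).
    apply/measurable_EFinP; exact: measurableT_comp mgc (pair1_measurable t).
  by move=> x _ /=; rewrite lee_fin (le_trans (gab _ _))// ler_norm.
have [] := key (fun x => complex.Re (f x)) mf.1.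
  by move=> t x; rewrite (le_trans _ (fab t x))// lerDl.
have [] := key (fun x => complex.Im (f x)) mf.2.
  by move=> t x; rewrite (le_trans _ (fab t x))// lerDr.
by move=> i2 e2 i1 e1; split => //; rewrite /cint e1 e2.
Qed.

(** Integrability is carried through the induction together with the product formula, since
    splitting off a coordinate requires an integrable majorant of the remaining factors. *)
Lemma cint_tensor n (phi : 'I_n -> R -> R[i]) :
  (forall j, cintegrable leb (phi j)) ->
  cintegrable (lebesgue_rv R n) (fun x => \prod_j phi j (x ord0 j)) /\
  cint (lebesgue_rv R n) (fun x => \prod_j phi j (x ord0 j)) =
  \prod_j cint leb (phi j).
Proof.
elim: n phi => [|n ih] phi iphi.
  have e : (fun x : 'rV[R]_0 => \prod_j phi j (x ord0 j)) = cst 1.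
    by apply/funext => x; rewrite big_ord0.
  have ii (r : R) : (lebesgue_rv R 0).-integrable setT (fun=> r%:E).
    by apply/integrableP; split => //; rewrite integral_cst//= diracT mule1 ltry.
  rewrite e big_ord0; split; first by split; exact: ii.
  have ci (r : R) : \int[lebesgue_rv R 0]_x r = r.
    have D : (lebesgue_rv R 0 setT = 1)%E by rewrite /= diracT.
    rewrite /Rintegral (_ : integral _ _ _ = r%:E)//.
    by transitivity (r%:E * lebesgue_rv R 0 setT)%E; [exact: integral_cst|rewrite D mule1].
  by rewrite /cint /= !ci.
have [ii ee] := ih (fun j => phi (lift ord0 j)) (fun j => iphi _).
have mphi j : cmeasurable (phi j) := cintegrable_cmeasurable (iphi j).
have hb t x : cnorm1 (\prod_j phi j (rvcons (t, x) ord0 j)) <=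
    cnorm1 (phi ord0 t) * cnorm1 (\prod_(j < n) phi (lift ord0 j) (x ord0 j)).
  rewrite big_ord_recl rvcons0 (le_trans (cnorm1M _ _))//.
  by under eq_bigr do rewrite rvconsS.
have [i' e'] := @cint_rvS n (fun x => \prod_j phi j (x ord0 j))
  (fun t => cnorm1 (phi ord0 t))
  (fun x => cnorm1 (\prod_(j < n) phi (lift ord0 j) (x ord0 j)))
  (cmeasurable_tensor mphi) (cintegrable_cnorm1 (iphi ord0)) (cintegrable_cnorm1 ii) hb.
split => //; rewrite e' big_ord_recl -ee.
transitivity (cint leb (fun t => cint (lebesgue_rv R n)
   (fun x => \prod_(j < n) phi (lift ord0 j) (x ord0 j)) * phi ord0 t)).
  apply: eq_cint => t; rewrite mulrC -cintZ//; apply: eq_cint => x.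
  rewrite big_ord_recl rvcons0; congr (_ * _); apply: eq_bigr => j _.
  by rewrite rvconsS.
by rewrite cintZ// mulrC.
Qed.

Lemma cnorm1_prod n (z : 'I_n -> R[i]) (M : 'I_n -> R) :
  (forall j, cnorm1 (z j) <= M j) -> cnorm1 (\prod_j z j) <= \prod_j M j.
Proof.
move=> zM; elim/big_ind2 : _ => [|u1 u2 v1 v2 h1 h2|j _]; last exact: zM.
  by rewrite /cnorm1 /= normr1 normr0 addr0.
rewrite (le_trans (cnorm1M _ _))// ler_pM// cnorm1_ge0//.
Qed.

End complex_tensor.

(** * Fourier multipliers as kernels, Schur's test, Plancherel's inequality *)

Section plancherel.
Context (R : realType) (d : nat).
Local Notation mu := (lebesgue_rv R d).
Local Notation leb := (@lebesgue_measure R).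

(* [fourier (M * conj ghat) x] is, up to conjugation, the convolution of [g]
   with the conjugate of [fourier M]. *)
Lemma fourier_mul_conj (M g : 'rV[R]_d -> R[i]) x :
  cintegrable mu M -> cintegrable mu g ->
  fourier (fun xi => M xi * conjc (fourier g xi)) x =
  conjc (cint mu (fun y => g y * conjc (fourier M (x - y)))).
Proof.
move=> iM ig; have mM := cintegrable_cmeasurable iM.
have mg := cintegrable_cmeasurable ig.
have iMw : cintegrable mu (fun xi => conjc (M xi * wave xi x)).
  by apply: cintegrableJ; exact: cintegrable_wave.
have E y : fourier (fun xi => conjc (M xi * wave xi x)) y = conjc (fourier M (x - y)).
  rewrite fourierE fourierE -cintJ; last exact: cintegrable_wave.
  apply: eq_cint => xi; rewrite !conjcM -mulrA; congr (_ * _).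
  by rewrite !(waveC xi) !waveJ -waveD opprB addrC.
transitivity (conjc (cint mu (fun xi => fourier g xi * conjc (M xi * wave xi x)))).
  rewrite fourierE -cintJ.
    by apply: eq_cint => xi; rewrite !conjcM !conjcK; ring.
  apply: (@cintegrable_dominated _ _ _ _ _ (fun xi => 2 * \int[mu]_x cnorm1 (g x) *
     cnorm1 (conjc (M xi * wave xi x)))).
  - apply: cmeasurableM; first exact: cmeasurable_fourier.
    exact: cintegrable_cmeasurable iMw.
  - by apply: integrableZl_EFin; exact: cintegrable_cnorm1.
  - move=> xi; rewrite (le_trans (cnorm1M _ _))// ler_wpM2r ?cnorm1_ge0//.
    exact: cnorm1_fourier.
rewrite (multiplication_formula ig iMw).
apply: (f_equal (@conjc R)); by apply: eq_cint => y; rewrite E.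
Qed.

(** The multiplication formula moves the transform off [f], and [fourier_mul_conj] then exhibits the
    kernel [fourier M (x - y)]. The double integral is kept in the extended reals because it is
    bounded in two ways: by Schur's test for Plancherel's inequality, and by the supremum of the
    kernel for [L_1] data. *)
Lemma fourier_sesquilinear (M f g : 'rV[R]_d -> R[i]) :
  cintegrable mu M -> cintegrable mu f -> cintegrable mu g ->
  ((cnorm1 (cint mu (fun xi => fourier f xi * (M xi * conjc (fourier g xi)))))%:E <=
   \int[mu]_x \int[mu]_y
     (cnorm1 (f x) * (cnorm1 (g y) * cnorm1 (fourier M (x - y))))%:E)%E.
Proof.
move=> iM fi ig; have mM := cintegrable_cmeasurable iM.
have mf := cintegrable_cmeasurable fi; have mg := cintegrable_cmeasurable ig.
pose G xi := M xi * conjc (fourier g xi).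
have iG : cintegrable mu G.
  apply: (cintegrable_bounded_mul iM); first exact/cmeasurableJ/cmeasurable_fourier.
  by move=> xi; rewrite cnorm1J; exact: cnorm1_fourier.
rewrite (multiplication_formula fi iG).
have mFM : cmeasurable (fun p : 'rV[R]_d * 'rV[R]_d => fourier M (p.1 - p.2)).
  apply: (cmeasurable_comp (cmeasurable_fourier mM)).
  apply: measurable_fun_coord => i; under eq_fun do rewrite !mxE.
  apply: measurable_funB.
    exact: measurableT_comp (measurable_coord i) measurable_fst.
  exact: measurableT_comp (measurable_coord i) measurable_snd.
have iGM x : cintegrable mu (fun y => g y * conjc (fourier M (x - y))).
  apply: (cintegrable_bounded_mul ig (M := 2 * \int[mu]_x cnorm1 (M x))).
    apply: cmeasurableJ.
    exact: cmeasurable_comp mFM (pair1_measurable x).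
  by move=> y; rewrite cnorm1J; exact: cnorm1_fourier.
have ifG : cintegrable mu (fun x => f x * fourier G x).
  apply: (cintegrable_bounded_mul fi (M := 2 * \int[mu]_x cnorm1 (G x))).
    apply: cmeasurable_fourier; exact: cintegrable_cmeasurable iG.
  by move=> x; exact: cnorm1_fourier.
rewrite (le_trans (EFin_cnorm1_cint ifG))//.
have mK : measurable_fun setT (fun p : 'rV[R]_d * 'rV[R]_d =>
    (cnorm1 (f p.1) * (cnorm1 (g p.2) * cnorm1 (fourier M (p.1 - p.2))))%:E).
  apply/measurable_EFinP/measurable_funM.
    exact: measurableT_comp (cmeasurable_cnorm1 mf) measurable_fst.
  apply: measurable_funM; last exact: cmeasurable_cnorm1.
  exact: measurableT_comp (cmeasurable_cnorm1 mg) measurable_snd.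
apply: ge0_le_integral => //.
- by move=> x _; rewrite lee_fin cnorm1_ge0.
- apply/measurable_EFinP; apply: cmeasurable_cnorm1.
  exact: cintegrable_cmeasurable ifG.
- apply: (measurable_fun_fubini_tonelli_F _ mK) => p /=.
  by rewrite lee_fin !mulr_ge0 ?cnorm1_ge0.
- move=> x _; rewrite fourier_mul_conj//.
  rewrite (le_trans (y := ((cnorm1 (f x))%:E * (cnorm1 (cint mu (fun y => g y * conjc (fourier M (x - y)))))%:E)%E))//.
    by rewrite -EFinM lee_fin (le_trans (cnorm1M _ _))// cnorm1J.
  under eq_integral do rewrite EFinM.
  rewrite ge0_integralZl//.
  + rewrite lee_wpmul2l ?lee_fin ?cnorm1_ge0// (le_trans (EFin_cnorm1_cint (iGM x)))//.
    apply: ge0_le_integral => //.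
    * by move=> y _; rewrite lee_fin cnorm1_ge0.
    * apply/measurable_EFinP; apply: cmeasurable_cnorm1.
      exact: cintegrable_cmeasurable (iGM x).
    * apply/measurable_EFinP/measurable_funM; first exact: cmeasurable_cnorm1.
      by apply: cmeasurable_cnorm1; exact: cmeasurable_comp mFM (pair1_measurable x).
    * by move=> y _; rewrite lee_fin (le_trans (cnorm1M _ _))// cnorm1J.
  + apply/measurable_EFinP/measurable_funM; first exact: cmeasurable_cnorm1.
    by apply: cmeasurable_cnorm1; exact: cmeasurable_comp mFM (pair1_measurable x).
  + by move=> y _; rewrite lee_fin mulr_ge0 ?cnorm1_ge0.
  + by rewrite lee_fin cnorm1_ge0.
Qed.

End plancherel.

Section fatou_bound.
Context (R : realType) dd (T : measurableType dd) (m : {measure set T -> \bar R}).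

Lemma fatou_le (u : nat -> T -> R) (f : T -> R) (M : \bar R) :
  (forall n, measurable_fun setT (u n)) -> (forall n x, 0 <= u n x) ->
  (forall x, u n x @[n --> \oo] --> f x) ->
  (forall n, \int[m]_x (u n x)%:E <= M)%E -> (\int[m]_x (f x)%:E <= M)%E.
Proof.
move=> mu u0 uf uM.
have -> : (\int[m]_x (f x)%:E = \int[m]_x limn_einf (fun n => (u n x)%:E))%E.
  apply: eq_integral => x _.
  have cu : (u n x)%:E @[n --> \oo] --> (f x)%:E by apply: cvg_EFin; [exact: nearW|exact: uf].
  rewrite is_cvg_limn_einfE; last by apply/cvg_ex; exists (f x)%:E.
  by apply/esym/cvg_lim.
apply: (@le_trans _ _ (limn_einf (fun n => \int[m]_x (u n x)%:E)))%E.
  apply: fatou => //.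
  - by move=> n; exact/measurable_EFinP.
  - by move=> n x _; rewrite lee_fin.
rewrite limn_einf_lim; apply: lime_le; first exact: is_cvg_einfs.
apply: nearW => n; apply: le_trans (uM n).
by apply: ereal_inf_lbound; exists n => /=.
Qed.

End fatou_bound.

Section schur_test.
Context (R : realType) (d : nat).
Local Notation mu := (lebesgue_rv R d).

Lemma measurable_sub_rv :
  measurable_fun setT (fun p : 'rV[R]_d * 'rV[R]_d => p.1 - p.2).
Proof.
apply: measurable_fun_coord => i; under eq_fun do rewrite !mxE.
apply: measurable_funB.
  exact: measurableT_comp (measurable_coord i) measurable_fst.
exact: measurableT_comp (measurable_coord i) measurable_snd.
Qed.

(** Schur's test for a convolution kernel, with [q] standing for a squared modulus. The half with
    [q x] follows from translation invariance in [y]; the other half reduces to it by exchanging the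
    integrals, as [K] is even. *)
Lemma schur_convolution (q K : 'rV[R]_d -> R) :
  measurable_fun setT q -> measurable_fun setT K ->
  (forall x, 0 <= q x) -> (forall x, 0 <= K x) -> (forall x, K (- x) = K x) ->
  (\int[mu]_x \int[mu]_y ((q x + q y) * K (x - y))%:E =
   2%:E * (\int[mu]_x (K x)%:E * \int[mu]_x (q x)%:E))%E.
Proof.
move=> mq mK q0 K0 Ke.
have mK2 : measurable_fun setT (fun p : 'rV[R]_d * 'rV[R]_d => K (p.1 - p.2)).
  exact: measurableT_comp mK measurable_sub_rv.
have mKx (x : 'rV[R]_d) : measurable_fun setT (fun y : 'rV[R]_d => K (x - y)).
  exact: measurableT_comp mK2 (pair1_measurable x).
have intK (x : 'rV[R]_d) : (\int[mu]_y (K (x - y))%:E = \int[mu]_y (K y)%:E)%E.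
  rewrite -(@ge0_integral_translation _ _ (- x) (fun y => (K y)%:E)).
  - by apply: eq_integral => y _; rewrite -Ke opprB.
  - exact/measurable_EFinP.
  - by move=> y; rewrite lee_fin.
have mQK1 : measurable_fun setT (fun p : 'rV[R]_d * 'rV[R]_d => (q p.1 * K (p.1 - p.2))%:E).
  apply/measurable_EFinP/measurable_funM => //.
  exact: measurableT_comp mq measurable_fst.
have mQK2 : measurable_fun setT (fun p : 'rV[R]_d * 'rV[R]_d => (q p.2 * K (p.1 - p.2))%:E).
  apply/measurable_EFinP/measurable_funM => //.
  exact: measurableT_comp mq measurable_snd.
have Kq0 : (0 <= \int[mu]_x (K x)%:E)%E by apply: integral_ge0 => x _; rewrite lee_fin.
have E1 : (\int[mu]_x \int[mu]_y (q x * K (x - y))%:E =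
    \int[mu]_x (K x)%:E * \int[mu]_x (q x)%:E)%E.
  rewrite -ge0_integralZl//.
  - apply: eq_integral => x _; rewrite -(intK x) muleC -ge0_integralZl//.
    + by apply/measurable_EFinP; exact: mKx.
    + by move=> y _; rewrite lee_fin.
    + by rewrite lee_fin.
  - exact/measurable_EFinP.
  - by move=> x _; rewrite lee_fin.
have E2 : (\int[mu]_x \int[mu]_y (q y * K (x - y))%:E =
    \int[mu]_x (K x)%:E * \int[mu]_x (q x)%:E)%E.
  rewrite (@fubini_tonelli _ _ _ _ _ mu mu _ mQK2)/=; last first.
    by move=> p; rewrite lee_fin mulr_ge0.
  rewrite -E1; apply: eq_integral => y _; apply: eq_integral => x _.
  by rewrite -opprB Ke.
under eq_integral => x _.
  under eq_integral => y _ do rewrite mulrDl EFinD.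
  rewrite ge0_integralD//; last 4 first.
  - by move=> y _; rewrite lee_fin mulr_ge0.
  - exact: measurableT_comp mQK1 (pair1_measurable x).
  - by move=> y _; rewrite lee_fin mulr_ge0.
  - exact: measurableT_comp mQK2 (pair1_measurable x).
  over.
rewrite ge0_integralD//; last 4 first.
- by move=> x _; apply: integral_ge0 => y _; rewrite lee_fin mulr_ge0.
- by apply: (measurable_fun_fubini_tonelli_F _ mQK1) => p /=; rewrite lee_fin mulr_ge0.
- by move=> x _; apply: integral_ge0 => y _; rewrite lee_fin mulr_ge0.
- by apply: (measurable_fun_fubini_tonelli_F _ mQK2) => p /=; rewrite lee_fin mulr_ge0.
by rewrite E1 E2 -mule2n -mule_natl.
Qed.

End schur_test.

Section dilation.
Context (R : realType) (d : nat).
Local Notation mu := (lebesgue_rv R d).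

Lemma fourier_dilation (c : 'rV[R]_d) (f : 'rV[R]_d -> R[i]) z :
  (forall j, 0 < c ord0 j) -> cintegrable mu f ->
  ((\prod_j c ord0 j)%:C)%C * fourier (fun xi => f (affine c 0 xi)) z =
  fourier f (\row_j (z ord0 j / c ord0 j)).
Proof.
move=> c0 fi; rewrite [RHS]fourierE (cint_affine 0 c0); last exact: cintegrable_wave.
congr (_ * _); apply: eq_cint => xi; congr (_ * cexpi (- (_ * _))).
apply: eq_bigr => j _; rewrite !mxE addr0.
by field; rewrite gt_eqF.
Qed.

End dilation.

(** Squeezed between [1 - t ^+ 2 / n.+1] and 1. The [+ 0] is the zero shift of [affine]. *)
Lemma cvg_bump (R : realType) (t : R) : bump ((n.+1%:R)^-1 * t + 0) @[n --> \oo] --> (1 : R).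
Proof.
apply: (@squeeze_cvgr _ _ _ _ (fun n => 1 - t ^+ 2 * @harmonic R n) (cst 1)).
- near=> n; rewrite bump_le1 andbT addr0 le_max; apply/orP; right.
  rewrite lerD2l lerN2 exprMn mulrC ler_wpM2l ?sqr_ge0//.
  rewrite /harmonic /= expr2 ler_piMr ?invr_ge0// invf_le1 ?ler1n//.
- rewrite -[X in _ --> X]subr0 -[X in _ - X](mulr0 (t ^+ 2)).
  by apply: cvgB; [exact: cvg_cst|apply: cvgM; [exact: cvg_cst|exact: cvg_harmonic]].
- exact: cvg_cst.
Unshelve. all: by end_near. Qed.

Section lorentzian.
Context (R : realType) (d : nat).
Local Notation mu := (lebesgue_rv R d).
Local Notation leb := (@lebesgue_measure R).

(** Dominates the transform of the tensor window, by [bump_fourier_le] in each coordinate; it also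
    serves as an integrable majorant for Schwartz functions. *)
Definition lorentzian (z : 'rV[R]_d) : R := \prod_j (16 / (1 + z ord0 j ^+ 2)).

Let lor1_ge0 (t : R) : 0 <= 16 / (1 + t ^+ 2).
Proof. by rewrite divr_ge0// addr_ge0// sqr_ge0. Qed.

Lemma lorentzian_ge0 z : 0 <= lorentzian z.
Proof. by apply: prodr_ge0 => j _. Qed.

Let measurable_lor1 : measurable_fun setT (fun t : R => 16 / (1 + t ^+ 2)).
Proof.
apply: measurable_funM => //; apply: continuous_measurable_fun => t.
exact: continuous_oneDsqrV.
Qed.

Lemma measurable_lorentzian : measurable_fun setT lorentzian.
Proof.
apply: measurable_prod => j _.
exact: measurableT_comp measurable_lor1 (measurable_coord j).
Qed.

Lemma integral_lorentzian : (\int[mu]_z (lorentzian z)%:E < +oo)%E.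
Proof.
rewrite (ge0_integral_tensor (g := fun=> fun t => 16 / (1 + t ^+ 2)))//.
suff /andP[] // : (0 <= \prod_(j < d) \int[leb]_t (16 / (1 + t ^+ 2))%:E < +oo)%E by [].
elim/big_ind : _ => [|x y /andP[x0 x1] /andP[y0 y1]|j _].
- by rewrite lee01 ltry.
- by rewrite mule_ge0// lte_mul_pinfty// ge0_fin_numE.
- rewrite integral_ge0 => [|t _]; last by rewrite lee_fin.
  under eq_integral do rewrite -(mulr1 16) -mulrA EFinM.
  rewrite ge0_integralZl//.
  + by rewrite lte_mul_pinfty// ?integral_oneDsqrV// lee_fin.
  + apply/measurable_EFinP; under eq_fun do rewrite div1r.
    by apply: continuous_measurable_fun => t; exact: continuous_oneDsqrV.
  + by move=> t _; rewrite lee_fin divr_ge0// addr_ge0// sqr_ge0.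
Qed.

End lorentzian.

Section plancherel_inequality.
Context (R : realType) (d : nat).
Local Notation mu := (lebesgue_rv R d).
Local Notation leb := (@lebesgue_measure R).

Let W (xi : 'rV[R]_d) : R := \prod_j bump (xi ord0 j).
Let K := @lorentzian R d.

Let WE xi : ((W xi)%:C)%C = \prod_j Complex (bump (xi ord0 j)) 0.
Proof. by rewrite /W rmorph_prod. Qed.

Let W0 xi : 0 <= W xi. Proof. by apply: prodr_ge0 => j _; exact: bump_ge0. Qed.

Let mW : measurable_fun setT W.
Proof.
apply: measurable_prod => j _.
exact: measurableT_comp (@measurable_bump R) (measurable_coord j).
Qed.

Let K0 z : 0 <= K z. Proof. exact: lorentzian_ge0. Qed.

Let mK : measurable_fun setT K. Proof. exact: measurable_lorentzian. Qed.

Let Kfin : (\int[mu]_z (K z)%:E < +oo)%E. Proof. exact: integral_lorentzian. Qed.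

Let W_tensor :
  cintegrable mu (fun xi => ((W xi)%:C)%C) /\
  (forall z, cnorm1 (fourier (fun xi => ((W xi)%:C)%C) z) <= K z).
Proof.
have ib : cintegrable leb (fun t : R => Complex (bump t) 0).
  by split => /=; [exact: integrable_bump|exact: integrable0].
split.
  under eq_fun do rewrite WE.
  by have [] := @cint_tensor R d (fun _ t => Complex (bump t) 0) (fun=> ib).
move=> z.
pose phi (j : 'I_d) (t : R) := Complex (bump t) 0 * cexpi (- (2 * pi * (t * z ord0 j))).
have iphi j : cintegrable leb (phi j).
  apply: (cintegrable_bounded_mul ib) => [|t]; last exact: cnorm1_cexpi.
  apply: cmeasurable_cexpi; apply: measurableT_comp => //.
  by apply: measurable_funM => //; exact: measurable_funM.
have [_ e] := cint_tensor iphi.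
have -> : fourier (fun xi => ((W xi)%:C)%C) z =
    cint mu (fun x => \prod_j phi j (x ord0 j)).
  rewrite fourierE; apply: eq_cint => xi; rewrite WE big_split/=; congr (_ * _).
  rewrite /wave /dotp mulr_sumr -sumrN.
  elim/big_ind2 : _ => [|x1 x2 y1 y2 <- <-|j _]; rewrite ?cexpi0 ?cexpiD//.
rewrite e; apply: cnorm1_prod => j; exact: bump_fourier_le.
Qed.

(** Stretching the window by [n.+1] lets it tend to 1, while the kernel bound becomes an
    [L_1]-normalized rescaling [Ke] of [K]. *)
Let We n (xi : 'rV[R]_d) : R := W (affine (const_mx (n.+1%:R)^-1) 0 xi).
Let Ke n (z : 'rV[R]_d) : R := n.+1%:R ^+ d * K (affine (const_mx n.+1%:R) 0 z).

Let We_fourier n :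
  cintegrable mu (fun xi => ((We n xi)%:C)%C) /\
  (forall z, cnorm1 (fourier (fun xi => ((We n xi)%:C)%C) z) <= Ke n z).
Proof.
have [iW Wb] := W_tensor.
have c0 j : 0 < (const_mx (n.+1%:R)^-1 : 'rV[R]_d) ord0 j by rewrite mxE invr_gt0.
split; first exact: (cintegrable_affine 0 c0 iW).
move=> z; have := fourier_dilation z c0 iW.
have -> : \prod_j (const_mx (n.+1%:R)^-1 : 'rV[R]_d) ord0 j = (n.+1%:R ^+ d)^-1.
  under eq_bigr do rewrite mxE.
  by rewrite prodr_const card_ord exprVn.
have -> : \row_j (z ord0 j / (const_mx (n.+1%:R)^-1 : 'rV[R]_d) ord0 j) =
    affine (const_mx n.+1%:R) 0 z.
  by apply/rowP => j; rewrite !mxE invrK addr0 mulrC.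
set F := fourier _ z => e.
have -> : F = ((n.+1%:R ^+ d)%:C)%C * fourier (fun xi => ((W xi)%:C)%C) (affine (const_mx n.+1%:R) 0 z).
  rewrite -e mulrA -rmorphM mulfV ?rmorph1 ?mul1r// expf_neq0//.
rewrite (le_trans (cnorm1M _ _))// cnorm1_real ger0_norm ?exprn_ge0//.
by rewrite ler_wpM2l ?exprn_ge0.
Qed.

Let Ke0 n z : 0 <= Ke n z.
Proof. by rewrite mulr_ge0// exprn_ge0. Qed.

Let mKe n : measurable_fun setT (Ke n).
Proof.
apply: measurable_funM => //.
exact: measurableT_comp mK (measurable_affine _ _).
Qed.

Let Ke_int n : (\int[mu]_z (Ke n z)%:E = \int[mu]_z (K z)%:E)%E.
Proof.
rewrite [RHS](@ge0_integral_affine _ _ (const_mx n.+1%:R) 0); last 3 first.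
- by move=> j; rewrite mxE.
- exact/measurable_EFinP.
- by move=> x; rewrite lee_fin.
have -> : \prod_j (const_mx n.+1%:R : 'rV[R]_d) ord0 j = n.+1%:R ^+ d.
  by under eq_bigr do rewrite mxE; rewrite prodr_const card_ord.
rewrite -ge0_integralZl//.
- by apply/measurable_EFinP; exact: measurableT_comp mK (measurable_affine _ _).
- by move=> x _; rewrite lee_fin.
Qed.

Let Ke_even n z : Ke n (- z) = Ke n z.
Proof.
rewrite /Ke /K; congr (_ * _); apply: eq_bigr => j _.
by rewrite !mxE !addr0 mulrN sqrrN.
Qed.

Let windowed n (h : 'rV[R]_d -> R[i]) : cintegrable mu h ->
  (\int[mu]_xi (We n xi * cnormsq (fourier h xi))%:E <=
   2%:E * (\int[mu]_x (K x)%:E * \int[mu]_x (cnormsq (h x))%:E))%E.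
Proof.
move=> ih; have [iW Wb] := We_fourier n.
have mh := cintegrable_cmeasurable ih.
have mF := cmeasurable_fourier mh.
pose G xi := ((We n xi)%:C)%C * conjc (fourier h xi).
have iG : cintegrable mu (fun xi => fourier h xi * G xi).
  rewrite (_ : (fun xi => _) = fun xi => ((We n xi)%:C)%C * (conjc (fourier h xi) * fourier h xi)).
    apply: (cintegrable_bounded_mul iW (M := (2 * \int[mu]_x cnorm1 (h x)) ^+ 2)).
      by apply: cmeasurableM => //; exact: cmeasurableJ.
    move=> xi; rewrite (le_trans (cnorm1M _ _))// cnorm1J expr2.
    by rewrite ler_pM ?cnorm1_ge0// cnorm1_fourier.
  by apply/funext => xi; rewrite /G; ring.
have EG xi : fourier h xi * G xi = ((We n xi * cnormsq (fourier h xi))%:C)%C.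
  by rewrite /G mulrCA mulcJ -rmorphM.
have -> : (\int[mu]_xi (We n xi * cnormsq (fourier h xi))%:E =
    (complex.Re (cint mu (fun xi => fourier h xi * G xi)))%:E)%E.
  have -> : complex.Re (cint mu (fun xi => fourier h xi * G xi)) =
      \int[mu]_xi (We n xi * cnormsq (fourier h xi)).
    by rewrite -[LHS]/(Rintegral _ _ _); apply: eq_Rintegral => xi _; rewrite EG.
  rewrite /Rintegral fineK//; apply: integrable_fin_num => //.
  have := iG.1; rewrite (_ : (fun x => _) = fun xi => (We n xi * cnormsq (fourier h xi))%:E)//.
  by apply/funext => xi; rewrite EG.
apply: (@le_trans _ _ (cnorm1 (cint mu (fun xi => fourier h xi * G xi)))%:E).
  by rewrite lee_fin (le_trans (ler_norm _))// lerDl.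
apply: (le_trans (fourier_sesquilinear iW ih ih)).
have Kf : ((\int[mu]_x (K x)%:E) \is a fin_num)%E.
  by rewrite ge0_fin_numE// integral_ge0// => x _; rewrite lee_fin.
rewrite -(Ke_int n) -schur_convolution//; last 2 first.
- exact: cmeasurable_cnormsq.
- by move=> x; exact: cnormsq_ge0.
have mK2 : measurable_fun setT (fun p : 'rV[R]_d * 'rV[R]_d => Ke n (p.1 - p.2)).
  exact: measurableT_comp (mKe n) (@measurable_sub_rv _ _).
have mF2 : measurable_fun setT (fun p : 'rV[R]_d * 'rV[R]_d =>
    cnorm1 (fourier (fun xi => ((We n xi)%:C)%C) (p.1 - p.2))).
  apply: cmeasurable_cnorm1; apply: cmeasurable_comp (@measurable_sub_rv _ _).
  apply: cmeasurable_fourier; exact: cintegrable_cmeasurable iW.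
have mN := cmeasurable_cnorm1 mh; have mQ := cmeasurable_cnormsq mh.
have m1 : measurable_fun setT (fun p : 'rV[R]_d * 'rV[R]_d =>
  (cnorm1 (h p.1) * (cnorm1 (h p.2) * cnorm1 (fourier (fun xi => ((We n xi)%:C)%C) (p.1 - p.2))))%:E).
  apply/measurable_EFinP/measurable_funM; first exact: measurableT_comp mN measurable_fst.
  by apply: measurable_funM => //; exact: measurableT_comp mN measurable_snd.
have m2 : measurable_fun setT (fun p : 'rV[R]_d * 'rV[R]_d =>
  ((cnormsq (h p.1) + cnormsq (h p.2)) * Ke n (p.1 - p.2))%:E).
  apply/measurable_EFinP/measurable_funM => //; apply: measurable_funD.
    exact: measurableT_comp mQ measurable_fst.
  exact: measurableT_comp mQ measurable_snd.
apply: ge0_le_integral => //.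
- by move=> x _; apply: integral_ge0 => y _; rewrite lee_fin !mulr_ge0 ?cnorm1_ge0.
- by apply: (measurable_fun_fubini_tonelli_F _ m1) => p; rewrite lee_fin !mulr_ge0 ?cnorm1_ge0.
- apply: (measurable_fun_fubini_tonelli_F _ m2) => p /=; rewrite lee_fin.
  by apply: mulr_ge0; [apply: addr_ge0; exact: cnormsq_ge0|exact: Ke0].
move=> x _; apply: ge0_le_integral => //.
- by move=> y _; rewrite lee_fin !mulr_ge0 ?cnorm1_ge0.
- exact: measurableT_comp m1 (pair1_measurable x).
- exact: measurableT_comp m2 (pair1_measurable x).
move=> y _; rewrite lee_fin mulrA ler_pM ?mulr_ge0 ?cnorm1_ge0//.
(* Here [|h x| |h y|] is at most half the sum of the squares of [cnorm1], and each such square is at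
   most twice [cnormsq]. *)
have := cnorm1_sqr_le (h x); have := cnorm1_sqr_le (h y).
have := sqr_ge0 (cnorm1 (h x) - cnorm1 (h y)); nra.
Qed.

(* [\int |hhat|^2 W(xi / n)] is a quadratic form in [h] with an integrable
   convolution kernel of fixed mass, bounded by Schur's test; then [n] tends to
   infinity. *)
Lemma plancherel_le : exists2 B : R, 0 <= B & forall h, cintegrable mu h ->
  (\int[mu]_xi (cnormsq (fourier h xi))%:E <=
   B%:E * \int[mu]_x (cnormsq (h x))%:E)%E.
Proof.
have K0' : (0 <= \int[mu]_x (K x)%:E)%E by apply: integral_ge0 => x _; rewrite lee_fin.
exists (2 * fine (\int[mu]_x (K x)%:E)); first by rewrite mulr_ge0// fine_ge0.
move=> h ih; have mF := cmeasurable_fourier (cintegrable_cmeasurable ih).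
rewrite EFinM fineK ?ge0_fin_numE// -muleA.
apply: (@fatou_le _ _ _ _ (fun n xi => We n xi * cnormsq (fourier h xi))).
- move=> n; apply: measurable_funM; last exact: cmeasurable_cnormsq.
  exact: measurableT_comp mW (measurable_affine _ _).
- by move=> n xi; rewrite mulr_ge0 ?cnormsq_ge0// W0.
- move=> xi; rewrite -[X in _ --> X]mul1r; apply: cvgM; last exact: cvg_cst.
  have e : \prod_(j < d) (1 : R) = 1 by rewrite big1.
  rewrite /We /W -[X in _ --> X]e.
  apply: cvg_big => [|j _]; first exact: mul_continuous.
  rewrite (_ : (fun n => _) = fun n => bump (n.+1%:R^-1 * xi ord0 j + 0)); first exact: cvg_bump.
  by apply/funext => n; rewrite !mxE.
- by move=> n; exact: windowed.
Qed.

End plancherel_inequality.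

(** * Completeness of [L_2] and the inverse transform on it *)

Section l2_completeness.
Context (R : realType).

Lemma cvg_geometric_increments (u : nat -> R) (c : R) :
  (forall n, `|u n.+1 - u n| <= c * 2^-1 ^+ n) -> cvgn u.
Proof.
move=> uc.
have -> : u = fun n => u 0%N + series (telescope u) n.
  by apply/funext => n; exact: eq_sum_telescope.
apply: is_cvgD; first exact: is_cvg_cst.
apply: normed_cvg; apply: (@series_le_cvg _ _ (geometric c 2^-1)) => //.
- by move=> n /=; exact: normr_ge0.
- by move=> n /=; rewrite (le_trans _ (uc n)).
- apply: is_cvg_geometric_series.
  by rewrite ger0_norm ?invr_ge0// invf_lt1 ?ltr1n.
Qed.

Context dd (T : measurableType dd) (m : {measure set T -> \bar R}).

(** Riesz-Fischer with an explicit rate, so no subsequence has to be extracted. As [8 = 4 * 2], the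
    sum of [4 ^+ n * |D n|^2] still has a finite integral, at most [2 * C]; wherever it is finite,
    [|D n|] is of order [2 ^- n] and the sequence converges. *)
Lemma l2_complete (g : nat -> T -> R[i]) (C : R) :
  (forall n, cmeasurable (g n)) ->
  (forall n k, (n <= k)%N ->
    (\int[m]_x (cnormsq (g k x - g n x))%:E <= (C / 8 ^+ n)%:E)%E) ->
  exists2 G : T -> R[i], cmeasurable G &
    forall n, (\int[m]_x (cnormsq (G x - g n x))%:E <= (C / 8 ^+ n)%:E)%E.
Proof.
move=> mg gC.
pose D n x := g n.+1 x - g n x.
have mD n : cmeasurable (D n) by exact: cmeasurableB.
pose t n x := ((4 ^+ n * cnormsq (D n x))%:E : \bar R).
have t0 n x : (0 <= t n x)%E by rewrite lee_fin mulr_ge0 ?exprn_ge0 ?cnormsq_ge0.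
have mt n : measurable_fun setT (t n).
  by apply/measurable_EFinP/measurable_funM => //; exact: cmeasurable_cnormsq.
pose S x := (\sum_(n <oo) t n x)%E.
have mS : measurable_fun setT S by exact: ge0_emeasurable_sum.
have C0 : 0 <= C.
  have := gC 0%N 0%N (leqnn _); rewrite expr0 divr1 -lee_fin; apply: le_trans.
  by apply: integral_ge0 => x _; rewrite lee_fin cnormsq_ge0.
have iS : (\int[m]_x S x <= (2 * C)%:E)%E.
  rewrite integral_nneseries//.
  apply: lime_le; first by apply: is_cvg_nneseries => n _ _; exact: integral_ge0.
  apply: nearW => n.
  have tn k : (\int[m]_x t k x <= (C / 2 ^+ k)%:E)%E.
    under eq_integral do rewrite /t EFinM.
    rewrite ge0_integralZl//.
    - apply: (@le_trans _ _ ((4 ^+ k)%:E * (C / 8 ^+ k)%:E)%E).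
        by rewrite lee_wpmul2l ?lee_fin ?exprn_ge0// gC.
      rewrite -EFinM lee_fin mulrCA ler_wpM2l//.
      have -> : (8 : R) = 4 * 2 by rewrite -natrM.
      by rewrite exprMn invfM mulrA divff ?mul1r// expf_neq0.
    - by apply/measurable_EFinP; exact: cmeasurable_cnormsq.
    - by move=> x _; rewrite lee_fin cnormsq_ge0.
  apply: (@le_trans _ _ (\sum_(0 <= k < n) (C / 2 ^+ k))%:E).
    by rewrite -sumEFin; apply: lee_sum => k _.
  rewrite lee_fin (_ : \sum_(0 <= k < n) _ = 2 * C - 2 * C / 2 ^+ n).
    by rewrite gerBl divr_ge0 ?mulr_ge0 ?exprn_ge0.
  elim: n => [|n ih]; first by rewrite big_geq// expr0 divr1 subrr.
  by rewrite big_nat_recr//= ih exprS; field; rewrite expf_neq0.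
have S0 x : (0 <= S x)%E by exact: nneseries_ge0.
have fS : {ae m, forall x, S x \is a fin_num}.
  have : m.-integrable setT S.
    apply/integrableP; split => //; under eq_integral do rewrite gee0_abs//.
    by rewrite (le_lt_trans iS)// ltry.
  move=> /(integrable_ae measurableT); apply: filterS => x; exact.
pose E := [set x | S x \is a fin_num].
have mE : measurable E.
  by rewrite /E -[X in measurable X]setTI; exact: emeasurable_fin_num.
(* Setting the sequence to 0 on the null set where [S] is infinite makes it converge everywhere, so
   that the limit is measurable. *)
pose v n x : R[i] := if x \in E then g n x else 0.
have mv n : cmeasurable (v n).
  have key (f : T -> R) : measurable_fun setT f ->
      measurable_fun setT (fun x => if x \in E then f x else 0).
    move=> mf; apply: measurable_fun_ifT => //.
    apply: (@measurable_fun_bool _ _ _ _ true) => //; rewrite setTI.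
    rewrite (_ : _ @^-1` _ = E)//; apply/seteqP; split => x /=; first by move=> /set_mem.
    by move=> /mem_set.
  split.
    rewrite (_ : (fun x => _) = fun x => if x \in E then complex.Re (g n x) else 0).
      exact: key (mg n).1.
    by apply/funext => x; rewrite /v; case: ifP.
  rewrite (_ : (fun x => _) = fun x => if x \in E then complex.Im (g n x) else 0).
    exact: key (mg n).2.
  by apply/funext => x; rewrite /v; case: ifP.
have incr n x : x \in E -> cnormsq (D n x) <= fine (S x) / 4 ^+ n.
  rewrite inE => Ex; rewrite ler_pdivlMr ?exprn_gt0// mulrC -lee_fin fineK//.
  apply: (@le_trans _ _ (\sum_(0 <= k < n.+1) t k x)%E).
    by rewrite big_nat_recr//= leeDr// sume_ge0.
  exact: nneseries_lim_ge.
(* With [y = |r| * 2 ^+ n], the inequality [2 * y <= 1 + y ^+ 2 <= 1 + s] takes the place of a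
   square root. *)
have small (s r : R) n : 0 <= s -> r ^+ 2 <= s / 4 ^+ n -> `|r| <= (1 + s) / 2 * 2^-1 ^+ n.
  move=> s0 rs; have p0 : 0 < (2 : R) ^+ n by rewrite exprn_gt0.
  have e4 : (4 : R) ^+ n = 2 ^+ n * 2 ^+ n by rewrite -exprMn -natrM.
  rewrite exprVn ler_pdivlMr// .
  have : (`|r| * 2 ^+ n) ^+ 2 <= s.
    by rewrite exprMn real_normK ?num_real// (expr2 (2 ^+ n)) -e4 -ler_pdivlMr ?exprn_gt0.
  have := mulr_ge0 (normr_ge0 r) (ltW p0).
  have := sqr_ge0 (`|r| * 2 ^+ n - 1); nra.
have cvRe x : cvgn (fun n => complex.Re (v n x)).
  rewrite /v; case xE : (x \in E); last exact: is_cvg_cst.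
  apply: (@cvg_geometric_increments _ ((1 + fine (S x)) / 2)) => n.
  apply: small; first exact: fine_ge0.
  apply: le_trans (incr n x xE); rewrite /cnormsq /D Re_add.
  rewrite (_ : complex.Re (- g n x) = - complex.Re (g n x)); last by case: (g n x).
  by rewrite lerDl sqr_ge0.
have cvIm x : cvgn (fun n => complex.Im (v n x)).
  rewrite /v; case xE : (x \in E); last exact: is_cvg_cst.
  apply: (@cvg_geometric_increments _ ((1 + fine (S x)) / 2)) => n.
  apply: small; first exact: fine_ge0.
  apply: le_trans (incr n x xE); rewrite /cnormsq /D Im_add.
  rewrite (_ : complex.Im (- g n x) = - complex.Im (g n x)); last by case: (g n x).
  by rewrite lerDr sqr_ge0.
pose G x := Complex (limn (fun n => complex.Re (v n x))) (limn (fun n => complex.Im (v n x))).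
have mG : cmeasurable G.
  split => /=.
    by apply: (measurable_fun_cvg (h := fun n x => complex.Re (v n x))) => [n|x _]; [exact: (mv n).1|exact: cvRe].
  by apply: (measurable_fun_cvg (h := fun n x => complex.Im (v n x))) => [n|x _]; [exact: (mv n).2|exact: cvIm].
exists G => // n.
have -> : (\int[m]_x (cnormsq (G x - g n x))%:E = \int[m]_x (cnormsq (G x - v n x))%:E)%E.
  apply: ae_eq_integral => //.
  - by apply/measurable_EFinP/cmeasurable_cnormsq/cmeasurableB.
  - by apply/measurable_EFinP/cmeasurable_cnormsq/cmeasurableB.
  - by apply: filterS fS => x Ex _; rewrite /v mem_set.
(* The shift by [n] keeps the indices ordered, so [gC] applies for every [k]. *)
apply: (@fatou_le _ _ _ _ (fun k x => cnormsq (v (k + n)%N x - v n x))).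
- by move=> k; apply/cmeasurable_cnormsq/cmeasurableB.
- by move=> k x; exact: cnormsq_ge0.
- move=> x; rewrite /cnormsq.
  have Re_sub (z w : R[i]) : complex.Re (z - w) = complex.Re z - complex.Re w.
    by case: z w => [? ?] [].
  have Im_sub (z w : R[i]) : complex.Im (z - w) = complex.Im z - complex.Im w.
    by case: z w => [? ?] [].
  rewrite Re_sub Im_sub; under eq_fun do rewrite Re_sub Im_sub.
  apply: cvgD.
    apply: (@cvg_comp _ _ _ _ (fun r : R => r ^+ 2)); last exact: exprn_continuous.
    apply: cvgB; last exact: cvg_cst.
    rewrite (cvg_shiftn n (fun k => complex.Re (v k x))); exact: cvRe.
  apply: (@cvg_comp _ _ _ _ (fun r : R => r ^+ 2)); last exact: exprn_continuous.
  apply: cvgB; last exact: cvg_cst.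
  rewrite (cvg_shiftn n (fun k => complex.Im (v k x))); exact: cvIm.
- move=> k; apply: le_trans (gC n (k + n)%N (leq_addl _ _)).
  apply: ge0_le_integral => //.
  + by move=> x _; rewrite lee_fin cnormsq_ge0.
  + by apply/measurable_EFinP/cmeasurable_cnormsq/cmeasurableB.
  + by apply/measurable_EFinP/cmeasurable_cnormsq/cmeasurableB.
  + move=> x _; rewrite lee_fin /v; case: ifP => // _.
    by rewrite subr0 {1}/cnormsq /= expr0n addr0 cnormsq_ge0.
Qed.

End l2_completeness.

Section l2_pairing.
Context (R : realType) dd (T : measurableType dd) (m : {measure set T -> \bar R}).

(** Young's inequality with a free parameter [s] in place of Cauchy-Schwarz. Its factor 1/2 absorbs
    the 2 of [cnorm1_sqr_le], and [s] is later tuned to a small [A] against a fixed [B]. *)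
Lemma l2_pairing (a b : T -> R[i]) (A B s : R) : 0 < s ->
  cmeasurable a -> cmeasurable b ->
  (\int[m]_x (cnormsq (a x))%:E <= A%:E)%E ->
  (\int[m]_x (cnormsq (b x))%:E <= B%:E)%E ->
  cintegrable m (fun x => a x * b x) /\
  cnorm1 (cint m (fun x => a x * b x)) <= s * A + B / s.
Proof.
move=> s0 ma mb aA bB.
have young (x y p q : R) : x ^+ 2 <= 2 * p -> y ^+ 2 <= 2 * q -> x * y <= s * p + s^-1 * q.
  move=> xp yq; rewrite -(ler_pM2l s0).
  have -> : s * (s * p + s^-1 * q) = s ^+ 2 * p + q by field; rewrite gt_eqF.
  have := sqr_ge0 (s * x - y).
  have : s ^+ 2 * x ^+ 2 <= s ^+ 2 * (2 * p) by rewrite ler_wpM2l ?sqr_ge0.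
  nra.
have ab x : cnorm1 (a x * b x) <= s * cnormsq (a x) + s^-1 * cnormsq (b x).
  rewrite (le_trans (cnorm1M _ _))//.
  exact: young (cnorm1_sqr_le _) (cnorm1_sqr_le _).
have mab : cmeasurable (fun x => a x * b x) by exact: cmeasurableM.
have I : (\int[m]_x (cnorm1 (a x * b x))%:E <= (s * A + B / s)%:E)%E.
  apply: (@le_trans _ _ (\int[m]_x ((s * cnormsq (a x))%:E + (s^-1 * cnormsq (b x))%:E))%E).
    apply: ge0_le_integral => //.
    - by move=> x _; rewrite lee_fin cnorm1_ge0.
    - by apply/measurable_EFinP; exact: cmeasurable_cnorm1.
    - by apply: emeasurable_funD; apply/measurable_EFinP/measurable_funM => //; exact: cmeasurable_cnormsq.
    - by move=> x _; rewrite -EFinD lee_fin.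
  rewrite ge0_integralD//; last 4 first.
  - by move=> x _; rewrite lee_fin mulr_ge0 ?cnormsq_ge0// ltW.
  - by apply/measurable_EFinP/measurable_funM => //; exact: cmeasurable_cnormsq.
  - by move=> x _; rewrite lee_fin mulr_ge0 ?cnormsq_ge0// invr_ge0 ltW.
  - by apply/measurable_EFinP/measurable_funM => //; exact: cmeasurable_cnormsq.
  rewrite EFinD; apply: leeD.
    under eq_integral do rewrite EFinM.
    rewrite ge0_integralZl//; last 3 first.
    - by apply/measurable_EFinP; exact: cmeasurable_cnormsq.
    - by move=> x _; rewrite lee_fin cnormsq_ge0.
    - by rewrite lee_fin ltW.
    by rewrite EFinM lee_wpmul2l// lee_fin ltW.
  under eq_integral do rewrite EFinM.
  rewrite ge0_integralZl//; last 3 first.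
  - by apply/measurable_EFinP; exact: cmeasurable_cnormsq.
  - by move=> x _; rewrite lee_fin cnormsq_ge0.
  - by rewrite lee_fin invr_ge0 ltW.
  by rewrite mulrC EFinM lee_wpmul2l// lee_fin invr_ge0 ltW.
have iab : cintegrable m (fun x => a x * b x).
  by apply: cintegrableP => //; rewrite (le_lt_trans I)// ltry.
by split => //; rewrite -lee_fin (le_trans (EFin_cnorm1_cint iab)).
Qed.

End l2_pairing.

Section inverse_transform.
Context (R : realType) (d : nat).
Local Notation mu := (lebesgue_rv R d).
Implicit Types f g h : 'rV[R]_d -> R[i].

Lemma cnormsqJ (z : R[i]) : cnormsq (conjc z) = cnormsq z.
Proof. by case: z => a b; rewrite /cnormsq /= sqrrN. Qed.

Lemma cnormsq_realM (r : R) (z : R[i]) : cnormsq ((r%:C)%C * z) = r ^+ 2 * cnormsq z.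
Proof. by case: z => a b; rewrite /cnormsq /=; ring. Qed.

Lemma cnormsqD (z w : R[i]) : cnormsq (z + w) <= 2 * cnormsq z + 2 * cnormsq w.
Proof.
case: z w => [a b] [c e]; rewrite /cnormsq /=.
have := sqr_ge0 (a - c); have := sqr_ge0 (b - e); nra.
Qed.

Lemma cmeasurable_inv_fourier f : cintegrable mu f -> cmeasurable (inv_fourier f).
Proof.
move=> fi; rewrite (_ : inv_fourier f = fun x => conjc (fourier (fun y => conjc (f y)) x)).
  apply/cmeasurableJ/cmeasurable_fourier/cmeasurableJ; exact: cintegrable_cmeasurable fi.
by apply/funext => x; exact: inv_fourierE.
Qed.

Lemma inv_fourierB f g x : cintegrable mu f -> cintegrable mu g ->
  inv_fourier (fun y => f y - g y) x = inv_fourier f x - inv_fourier g x.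
Proof.
move=> fi gi.
have iw k : cintegrable mu k ->
    cintegrable mu (fun y => k y * cexpi (2 * pi * dotp x y)).
  move=> ki; apply: (cintegrable_bounded_mul ki) => [|y]; last exact: cnorm1_cexpi.
  apply: cmeasurable_cexpi; apply: measurable_funM => //.
  exact: measurable_dotp.
rewrite /inv_fourier -[LHS]/(cint _ _) -[RHS]/(cint _ _ - cint _ _).
rewrite -[X in _ + X]mulN1r -cintZ; last exact: iw.
rewrite -cintD; [|exact: iw|by apply: cintegrableZ; exact: iw].
by apply: eq_cint => y; ring.
Qed.

Lemma inv_multiplication_formula f g : cintegrable mu f -> cintegrable mu g ->
  cint mu (fun x => inv_fourier f x * g x) = cint mu (fun x => f x * inv_fourier g x).
Proof.
move=> fi gi; have fJ := cintegrableJ fi; have gJ := cintegrableJ gi.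
have bnd k l : cintegrable mu k -> cintegrable mu l ->
    cintegrable mu (fun x => k x * fourier l x).
  move=> ki li; apply: (cintegrable_bounded_mul ki (M := 2 * \int[mu]_x cnorm1 (l x))).
    by apply: cmeasurable_fourier; exact: cintegrable_cmeasurable li.
  by move=> x; exact: cnorm1_fourier.
transitivity (conjc (cint mu (fun x => fourier (fun y => conjc (f y)) x * conjc (g x)))).
  have b : cintegrable mu (fun x => fourier (fun y => conjc (f y)) x * conjc (g x)).
    have := bnd _ _ gJ fJ; congr (cintegrable _ _); apply/funext => x; exact: mulrC.
  by rewrite -(cintJ b); apply: eq_cint => x; rewrite inv_fourierE// conjcM conjcK.
rewrite multiplication_formula// -cintJ; last exact: bnd.
by apply: eq_cint => x; rewrite conjcM conjcK inv_fourierE.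
Qed.

End inverse_transform.

Lemma small_geometric (R : realType) (q : nat) (c e : R) : (1 < q)%N -> 0 < e ->
  exists n : nat, c / q%:R ^+ n <= e.
Proof.
move=> q1 e0; exists (Num.bound `|c / e|).
rewrite ler_pdivrMr ?exprn_gt0 ?ltr0n ?(ltnW q1)// mulrC -ler_pdivrMr//.
rewrite (le_trans (ler_norm _))// (le_trans (ltW (archi_boundP (normr_ge0 _))))//.
by rewrite -natrX ler_nat ltnW// ltn_expl.
Qed.

Section l2_inverse_transform.
Context (R : realType) (d : nat).
Local Notation mu := (lebesgue_rv R d).
Implicit Types f g h : 'rV[R]_d -> R[i].

Let cube (n : nat) : set 'rV[R]_d := [set x | forall i : 'I_d, `[- n%:R, n%:R]%classic (x ord0 i)].

Let mcube n : measurable (cube n).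
Proof.
rewrite (_ : cube n = \bigcap_(i in [set: 'I_d])
    ((fun x : 'rV[R]_d => x ord0 i) @^-1` `[- n%:R, n%:R]%classic)).
  apply: fin_bigcap_measurable => [|i _]; first exact: finite_finset.
  by rewrite -[X in measurable X]setTI; apply: measurable_coord.
by apply/seteqP; split => x Bx i => [_|]; exact: Bx.
Qed.

Let cube_fin n : (mu (cube n) < +oo)%E.
Proof.
rewrite (@lebesgue_rv_box R d (fun=> `[- n%:R, n%:R]%classic))//.
suff H : (0 <= \prod_(i < d)
  lebesgue_measure (`[(- n%:R)%R, (n%:R)%R]%classic : set R) < +oo)%E by case/andP: H.
elim/big_ind : _ => [|x y /andP[x0 x1] /andP[y0 y1]|j _].
- by rewrite lee01 ltry.
- by rewrite mule_ge0// lte_mul_pinfty// ge0_fin_numE.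
- by rewrite measure_ge0/= lebesgue_measure_itv/=; case: ifP => _; rewrite -?EFinD ltry.
Qed.

Let I n (x : 'rV[R]_d) : R := \1_(cube n) x.

Let I01 n x : I n x = 0 \/ I n x = 1.
Proof. by rewrite /I indicE; case: (x \in _); [right|left]. Qed.

Let mI n : measurable_fun setT (I n).
Proof. exact: measurable_indic. Qed.

Let I_near x : \forall n \near \oo, I n x = 1.
Proof.
near=> n; rewrite /I indicE mem_set// => i /=; rewrite in_itv/= -ler_norml.
rewrite (le_trans (coord_le_enorm x i))//.
near: n; exact: nbhs_infty_ger.
Unshelve. all: by end_near. Qed.

Let trunc h n x : R[i] := ((I n x)%:C)%C * h x.

Let mtrunc h n : cmeasurable h -> cmeasurable (trunc h n).
Proof. by move=> mh; apply: cmeasurableM => //; exact: cmeasurable_real. Qed.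

(** A cube has finite measure, so its indicator is square integrable and can be paired with [h]. *)
Let itrunc h n (A : R) : cmeasurable h -> (\int[mu]_x (cnormsq (h x))%:E <= A%:E)%E ->
  cintegrable mu (trunc h n).
Proof.
move=> mh hA; have iI : (\int[mu]_x (cnormsq ((I n x)%:C)%C)%:E <= (fine (mu (cube n)))%:E)%E.
  have eI : (\int[mu]_x (I n x)%:E = mu (cube n))%E by rewrite integral_indic// setIT.
  rewrite fineK; last by rewrite ge0_fin_numE ?measure_ge0//; exact: cube_fin.
  rewrite -eI.
  apply: ge0_le_integral => //.
  - by move=> x _; rewrite lee_fin cnormsq_ge0.
  - by apply/measurable_EFinP/cmeasurable_cnormsq/cmeasurable_real.
  - exact/measurable_EFinP.
  - move=> x _; rewrite lee_fin -/(I n x) /cnormsq /=.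
    by have [->|->] := I01 n x; rewrite ?expr0n ?expr1n ?addr0.
have mIc : cmeasurable (fun x => ((I n x)%:C)%C) by exact: cmeasurable_real.
by have [] := l2_pairing ltr01 mIc mh iI hA.
Qed.

Let tail h n x := (1 - I n x) * cnormsq (h x).

Let tail_small h (e : R) : 0 < e -> cmeasurable h ->
  (\int[mu]_x (cnormsq (h x))%:E < +oo)%E ->
  exists n, (\int[mu]_x (tail h n x)%:E <= e%:E)%E.
Proof.
move=> e0 mh hoo.
have mt n : measurable_fun setT (fun x => (tail h n x)%:E).
  apply/measurable_EFinP/measurable_funM; last exact: cmeasurable_cnormsq.
  exact: measurable_funB.
have t0 n x : 0 <= tail h n x.
  by rewrite mulr_ge0 ?cnormsq_ge0//; have [->|->] := I01 n x; rewrite ?subr0 ?subrr.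
have ih : mu.-integrable setT (fun x => (cnormsq (h x))%:E).
  apply/integrableP; split; first by apply/measurable_EFinP; exact: cmeasurable_cnormsq.
  by under eq_integral do rewrite gee0_abs ?lee_fin ?cnormsq_ge0//.
have tcvg : {ae mu, forall x, setT x -> (tail h n x)%:E @[n --> \oo] --> (cst 0%E x : \bar R)}.
  apply: aeW => x _; apply: cvg_near_cst.
  by near=> n; rewrite /tail (near (I_near x) n) ?subrr ?mul0r//; near: n.
have tdom : {ae mu, forall x n, setT x -> (`|(tail h n x)%:E| <= (cnormsq (h x))%:E)%E}.
  apply: aeW => x n _; rewrite gee0_abs ?lee_fin// /tail ler_piMl ?cnormsq_ge0//.
  by have [->|->] := I01 n x; rewrite ?subr0 ?subrr.
have [_ _] := dominated_convergence measurableT mt (measurable_cst _) tcvg ih tdom.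
rewrite integral0 => /fine_cvgP[].
move=> fn /cvgrPdist_le /(_ _ e0) H.
near \oo => n; exists n.
have f : (\int[mu]_x (tail h n x)%:E)%E \is a fin_num by near: n; exact: fn.
have : `|0 - fine (\int[mu]_x (tail h n x)%:E)%E| <= e by near: n; exact: H.
rewrite sub0r normrN ger0_norm; first by rewrite -lee_fin fineK.
by apply: fine_ge0; apply: integral_ge0 => x _; rewrite lee_fin.
Unshelve. all: by end_near. Qed.

Let tail_ge0 h n x : 0 <= tail h n x.
Proof. by rewrite mulr_ge0 ?cnormsq_ge0//; have [->|->] := I01 n x; rewrite ?subr0 ?subrr. Qed.

Let mtail h n : cmeasurable h -> measurable_fun setT (fun x => (tail h n x)%:E).
Proof.
move=> mh; apply/measurable_EFinP/measurable_funM; last exact: cmeasurable_cnormsq.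
exact: measurable_funB.
Qed.

Let trunc_sub h n x : cnormsq (h x - trunc h n x) = tail h n x.
Proof.
rewrite /trunc /tail -{1}(mul1r (h x)) -mulrBl -[1]/((1 : R)%:C)%C -rmorphB cnormsq_realM.
by have [->|->] := I01 n x; rewrite ?subr0 ?subrr ?expr1n ?expr0n.
Qed.

Let trunc_dist h n k x : cnormsq (trunc h k x - trunc h n x) <= tail h k x + tail h n x.
Proof.
rewrite /trunc /tail -mulrBl -rmorphB cnormsq_realM -mulrDl ler_wpM2r ?cnormsq_ge0//.
by have [->|->] := I01 n x; have [->|->] := I01 k x; lra.
Qed.

(* The pairing with [phi] identifies [g] with the distributional inverse Fourier
   transform of [h]. *)
Lemma l2_inv_fourier : exists2 C : R, 0 <= C & forall h, cmeasurable h ->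
  (\int[mu]_x (cnormsq (h x))%:E < +oo)%E ->
  exists2 g : 'rV[R]_d -> R[i], cmeasurable g &
    (\int[mu]_x (cnormsq (g x))%:E <= C%:E * \int[mu]_x (cnormsq (h x))%:E)%E /\
    forall phi, cintegrable mu phi -> (\int[mu]_x (cnormsq (phi x))%:E < +oo)%E ->
      cint mu (fun x => h x * inv_fourier phi x) = cint mu (fun x => g x * phi x).
Proof.
have [B B0 plB] := plancherel_le R d.
have invP f : cintegrable mu f -> (\int[mu]_x (cnormsq (inv_fourier f x))%:E <=
    B%:E * \int[mu]_x (cnormsq (f x))%:E)%E.
  move=> fi; under eq_integral do rewrite inv_fourierE// cnormsqJ.
  rewrite (le_trans (plB _ (cintegrableJ fi)))//.
  by under eq_integral do rewrite cnormsqJ.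
(* The 2 comes from [|G|^2 <= 2 |G - g n|^2 + 2 |g n|^2], where the integral of the first term tends
   to 0. *)
exists (2 * B); first by rewrite mulr_ge0.
move=> h mh hoo.
have h0 : (0 <= \int[mu]_x (cnormsq (h x))%:E)%E.
  by apply: integral_ge0 => x _; rewrite lee_fin cnormsq_ge0.
pose y := fine (\int[mu]_x (cnormsq (h x))%:E)%E.
have yE : (\int[mu]_x (cnormsq (h x))%:E = y%:E)%E by rewrite fineK// ge0_fin_numE.
have hy : (\int[mu]_x (cnormsq (h x))%:E <= y%:E)%E by rewrite yE.
have y0 : 0 <= y by rewrite fine_ge0.
have p8 n : 0 < (8 : R) ^+ n by rewrite exprn_gt0.
have p2 n : 0 < (2 : R) ^+ n by rewrite exprn_gt0.
(* Truncations are chosen with tails below [8 ^- n], so that the transformed sequence has the rate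
   demanded by [l2_complete], with constant [2 * B]. *)
have /choice[k Hk] : forall n, exists k, (\int[mu]_x (tail h k x)%:E <= ((8 ^+ n)^-1)%:E)%E.
  by move=> n; apply: tail_small => //; rewrite invr_gt0.
pose H n := trunc h (k n).
have iH n : cintegrable mu (H n) by exact: itrunc mh hy.
have mH n : cmeasurable (H n) by exact: mtrunc.
pose g n := inv_fourier (H n).
have mg n : cmeasurable (g n) by exact: cmeasurable_inv_fourier.
have Hdist a b : (a <= b)%N ->
    (\int[mu]_x (cnormsq (H b x - H a x))%:E <= (2 / 8 ^+ a)%:E)%E.
  move=> ab; apply: (@le_trans _ _ (\int[mu]_x ((tail h (k b) x)%:E + (tail h (k a) x)%:E))%E).
    apply: ge0_le_integral => //.
    - by move=> x _; rewrite lee_fin cnormsq_ge0.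
    - by apply/measurable_EFinP/cmeasurable_cnormsq/cmeasurableB.
    - by apply: emeasurable_funD; exact: mtail.
    - by move=> x _; rewrite -EFinD lee_fin trunc_dist.
  rewrite ge0_integralD//; [|by move=> x _; rewrite lee_fin tail_ge0|exact: mtail|
    by move=> x _; rewrite lee_fin tail_ge0|exact: mtail].
  rewrite (le_trans (leeD (Hk b) (Hk a)))// -EFinD lee_fin mulrDl mul1r lerD2r.
  by rewrite lef_pV2 ?posrE// ler_weXn2l// ler1n.
have gdist a b : (a <= b)%N ->
    (\int[mu]_x (cnormsq (g b x - g a x))%:E <= (2 * B / 8 ^+ a)%:E)%E.
  move=> ab; under eq_integral do rewrite -inv_fourierB//.
  have iBA : cintegrable mu (fun x => H b x - H a x).
    have := cintegrableD (iH b) (cintegrableZ (-1) (iH a)).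
    by congr (cintegrable _ _); apply/funext => x; rewrite mulN1r.
  rewrite (le_trans (invP _ iBA))// [2 * B]mulrC -mulrA EFinM.
  by rewrite lee_wpmul2l ?lee_fin// Hdist.
have [G mG Gg] := l2_complete mg gdist.
exists G => //; split.
  apply/lee_addgt0Pr => e e0.
  have [n ne] := small_geometric (4 * B) (isT : (1 < 8)%N) e0.
  have gn : (\int[mu]_x (cnormsq (g n x))%:E <= (B * y)%:E)%E.
    rewrite (le_trans (invP _ (iH n)))// EFinM lee_wpmul2l ?lee_fin// -yE.
    apply: ge0_le_integral => //.
    - by move=> x _; rewrite lee_fin cnormsq_ge0.
    - by apply/measurable_EFinP/cmeasurable_cnormsq.
    - by apply/measurable_EFinP/cmeasurable_cnormsq.
    - move=> x _; rewrite lee_fin /H /trunc cnormsq_realM ler_piMl ?cnormsq_ge0//.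
      by have [->|->] := I01 (k n) x; rewrite ?expr0n ?expr1n.
  have mGg : cmeasurable (fun x => G x - g n x) by exact: cmeasurableB.
  apply: (@le_trans _ _ (\int[mu]_x (2%:E * (cnormsq (G x - g n x))%:E + 2%:E * (cnormsq (g n x))%:E))%E).
    apply: ge0_le_integral => //.
    - by move=> x _; rewrite lee_fin cnormsq_ge0.
    - by apply/measurable_EFinP/cmeasurable_cnormsq.
    - by apply: emeasurable_funD; apply: measurable_funeM; apply/measurable_EFinP/cmeasurable_cnormsq.
    - by move=> x _; rewrite -!EFinM -EFinD lee_fin -{1}(subrK (g n x) (G x)) cnormsqD.
  rewrite ge0_integralD//; last 4 first.
  - by move=> x _; rewrite -EFinM lee_fin mulr_ge0 ?cnormsq_ge0.
  - by apply: measurable_funeM; apply/measurable_EFinP/cmeasurable_cnormsq.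
  - by move=> x _; rewrite -EFinM lee_fin mulr_ge0 ?cnormsq_ge0.
  - by apply: measurable_funeM; apply/measurable_EFinP/cmeasurable_cnormsq.
  rewrite !ge0_integralZl//; try (by move=> x _; rewrite lee_fin cnormsq_ge0);
    try (by apply/measurable_EFinP/cmeasurable_cnormsq).
  apply: (@le_trans _ _ (2%:E * (2 * B / 8 ^+ n)%:E + 2%:E * (B * y)%:E)%E).
    by apply: leeD; rewrite lee_wpmul2l// lee_fin.
  rewrite yE -!EFinM -!EFinD lee_fin [leRHS]addrC [leRHS]addrC.
  move: ne; rewrite (_ : 4 * B / 8 ^+ n = 2 * (2 * B / 8 ^+ n)); first by lra.
  by field; rewrite expf_neq0.
move=> phi iphi phioo.
have mphi := cintegrable_cmeasurable iphi.
have phi0 : (0 <= \int[mu]_x (cnormsq (phi x))%:E)%E.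
  by apply: integral_ge0 => x _; rewrite lee_fin cnormsq_ge0.
pose f := fine (\int[mu]_x (cnormsq (phi x))%:E)%E.
have fE : (\int[mu]_x (cnormsq (phi x))%:E = f%:E)%E by rewrite fineK// ge0_fin_numE.
have f0 : 0 <= f by rewrite fine_ge0.
have phif : (\int[mu]_x (cnormsq (phi x))%:E <= f%:E)%E by rewrite fE.
have mip := cmeasurable_inv_fourier iphi.
have ipf : (\int[mu]_x (cnormsq (inv_fourier phi x))%:E <= (B * f)%:E)%E.
  by rewrite (le_trans (invP _ iphi))// fE.
(* Both pairings are compared with those of the truncations, which agree by
   [inv_multiplication_formula]. The errors have squared norms of order [8 ^- n] and the other
   factors are fixed, so [l2_pairing] with [s = 2 ^+ n] leaves a remainder of order [2 ^- n]. *)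
suff key n : cnorm1 (cint mu (fun x => h x * inv_fourier phi x) -
    cint mu (fun x => G x * phi x)) <= (1 + B * f + (2 * B + f)) / 2 ^+ n.
  apply/eqP; rewrite -subr_eq0; apply/eqP; move: key; set z := _ - _ => key.
  have z0 : cnorm1 z <= 0.
    apply/ler_addgt0Pr => e e0; rewrite add0r.
    have [n] := small_geometric (1 + B * f + (2 * B + f)) (isT : (1 < 2)%N) e0.
    exact: le_trans (key n).
  move: z0; rewrite /cnorm1 => z0.
  have a0 := normr_ge0 (complex.Re z); have b0 := normr_ge0 (complex.Im z).
  have /eqP a1 : `|complex.Re z| == 0 by apply/eqP; lra.
  have /eqP b1 : `|complex.Im z| == 0 by apply/eqP; lra.
  apply/eqP; rewrite eq_complex /=; apply/andP; split; apply/eqP; exact: normr0_eq0.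
have mhH : cmeasurable (fun x => h x - H n x) by exact: cmeasurableB.
have mGg : cmeasurable (fun x => G x - g n x) by exact: cmeasurableB.
have hH : (\int[mu]_x (cnormsq (h x - H n x))%:E <= ((8 ^+ n)^-1)%:E)%E.
  by under eq_integral do rewrite trunc_sub.
have [i1 b1] := l2_pairing (p2 n) mhH mip hH ipf.
have [i2 b2] := l2_pairing (p2 n) mGg mphi (Gg n) phif.
have iHi : cintegrable mu (fun x => H n x * inv_fourier phi x).
  apply: (cintegrable_bounded_mul (iH n) (M := 2 * \int[mu]_x cnorm1 (phi x))) => // x.
  rewrite inv_fourierE// cnorm1J (le_trans (cnorm1_fourier _ (cintegrableJ iphi)))//.
  rewrite le_eqVlt; apply/orP; left; apply/eqP; congr (_ * _).
  by apply: eq_Rintegral => t _; rewrite cnorm1J.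
have igp : cintegrable mu (fun x => g n x * phi x).
  have := cintegrable_bounded_mul iphi (mg n) (M := 2 * \int[mu]_x cnorm1 (H n x)).
  rewrite (_ : (fun x => phi x * g n x) = fun x => g n x * phi x).
    apply => x; rewrite /g inv_fourierE// cnorm1J (le_trans (cnorm1_fourier _ (cintegrableJ (iH n))))//.
    rewrite le_eqVlt; apply/orP; left; apply/eqP; congr (_ * _).
    by apply: eq_Rintegral => t _; rewrite cnorm1J.
  by apply/funext => x; rewrite mulrC.
have -> : cint mu (fun x => h x * inv_fourier phi x) =
    cint mu (fun x => (h x - H n x) * inv_fourier phi x) + cint mu (fun x => H n x * inv_fourier phi x).
  by rewrite -cintD//; apply: eq_cint => x; rewrite mulrBl subrK.
have -> : cint mu (fun x => G x * phi x) =
    cint mu (fun x => (G x - g n x) * phi x) + cint mu (fun x => g n x * phi x).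
  by rewrite -cintD//; apply: eq_cint => x; rewrite mulrBl subrK.
rewrite -(inv_multiplication_formula (iH n) iphi) opprD addrACA subrr addr0.
rewrite (le_trans (cnorm1B _ _))// (le_trans (lerD b1 b2))//.
have e8 : (8 : R) ^+ n = 2 ^+ n * 4 ^+ n by rewrite -exprMn -natrM.
have e4 : (4 ^+ n)^-1 <= (2 ^+ n)^-1 :> R.
  by rewrite lef_pV2 ?posrE ?exprn_gt0// lerXn2r// ?nnegrE// ler_nat.
have -> : 2 ^+ n / 8 ^+ n = (4 ^+ n)^-1 :> R.
  by rewrite e8; field; rewrite !expf_neq0.
have -> : 2 ^+ n * (2 * B / 8 ^+ n) = 2 * B * (4 ^+ n)^-1 :> R.
  by rewrite e8; field; rewrite !expf_neq0.
have := ler_wpM2l (mulr_ge0 (ler0n R 2) B0) e4; move: e4.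
set p := (2 ^+ n)^-1; set q := (4 ^+ n)^-1; lra.
Qed.

End l2_inverse_transform.

(** * Measurability of continuous functions; Schwartz functions *)

Section continuous_measurable_row_vectors.
Context (R : realType) (d : nat).

(** The sigma-algebra on row vectors is generated by the coordinates, not by the open sets. An open
    set is the countable union of the boxes it contains with rational center and side parameter
    [n.+1^-1]. *)
Lemma open_measurable_rv (U : set 'rV[R]_d) : open U -> measurable U.
Proof.
move=> oU.
pose box (p : 'rV[rat]_d * nat) : set 'rV[R]_d :=
  [set x | forall i : 'I_d, `|ratr (p.1 ord0 i) - x ord0 i| < p.2.+1%:R^-1].
have mbox p : measurable (box p).
  rewrite (_ : box p = \bigcap_(i in [set: 'I_d])
      ((fun x : 'rV[R]_d => x ord0 i) @^-1` [set t | `|ratr (p.1 ord0 i) - t| < p.2.+1%:R^-1])).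
    apply: fin_bigcap_measurable => [|i _]; first exact: finite_finset.
    rewrite -[X in measurable X]setTI; apply: measurable_coord => //.
    rewrite (_ : mkset _ = `]ratr (p.1 ord0 i) - p.2.+1%:R^-1, ratr (p.1 ord0 i) + p.2.+1%:R^-1[%classic)//.
    by apply/seteqP; split => t /=; rewrite in_itv/= ltr_distlC.
  by apply/seteqP; split => x Bx i => [_|]; exact: Bx.
pose F (p : 'rV[rat]_d * nat) := if `[< box p `<=` U >] then box p else set0.
have -> : U = \bigcup_p F p.
  apply/seteqP; split => [x Ux|x [p _]]; last first.
    by rewrite /F; case: asboolP => // pU /pU.
  have /nbhs_ballP[e /= e0 eU] : nbhs x U by exact: open_nbhs_nbhs.
  pose n := Num.bound (2 / e).
  have n0 : 0 < (n.+1%:R : R)^-1 by rewrite invr_gt0.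
  (* Two steps of length below [n.+1^-1] lead from [x] to the rational center and on to any point of
     the box. *)
  have ne : 2 * (n.+1%:R : R)^-1 < e.
    rewrite ltr_pdivrMr// mulrC -ltr_pdivrMr//.
    by rewrite (lt_trans (archi_boundP (ltW (divr_gt0 _ e0))))// ltr_nat.
  have /choice[q qx] : forall i : 'I_d, exists q : rat,
      `|ratr q - x ord0 i| < (n.+1%:R : R)^-1.
    move=> i; have /rat_in_itvoo[q] : x ord0 i - n.+1%:R^-1 < x ord0 i + n.+1%:R^-1 :> R.
      by rewrite ltrBlDr -addrA ltrDl addr_gt0.
    by rewrite in_itv /= => qx; exists q; rewrite distrC ltr_distlC.
  exists (\row_i q i, n) => //; rewrite /F.
  have xb : box (\row_i q i, n) x by move=> i /=; rewrite mxE.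
  case: asboolP => // -[]; move=> y yb; apply: eU; split => // i j.
  rewrite (ord1 i) /ball /=.
  have := yb j; have := qx j; rewrite /= mxE => h1 h2.
  rewrite (le_lt_trans (ler_distD (ratr (q j)) _ _))//.
  by rewrite (lt_trans _ ne)// mulr2n mulrDl mul1r distrC ltrD.
apply: countable_bigcupT_measurable; first exact: countableP.
by move=> p; rewrite /F; case: asboolP.
Qed.

Lemma continuous_measurable_rv (f : 'rV[R]_d -> R) :
  continuous f -> measurable_fun setT f.
Proof.
move=> /continuousP cf; apply: (measurability _ (RGenOpens.measurableE R)).
move=> _ [_ [a [b ->] <-]]; rewrite setTI; apply: open_measurable_rv.
exact/cf/interval_open.
Qed.

End continuous_measurable_row_vectors.

Section schwartz_functions.
Context (R : realType) (d : nat).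
Local Notation mu := (lebesgue_rv R d).

(** Each factor satisfies [(1 + |x|)^2 * 16 / (1 + x_j^2) >= 1]. Hence decay of order [2 * d] is
    enough for domination by [lorentzian]. *)
Lemma lorentzian_lower (x : 'rV[R]_d) : 1 <= (1 + enorm x) ^+ (2 * d) * lorentzian x.
Proof.
have -> : (1 + enorm x) ^+ (2 * d) = \prod_(j < d) (1 + enorm x) ^+ 2.
  by rewrite prodr_const card_ord exprM.
have e1 : \prod_(j < d) (1 : R) = 1 by rewrite big1.
rewrite /lorentzian -big_split /= -[leLHS]e1.
apply: ler_prod => j _; rewrite ler01 /=.
have p : 0 < 1 + x ord0 j ^+ 2 by rewrite ltr_pwDl// sqr_ge0.
rewrite mulrA ler_pdivlMr// mul1r.
have := coord_le_enorm x j; have := normr_ge0 (x ord0 j); have := enorm_ge0 x.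
rewrite -(real_normK (num_real (x ord0 j))); nra.
Qed.

Lemma real_schwartz_majorant (h : 'rV[R]_d -> R) : real_schwartz h ->
  [/\ measurable_fun setT h, exists M0, forall x, `|h x| <= M0 &
      exists M, forall x, `|h x| <= M * lorentzian x].
Proof.
move=> /(_ [::])[/= dh bh]; split.
- by apply: continuous_measurable_rv => x; exact: differentiable_continuous.
- by have [M hM] := bh 0%N; exists M => x; rewrite -[leLHS]mul1r -(expr0 (1 + enorm x)).
- have [M hM] := bh (2 * d)%N; exists M => x.
  have k0 := lorentzian_ge0 x.
  apply: le_trans (ler_wpM2r k0 (hM x)).
  by rewrite mulrAC ler_peMl// lorentzian_lower.
Qed.

Lemma schwartz_integrable (phi : 'rV[R]_d -> R[i]) : schwartz phi ->
  cintegrable mu phi /\ (\int[mu]_x (cnormsq (phi x))%:E < +oo)%E.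
Proof.
move=> [/real_schwartz_majorant[m1 [A0 hA0] [A hA]] /real_schwartz_majorant[m2 [B0 hB0] [B hB]]].
have ilor : mu.-integrable setT (EFin \o @lorentzian R d).
  apply/integrableP; split; first by apply/measurable_EFinP; exact: measurable_lorentzian.
  under eq_integral do rewrite gee0_abs ?lee_fin ?lorentzian_ge0//.
  exact: integral_lorentzian.
have mphi : cmeasurable phi by [].
have iphi : cintegrable mu phi.
  apply: (cintegrable_dominated (g := fun x => (A + B) * lorentzian x)) => //.
    exact: integrableZl_EFin.
  by move=> x; rewrite mulrDl /cnorm1 lerD.
split => //.
have := integrableZl_EFin (A0 + B0) (cintegrable_cnorm1 iphi) => /integrableP[_].
apply: le_lt_trans; apply: ge0_le_integral => //.
- by move=> x _; rewrite lee_fin cnormsq_ge0.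
- by apply/measurable_EFinP; exact: cmeasurable_cnormsq.
- apply: measurableT_comp => //; apply/measurable_EFinP.
  by apply: measurable_funM => //; exact: cmeasurable_cnorm1.
- move=> x _; rewrite /= lee_fin (le_trans _ (ler_norm _))// (le_trans (cnormsq_le _))//.
  by rewrite expr2 ler_wpM2r ?cnorm1_ge0// lerD.
Qed.

End schwartz_functions.

(** * Geometry of anisotropic dilations: [eta] and the projection to the sphere *)

Section anisotropic_geometry.
Context (R : realType) (d : nat) (a : 'rV[R]_d).
Hypothesis a_gt0 : forall j, 0 < a ord0 j.

(* [eta a xi] is [exp s] for the only [s] with [level xi s = 1]. *)
Definition level (xi : 'rV[R]_d) (s : R) : R :=
  \sum_j xi ord0 j ^+ 2 * expR (- (2 * a ord0 j) * s).

Lemma levelE (xi : 'rV[R]_d) (t : R) : 0 < t ->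
  \sum_j xi ord0 j ^+ 2 * t `^ (- (2 * a ord0 j)) = level xi (ln t).
Proof. by move=> t0; apply: eq_bigr => j _; rewrite /powR gt_eqF. Qed.

Lemma exponent_lower_bound : exists2 m : R, 0 < m & forall j, m <= a ord0 j.
Proof.
(* The reciprocal of a quantity exceeding every [1 / a_j]; the added 1 keeps it positive also when
   [d = 0]. *)
pose S := 1 + \sum_j (a ord0 j)^-1.
have S0 : 0 < S by rewrite ltr_pwDl// sumr_ge0// => j _; rewrite invr_ge0 ltW.
exists S^-1; first by rewrite invr_gt0.
move=> j; rewrite -[leRHS]invrK lef_pV2 ?posrE ?invr_gt0//.
rewrite /S (bigD1 j)//= addrCA lerDl addr_ge0// sumr_ge0// => i _.
by rewrite invr_ge0 ltW.
Qed.

(** Some positive lower bound for the exponents, fixed once; it need not be the least exponent. *)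
Definition exponent_min : R := xget 1 [set m | 0 < m /\ forall j, m <= a ord0 j].
Local Notation m := exponent_min.

Lemma exponent_minP : 0 < m /\ forall j, m <= a ord0 j.
Proof.
have [r r0 ra] := exponent_lower_bound.
have := @xgetPex _ 1 [set m | 0 < m /\ forall j, m <= a ord0 j].
by apply; exists r.
Qed.

Let m0 : 0 < m. Proof. by case: exponent_minP. Qed.
Let ma j : m <= a ord0 j. Proof. by case: exponent_minP. Qed.

Lemma level_ge0 xi s : 0 <= level xi s.
Proof. by apply: sumr_ge0 => j _; rewrite mulr_ge0 ?sqr_ge0 ?expR_ge0. Qed.

(** Every term decays in [s] at rate at least [2 m]. This quantitative monotonicity yields the
    uniqueness of [eta], an upper bracket for its existence, and its Lipschitz dependence on
    [xi]. *)
Lemma level_decreasing xi s s' : s <= s' ->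
  expR (2 * m * (s' - s)) * level xi s' <= level xi s.
Proof.
move=> ss'; rewrite /level mulr_sumr; apply: ler_sum => j _.
rewrite mulrCA ler_wpM2l ?sqr_ge0// -expRD ler_expR.
have : 0 <= (a ord0 j - m) * (s' - s) by rewrite mulr_ge0// subr_ge0.
nra.
Qed.

Lemma level0 xi : level xi 0 = enorm xi ^+ 2.
Proof.
by rewrite sqr_enormE; apply: eq_bigr => j _; rewrite mulr0 expR0 mulr1.
Qed.

Lemma continuous_level xi : continuous (level xi).
Proof.
move=> s; rewrite /level; apply: cvg_big => [|j _]; first exact: add_continuous.
apply: cvgM; first exact: cvg_cst.
apply: (@continuous_comp _ _ _ (fun s => - (2 * a ord0 j) * s) expR).
  exact: mulrl_continuous.
exact: continuous_expR.
Qed.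

Lemma level_eq1 (xi : 'rV[R]_d) : xi != 0 -> exists s, level xi s = 1.
Proof.
move=> xi0; have [j xj] : exists j, xi ord0 j != 0.
  apply/existsP; apply: contraNT xi0 => /existsPn h.
  by apply/eqP/rowP => j; rewrite mxE; have /negPn/eqP := h j.
have xj2 : 0 < xi ord0 j ^+ 2 by rewrite exprn_even_gt0.
(* At [s2] the term of index [j] alone is [y * exp (1 / y) >= y + 1] with [y = xi_j^2]. At [s1] the
   decay rate gives [exp (|xi|^2) * level xi s1 <= |xi|^2]. The intermediate value theorem then
   applies between them. *)
pose s2 := - ((xi ord0 j ^+ 2)^-1 / (2 * a ord0 j)).
pose s1 := enorm xi ^+ 2 / (2 * m).
have s2_le0 : s2 <= 0 by rewrite oppr_le0 divr_ge0 ?invr_ge0 ?ltW// mulr_gt0.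
have s1_ge0 : 0 <= s1 by rewrite divr_ge0 ?sqr_ge0// mulr_ge0// ltW.
have l1 : level xi s1 <= 1.
  have := level_decreasing xi s1_ge0; rewrite level0 subr0 => h.
  have e : 2 * m * s1 = enorm xi ^+ 2.
    by rewrite /s1 mulrC divfK// mulf_neq0// gt_eqF.
  rewrite e in h; have := expR_ge1Dx (enorm xi ^+ 2).
  have := level_ge0 xi s1; have := sqr_ge0 (enorm xi); nra.
have l2 : 1 <= level xi s2.
  rewrite /level (bigD1 j)//= (@le_trans _ _ (xi ord0 j ^+ 2 * expR (- (2 * a ord0 j) * s2)))//; last first.
    by rewrite lerDl sumr_ge0// => i _; rewrite mulr_ge0 ?sqr_ge0 ?expR_ge0.
  have -> : - (2 * a ord0 j) * s2 = (xi ord0 j ^+ 2)^-1.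
    by rewrite /s2 mulrNN mulrC divfK// mulf_neq0// gt_eqF.
  have := expR_ge1Dx (xi ord0 j ^+ 2)^-1.
  move=> /(ler_wpM2l (ltW xj2)); rewrite mulrDr mulr1 divff ?gt_eqF//; lra.
have [s _ ls] : exists2 s, s \in `[s2, s1]%R & level xi s = 1.
  apply: IVT; first exact: le_trans s2_le0 s1_ge0.
    by apply: continuous_subspaceT; exact: continuous_level.
  by rewrite ge_min l1 orbT le_max l2.
by exists s.
Qed.

Lemma level_inj xi s s' : level xi s = 1 -> level xi s' = 1 -> s = s'.
Proof.
wlog ss' : s s' / s <= s'.
  by move=> H l1 l2; have [/H|/ltW/H] := leP s s'; [exact|move=> h; apply/esym/h].
move=> l1 l2; have := level_decreasing xi ss'; rewrite l1 l2 mulr1.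
rewrite -[leRHS]expR0 ler_expR => h; apply/eqP; rewrite eq_le ss' /=.
have : 0 < 2 * m by rewrite mulr_gt0.
by move=> /pmulr_rle0 e; rewrite e subr_le0 in h.
Qed.

Lemma eta_spec (xi : 'rV[R]_d) : xi != 0 -> 0 < Defs.eta a xi /\ level xi (ln (Defs.eta a xi)) = 1.
Proof.
move=> /level_eq1[s ls].
pose P := [set t : R | 0 < t /\ \sum_j xi ord0 j ^+ 2 * t `^ (- (2 * a ord0 j)) = 1].
have [t0 <-] : P (Defs.eta a xi).
  apply: (@xgetPex _ 1 P); exists (expR s); split; first exact: expR_gt0.
  by rewrite levelE ?expR_gt0// expRK.
by split => //; rewrite levelE.
Qed.

Lemma eta_unique (xi : 'rV[R]_d) t : 0 < t -> level xi (ln t) = 1 -> Defs.eta a xi = t.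
Proof.
move=> t0 lt; have xi0 : xi != 0.
  apply/eqP => x0; move: lt; rewrite x0 /level big1 => [/esym/eqP|j _].
    by rewrite oner_eq0.
  by rewrite mxE expr0n mul0r.
have [e0 le] := eta_spec xi0.
by rewrite -(lnK e0) -(lnK t0); congr expR; exact: level_inj le lt.
Qed.

Definition spherical (xi : 'rV[R]_d) := dil a (Defs.eta a xi) xi.

Lemma sphericalE xi j : xi != 0 ->
  spherical xi ord0 j = expR (- a ord0 j * ln (Defs.eta a xi)) * xi ord0 j.
Proof. by move=> /eta_spec[e0 _]; rewrite mxE /powR gt_eqF. Qed.

Lemma spherical_unit xi : xi != 0 -> unit_sphere (spherical xi).
Proof.
move=> xi0; have [e0 le] := eta_spec xi0.
have : enorm (spherical xi) ^+ 2 = 1 ^+ 2.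
  rewrite sqr_enormE expr1n -le; apply: eq_bigr => j _.
  rewrite sphericalE// exprMn mulrC; congr (_ * _).
  by rewrite expr2 -expRD; congr expR; ring.
by move=> /eqP; rewrite eqrXn2 ?enorm_ge0// => /eqP.
Qed.

Lemma dil_neq0 t (xi : 'rV[R]_d) : 0 < t -> xi != 0 -> dil a t xi != 0.
Proof.
move=> t0; apply: contra_neq => /rowP h; apply/rowP => j.
have := h j; rewrite !mxE => /eqP; rewrite mulf_eq0 => /orP[|/eqP//].
by rewrite gt_eqF// powR_gt0.
Qed.

Lemma level_dil t xi s : 0 < t -> level (dil a t xi) s = level xi (s + ln t).
Proof.
move=> t0; apply: eq_bigr => j _; rewrite mxE /powR gt_eqF// exprMn.
rewrite mulrAC mulrC; congr (_ * _).
by rewrite expr2 -!expRD; congr expR; ring.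
Qed.

Lemma eta_dil t (xi : 'rV[R]_d) : 0 < t -> xi != 0 -> Defs.eta a (dil a t xi) = Defs.eta a xi / t.
Proof.
move=> t0 xi0; have [e0 le] := eta_spec xi0.
apply: eta_unique; first by rewrite divr_gt0.
by rewrite level_dil// ln_div ?posrE// subrK.
Qed.

Lemma spherical_dil t (xi : 'rV[R]_d) : 0 < t -> xi != 0 -> spherical (dil a t xi) = spherical xi.
Proof.
move=> t0 xi0; have [e0 le] := eta_spec xi0; apply/rowP => j.
rewrite sphericalE ?dil_neq0// sphericalE// eta_dil// mxE /powR gt_eqF//.
rewrite ln_div ?posrE// mulrA -expRD; congr (expR _ * _); ring.
Qed.

Lemma eta_sphere (zeta : 'rV[R]_d) : unit_sphere zeta -> Defs.eta a zeta = 1.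
Proof.
by move=> z1; apply: eta_unique => //; rewrite ln1 level0 z1 expr1n.
Qed.

Lemma spherical_id zeta : unit_sphere zeta -> spherical zeta = zeta.
Proof.
move=> z1; rewrite /spherical eta_sphere//; apply/rowP => j.
by rewrite mxE powR1 mul1r.
Qed.

(** With [enorm_le_eta2] this places the dyadic shell [1 <= eta <= 2] inside a Euclidean shell on
    which the cutoff is 1. The origin is excluded because [eta] takes the default value 1 there. *)
Lemma enorm_ge1 (xi : 'rV[R]_d) : 1 <= Defs.eta a xi -> xi != 0 -> 1 <= enorm xi.
Proof.
move=> e1 xi0; have [e0 le] := eta_spec xi0.
have l0 : 0 <= ln (Defs.eta a xi) by rewrite ln_ge0.
rewrite -(@ler_pXn2r _ 2) ?nnegrE ?enorm_ge0// expr1n -level0 -le.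
apply: le_trans (level_decreasing xi l0).
by rewrite ler_peMl ?level_ge0// -[leLHS]expR0 ler_expR subr0 mulr_ge0// mulr_ge0// ltW.
Qed.

Let M := \sum_j a ord0 j.

Let aM j : a ord0 j <= M.
Proof. by rewrite /M (bigD1 j)//= lerDl sumr_ge0// => i _; exact: ltW. Qed.

Lemma enorm_le_eta2 (xi : 'rV[R]_d) : Defs.eta a xi <= 2 -> xi != 0 -> enorm xi <= expR (M * ln 2).
Proof.
move=> e2 xi0; have [e0 le] := eta_spec xi0.
rewrite -(@ler_pXn2r _ 2) ?nnegrE ?enorm_ge0 ?expR_ge0//.
have l2 : ln (Defs.eta a xi) <= ln 2 by rewrite ler_ln ?posrE.
have ln20 : 0 <= ln (2 : R) by rewrite ln_ge0// ler1n.
have -> : expR (M * ln 2) ^+ 2 = expR (M * ln 2) ^+ 2 * level xi (ln (Defs.eta a xi)).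
  by rewrite le mulr1.
rewrite sqr_enormE /level mulr_sumr; apply: ler_sum => j _.
rewrite mulrCA ler_peMr ?sqr_ge0// expr2 -!expRD -[leLHS]expR0 ler_expR.
have h1 : a ord0 j * ln (Defs.eta a xi) <= a ord0 j * ln 2 by rewrite ler_wpM2l// ltW.
have h2 : a ord0 j * ln 2 <= M * ln 2 by rewrite ler_wpM2r.
lra.
Qed.

Let K := expR (M / m * ln 2).

Let K0 : 0 < K. Proof. exact: expR_gt0. Qed.

(** [K] is [2^(M/m)]. For [eta >= 1] the exponential is at most 1. Otherwise [level_decreasing]
    gives [eta^(-2m) |xi|^2 <= 1], so [|xi| >= 1/2] forces [eta^(-m) <= 2]; raising this to the
    power [a_j / m <= M / m] gives the bound. *)
Let exp_bound (xi : 'rV[R]_d) j : 2^-1 <= enorm xi -> expR (- a ord0 j * ln (Defs.eta a xi)) <= K.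
Proof.
move=> xih; have xi0 : xi != 0.
  by apply: contraTneq xih => ->; rewrite enorm0 -ltNge invr_gt0.
have [e0 le] := eta_spec xi0; set s := ln _ in le *.
have ln20 : 0 <= ln (2 : R) by rewrite ln_ge0// ler1n.
have M0 : 0 <= M / m.
  by rewrite divr_ge0 ?(ltW m0)// sumr_ge0// => i _; exact: ltW.
rewrite ler_expR; have [s0|s0] := leP 0 s.
  have p : - a ord0 j * s <= 0 by rewrite mulNr oppr_le0 mulr_ge0// ltW.
  exact: le_trans p (mulr_ge0 M0 ln20).
have := level_decreasing xi (ltW s0); rewrite le level0 sub0r => h.
have hm : m * - s <= ln 2.
  have : expR (2 * m * - s) <= expR (2 * ln 2).
    have -> : expR (2 * ln 2) = 4 :> R.
      by rewrite mulr2n mulrDl mul1r expRD lnK ?posrE//; ring.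
    have : expR (2 * m * - s) * enorm xi ^+ 2 <= 1 by [].
    have q : 2^-1 ^+ 2 <= enorm xi ^+ 2 by rewrite lerXn2r ?nnegrE ?enorm_ge0 ?invr_ge0.
    have := ler_wpM2l (expR_ge0 (2 * m * - s)) q; lra.
  rewrite ler_expR; lra.
have : a ord0 j / m * (m * - s) <= M / m * ln 2.
  apply: ler_pM => //.
  - by rewrite divr_ge0// ltW.
  - by rewrite mulr_ge0 ?oppr_ge0 ?ltW.
  - by rewrite ler_wpM2r// invr_ge0 ltW.
by rewrite mulrA divfK ?gt_eqF// mulrN mulNr.
Qed.

Let expR_dist (x y k : R) : expR x <= k -> expR y <= k ->
  `|expR x - expR y| <= k * `|x - y|.
Proof.
wlog xy : x y / x <= y.
  move=> H; have [xy|yx] := leP x y; first exact: H.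
  by move=> hx hy; rewrite distrC (distrC x); apply: H => //; exact: ltW.
move=> hx hy; rewrite distrC (distrC x) !ger0_norm ?subr_ge0 ?ler_expR//.
have e : expR x = expR y * expR (x - y) by rewrite -expRD; congr expR; ring.
have := expR_ge1Dx (x - y); have := expR_gt0 y; have := expR_gt0 (x - y).
rewrite e => h1 h2 h3.
have : expR y * (y - x) <= k * (y - x) by rewrite ler_wpM2r// subr_ge0.
nra.
Qed.

(** A quantitative implicit function argument. Let [s <= s'] be the two logarithms. Changing [xi] to
    [xi'] moves [level _ s] from 1 by at most [c |xi - xi'|], while [level xi' s' = 1] and the decay
    rate bound [level xi' s] below by [exp (2 m (s' - s)) >= 1 + 2 m (s' - s)]. *)
Lemma ln_eta_lipschitz (r : R) : exists2 L : R, 0 <= L & forall xi xi' : 'rV[R]_d,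
  2^-1 <= enorm xi <= r -> 2^-1 <= enorm xi' <= r ->
  `|ln (Defs.eta a xi) - ln (Defs.eta a xi')| <= L * enorm (xi - xi').
Proof.
pose c := 2 * `|r| * K ^+ 2 * d%:R.
have c0 : 0 <= c.
  by apply: mulr_ge0 => //; apply: mulr_ge0; [exact: mulr_ge0|exact: sqr_ge0].
exists (c / (2 * m)); first by rewrite divr_ge0// mulr_ge0// ltW.
move=> xi xi'; wlog ss' : xi xi' / ln (Defs.eta a xi) <= ln (Defs.eta a xi').
  move=> H h h'; have [ss'|ss'] := leP (ln (Defs.eta a xi)) (ln (Defs.eta a xi')); first exact: H.
  by rewrite distrC enormB; apply: H => //; exact: ltW.
move=> /andP[h1 h2] /andP[h1' h2'].
have nz (x : 'rV[R]_d) : 2^-1 <= enorm x -> x != 0.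
  by move=> xh; apply: contraTneq xh => ->; rewrite enorm0 -ltNge invr_gt0.
have [e0 le] := eta_spec (nz _ h1); have [e0' le'] := eta_spec (nz _ h1').
have := level_decreasing xi' ss'; rewrite le' mulr1 => h.
have hl : level xi' (ln (Defs.eta a xi)) <= 1 + c * enorm (xi - xi').
  rewrite -lerBlDl -{1}le /level -sumrB.
  apply: (@le_trans _ _ (\sum_(j < d) 2 * `|r| * K ^+ 2 * enorm (xi - xi'))).
    apply: ler_sum => j _; rewrite -mulrBl.
    have k1 : expR (- (2 * a ord0 j) * ln (Defs.eta a xi)) <= K ^+ 2.
      have -> : - (2 * a ord0 j) * ln (Defs.eta a xi) = - a ord0 j * ln (Defs.eta a xi) + - a ord0 j * ln (Defs.eta a xi) by ring.
      by rewrite expRD expr2 ler_pM ?expR_ge0// exp_bound.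
    have k2 : xi' ord0 j ^+ 2 - xi ord0 j ^+ 2 <= 2 * `|r| * enorm (xi - xi').
      have := coord_le_enorm (xi - xi') j; rewrite !mxE => q1.
      have q2 := le_trans (coord_le_enorm xi j) (le_trans h2 (ler_norm r)).
      have q3 := le_trans (coord_le_enorm xi' j) (le_trans h2' (ler_norm r)).
      have -> : xi' ord0 j ^+ 2 - xi ord0 j ^+ 2 = - (xi ord0 j - xi' ord0 j) * (xi' ord0 j + xi ord0 j) by ring.
      rewrite (le_trans (ler_norm _))// normrM normrN mulrC ler_pM//.
      by rewrite (le_trans (ler_normD _ _))//; lra.
    rewrite [leRHS](_ : _ = 2 * `|r| * enorm (xi - xi') * K ^+ 2); last by ring.
    apply: (@le_trans _ _ (2 * `|r| * enorm (xi - xi') * expR (- (2 * a ord0 j) * ln (Defs.eta a xi)))).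
      by rewrite ler_wpM2r ?expR_ge0.
    by rewrite ler_wpM2l// !mulr_ge0 ?enorm_ge0.
  by rewrite sumr_const card_ord -mulr_natr /c; rewrite le_eqVlt; apply/orP; left; apply/eqP; ring.
have := expR_ge1Dx (2 * m * (ln (Defs.eta a xi') - ln (Defs.eta a xi))).
move=> h3; rewrite distrC ger0_norm ?subr_ge0// [leRHS]mulrAC ler_pdivlMr ?mulr_gt0//.
have := le_trans h3 (le_trans h hl); lra.
Qed.

(** Each coordinate is the product of [xi_j] and [exp (- a_j ln eta)], both bounded and Lipschitz on
    the shell. The inner radius 1/2 is that of the support of the cutoff. *)
Lemma spherical_lipschitz (r : R) : exists2 L : R, 0 <= L & forall xi xi' : 'rV[R]_d,
  2^-1 <= enorm xi <= r -> 2^-1 <= enorm xi' <= r ->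
  enorm (spherical xi - spherical xi') <= L * enorm (xi - xi').
Proof.
have [L1 L10 HL] := ln_eta_lipschitz r.
pose c := K * (M * L1) * `|r| + K.
have M0 : 0 <= M by rewrite sumr_ge0// => i _; exact: ltW.
have c0 : 0 <= c by rewrite addr_ge0 ?mulr_ge0 ?(ltW K0).
exists (d%:R * c); first by rewrite mulr_ge0.
move=> xi xi' h h'; have := HL _ _ h h'; move: h h' => /andP[h1 h2] /andP[h1' h2'] hs.
have nz (x : 'rV[R]_d) : 2^-1 <= enorm x -> x != 0.
  by move=> xh; apply: contraTneq xh => ->; rewrite enorm0 -ltNge invr_gt0.
apply: le_trans (enorm_le_sum _) _.
have sumd (x : R) : d%:R * x = \sum_(j < d) x by rewrite sumr_const card_ord mulr_natl.
rewrite -mulrA sumd.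
have subE (x y : 'rV[R]_d) j : (x - y) ord0 j = x ord0 j - y ord0 j by rewrite !mxE.
apply: ler_sum => j _; rewrite subE !sphericalE ?nz//.
set u := expR _; set v := expR _.
have -> : u * xi ord0 j - v * xi' ord0 j = (u - v) * xi ord0 j + v * (xi ord0 j - xi' ord0 j) by ring.
have b1 : `|u - v| <= K * (M * L1 * enorm (xi - xi')).
  apply: le_trans (expR_dist (exp_bound _ h1) (exp_bound _ h1')) _.
  rewrite ler_wpM2l ?(ltW K0)// -mulrBr normrM normrN (gtr0_norm (a_gt0 j)).
  by rewrite -mulrA ler_pM// ltW.
have b2 := le_trans (coord_le_enorm xi j) (le_trans h2 (ler_norm r)).
have := coord_le_enorm (xi - xi') j; rewrite !mxE => b3.
rewrite (le_trans (ler_normD _ _))// !normrM /c mulrDl lerD//.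
  by rewrite [leRHS](_ : _ = K * (M * L1 * enorm (xi - xi')) * `|r|); [exact: ler_pM|ring].
by apply: ler_pM => //; rewrite ger0_norm ?expR_ge0//; exact: exp_bound.
Qed.

End anisotropic_geometry.

(** * Fourier decay of compactly supported Hoelder functions of mean zero *)

Section balls.
Context (R : realType) (d : nat).
Local Notation mu := (lebesgue_rv R d).

Definition eball (r : R) : set 'rV[R]_d := [set x | enorm x <= r].

Lemma measurable_eball r : measurable (eball r).
Proof.
rewrite -[X in measurable X]setTI (_ : eball r = @enorm R d @^-1` `]-oo, r]%classic).
  exact: measurable_enorm.
by apply/seteqP; split => x /=; rewrite in_itv.
Qed.

Lemma integrable_eball r : mu.-integrable setT (EFin \o (\1_(eball r) : 'rV[R]_d -> R)).
Proof.
suff mub : (mu (eball r) < +oo)%E.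
  apply/integrableP; split.
    by apply/measurable_EFinP; exact: measurable_indic (measurable_eball r).
  under eq_integral do rewrite /= ger0_norm//.
  by rewrite integral_indic ?setIT//; exact: measurable_eball.
pose A := [set x : 'rV[R]_d | forall i : 'I_d, `[- r, r]%classic (x ord0 i)].
have mA : measurable A.
  rewrite (_ : A = \bigcap_(i in [set: 'I_d])
      ((fun x : 'rV[R]_d => x ord0 i) @^-1` `[- r, r]%classic)).
    apply: fin_bigcap_measurable => [|i _]; first exact: finite_finset.
    by rewrite -[X in measurable X]setTI; apply: measurable_coord.
  by apply/seteqP; split => x Bx i => [_|]; exact: Bx.
apply: (@le_lt_trans _ _ (mu A)).
  apply: le_measure; rewrite ?inE//; first exact: measurable_eball.
  move=> x xr i /=; rewrite in_itv/= -ler_norml.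
  exact: le_trans (coord_le_enorm x i) xr.
rewrite /A (@lebesgue_rv_box R d (fun=> `[- r, r]%classic))//.
suff H : (0 <= \prod_(i < d) lebesgue_measure (`[(- r)%R, r]%classic : set R) < +oo)%E by case/andP: H.
elim/big_ind : _ => [|x y /andP[x0 x1] /andP[y0 y1]|j _].
- by rewrite lee01 ltry.
- by rewrite mule_ge0// lte_mul_pinfty// ge0_fin_numE.
- by rewrite measure_ge0/= lebesgue_measure_itv/=; case: ifP => _; rewrite -?EFinD ltry.
Qed.

Lemma cnorm1_cint_eball (f : 'rV[R]_d -> R[i]) (r B : R) : cmeasurable f ->
  (forall x, r < enorm x -> f x = 0) -> (forall x, enorm x <= r -> cnorm1 (f x) <= B) ->
  cintegrable mu f /\
  cnorm1 (cint mu f) <= B * \int[mu]_x (\1_(eball r) : 'rV[R]_d -> R) x.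
Proof.
move=> mf f0 fB.
have dom x : cnorm1 (f x) <= B * (\1_(eball r) : 'rV[R]_d -> R) x.
  rewrite indicE; have [xr|xr] := leP (enorm x) r.
    by rewrite mem_set// mulr1 fB.
  by rewrite f0// cnorm1_0 memNset ?mulr0//= /eball /=; apply/negP; rewrite -ltNge.
split.
  apply: (cintegrable_dominated mf _ dom).
  by apply: integrableZl_EFin; exact: integrable_eball.
rewrite -RintegralZl//; last exact: integrable_eball.
apply: cnorm1_cint_le => //.
by apply: integrableZl_EFin; exact: integrable_eball.
Qed.

End balls.

Lemma powR_unit_ge (R : realType) (t b : R) : 0 <= t <= 1 -> b <= 1 -> t <= t `^ b.
Proof.
move=> /andP[t0 t1] b1; have [->|tn0] := eqVneq t 0; first exact: powR_ge0.
have tp : 0 < t by rewrite lt_neqAle eq_sym tn0.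
by rewrite /powR (negbTE tn0) -[leLHS](lnK tp) ler_expR ler_niMl// ln_le0.
Qed.

Section fourier_decay.
Context (R : realType) (d : nat).
Local Notation mu := (lebesgue_rv R d).

Lemma cexpi_npi : cexpi (- pi) = -1 :> R[i].
Proof. by apply/eqP; rewrite eq_complex /= cosN sinN cospi sinpi oppr0 !eqxx. Qed.

(* Mean zero gives the bound for small [z]; for large [z] a shift by
   [z / (2 |z|^2)] flips the sign of the character, so that only differences of
   [F] remain. *)
Lemma fourier_decay (F : 'rV[R]_d -> R[i]) (r H B b : R) :
  0 < b <= 1 -> 0 <= r -> 0 <= H -> 0 <= B -> cmeasurable F ->
  (forall x, r < enorm x -> F x = 0) ->
  (forall x, cnorm1 (F x) <= B) ->
  (forall x y, enorm (x - y) <= 1 -> cnorm1 (F x - F y) <= H * enorm (x - y) `^ b) ->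
  cint mu F = 0 ->
  exists2 C : R, 0 <= C & forall z, cnorm1 (fourier F z) <=
    C * (enorm z `^ b / (1 + enorm z `^ b) ^+ 2).
Proof.
move=> /andP[b0 b1] r0 H0 B0 mF F0 FB FH Fmean.
pose V s := \int[mu]_x (\1_(eball s) : 'rV[R]_d -> R) x.
have V0 s : 0 <= V s by apply: Rintegral_ge0 => x _.
have mw z : cmeasurable (fun xi : 'rV[R]_d => wave xi z) by exact: cmeasurable_wave.
have [iF _] : cintegrable mu F /\ cnorm1 (cint mu F) <= B * V r.
  by apply: cnorm1_cint_eball => // x _.
have low z : cnorm1 (fourier F z) <= (B * (4 * pi * r) * V r) * enorm z.
  have -> : fourier F z = cint mu (fun xi => F xi * (wave xi z - 1)).
    transitivity (cint mu (fun xi => F xi * wave xi z + (-1) * F xi)).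
      rewrite cintD; [|exact: cintegrable_wave|exact: cintegrableZ].
      by rewrite cintZ// Fmean mulr0 addr0.
    by apply: eq_cint => xi; ring.
  have [] := @cnorm1_cint_eball R d (fun xi => F xi * (wave xi z - 1)) r (B * (4 * pi * r) * enorm z).
  - by apply: cmeasurableM => //; apply: cmeasurableB => //; exact: cmeasurable_cst.
  - by move=> x /F0 ->; rewrite mul0r.
  - move=> x xr; rewrite (le_trans (cnorm1M _ _))// -mulrA ler_pM ?cnorm1_ge0//.
    rewrite (le_trans (cexpi_sub1_le _))// normrN normrM (@ger0_norm _ (2 * pi)) ?mulr_ge0 ?pi_ge0//.
    have := cauchy_schwarz x z; have := enorm_ge0 z => z0 cs.
    have : `|dotp x z| <= r * enorm z by rewrite (le_trans cs)// ler_wpM2r.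
    move=> /(ler_wpM2l (mulr_ge0 (ler0n R 4) (pi_ge0 R))); lra.
  move=> _; rewrite -/(V r) => h; apply: le_trans h _.
  by rewrite le_eqVlt; apply/orP; left; apply/eqP; ring.
have high z : 1 <= enorm z -> cnorm1 (fourier F z) <= (H * V (r + 1)) / enorm z `^ b.
  move=> z1; have z0 : 0 < enorm z by lra.
  pose h : 'rV[R]_d := (2 * enorm z ^+ 2)^-1 *: z.
  have hn : enorm h = (2 * enorm z)^-1.
    rewrite /h enormZ ger0_norm; first by field; rewrite gt_eqF.
    by rewrite invr_ge0; apply: mulr_ge0 => //; exact: sqr_ge0.
  have h1 : enorm h <= 1.
    by rewrite hn invf_le1 ?mulr_gt0//; lra.
  have wh xi : wave (xi + h) z = - wave xi z.
    rewrite waveD {2}/wave /h dotpZl -sqr_enorm.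
    rewrite (_ : 2 * pi * _ = pi); last by field; rewrite gt_eqF.
    by rewrite cexpi_npi mulrN1.
  have e2 : fourier F z + fourier F z = cint mu (fun xi => (F xi - F (xi + h)) * wave xi z).
    transitivity (cint mu (fun xi => F xi * wave xi z) +
        cint mu (fun xi => F (xi + h) * wave (xi + h) z)).
      by rewrite (cint_translation h (cintegrable_wave z iF)) !fourierE.
    rewrite -cintD.
    - by apply: eq_cint => xi; rewrite wh; ring.
    - exact: cintegrable_wave.
    - exact: cintegrable_translation h _ (cintegrable_wave z iF).
  (* Since [|h| <= 1], the difference is supported in the ball of radius [r + 1]. *)
  have [] := @cnorm1_cint_eball R d (fun xi => (F xi - F (xi + h)) * wave xi z) (r + 1)
     (2 * (H * (enorm z `^ b)^-1)).
  - apply: cmeasurableM => //; apply: cmeasurableB => //.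
    apply: (cmeasurable_comp mF); apply: measurable_fun_coord => i.
    under eq_fun do rewrite mxE; apply: measurable_funD => //.
    exact: measurable_coord.
  - move=> x xr; rewrite !F0 ?subrr ?mul0r//; last lra.
    have := enormD (x + h) (- h); rewrite addrK enormN; lra.
  - move=> x _; rewrite (le_trans (cnorm1M _ _))// mulrC ler_pM ?cnorm1_ge0 ?cnorm1_wave//.
    have -> : F x - F (x + h) = - (F (x + h) - F x) by rewrite opprB.
    have hx : x + h - x = h by rewrite addrAC subrr add0r.
    rewrite cnorm1N; apply: le_trans (FH _ _ _) _; rewrite hx// ler_wpM2l// hn.
    have -> : (enorm z `^ b)^-1 = (enorm z)^-1 `^ b.
      by rewrite -powRN -mulN1r powRrM powR_inv1 ?(ltW z0).
    rewrite ge0_ler_powR ?nnegrE ?invr_ge0 ?mulr_ge0 ?(ltW z0) ?(ltW b0)//.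
    by rewrite lef_pV2 ?posrE ?mulr_gt0//; lra.
  move=> _; rewrite -e2 -/(V (r + 1)).
  have -> : cnorm1 (fourier F z + fourier F z) = 2 * cnorm1 (fourier F z).
    case: (fourier F z) => u v; rewrite /cnorm1 /= -!mulr2n !normrMn.
    by rewrite -mulrnDl mulr_natl.
  by rewrite -(mulrA 2) ler_pM2l// mulrAC.
pose C1 := B * (4 * pi * r) * V r; pose C2 := H * V (r + 1).
have C10 : 0 <= C1 by rewrite !mulr_ge0 ?pi_ge0.
have C20 : 0 <= C2 by rewrite mulr_ge0.
(* The 4 merges the two regimes: [(1 + x)^2 <= 4] when [x <= 1], and [(1 + x)^2 <= 4 x^2] when
   [x >= 1]. *)
exists (4 * (C1 + C2)); first by rewrite mulr_ge0// addr_ge0.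
move=> z; set x := enorm z `^ b.
have x0 : 0 <= x by exact: powR_ge0.
have d0 : 0 < (1 + x) ^+ 2 by rewrite exprn_gt0//; lra.
rewrite mulrA ler_pdivlMr//.
have [z1|z1] := leP (enorm z) 1.
  have zx : enorm z <= x.
    by apply: powR_unit_ge => //; rewrite enorm_ge0.
  have x1 : x <= 1.
    have p1 : (1 : R) `^ b = 1 by rewrite powR1.
    by rewrite /x -[leRHS]p1 ge0_ler_powR ?nnegrE ?enorm_ge0// ltW.
  have h1 : cnorm1 (fourier F z) <= C1 * x.
    by rewrite (le_trans (low z))// ler_wpM2l.
  have h2 : (1 + x) ^+ 2 <= 4 by nra.
  rewrite (le_trans (ler_pM (cnorm1_ge0 _) (ltW d0) h1 h2))//.
  have := mulr_ge0 C20 x0; lra.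
have x1 : 1 <= x.
  have p1 : (1 : R) `^ b = 1 by rewrite powR1.
  by rewrite /x -[leLHS]p1 ge0_ler_powR ?nnegrE ?enorm_ge0// ltW.
have h1 : cnorm1 (fourier F z) <= C2 / x by exact: high (ltW z1).
have h2 : (1 + x) ^+ 2 <= 4 * x ^+ 2 by nra.
rewrite (le_trans (ler_pM (cnorm1_ge0 _) (ltW d0) h1 h2))//.
have -> : C2 / x * (4 * x ^+ 2) = 4 * C2 * x by field; rewrite gt_eqF//; lra.
have := mulr_ge0 C10 x0; lra.
Qed.

End fourier_decay.

(* Since [x i.+1 >= Q x i], the increments of [t / (1 + t)] along [x] dominate the
   summands. *)
Lemma telescoping_bound (R : realType) (Q : R) (x : nat -> R) (n : nat) : 1 < Q ->
  (forall i, 0 <= x i) -> (forall i, Q * x i <= x i.+1) ->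
  \sum_(i < n) x i / (1 + x i) ^+ 2 <= Q / (Q - 1).
Proof.
move=> Q1 x0 xQ.
have Qp : 0 < Q - 1 by lra.
pose Phi (t : R) := t / (1 + t).
(* [Phi] is increasing, so it suffices to treat [x i.+1 = Q * x i]. There the increment is
   [(Q - 1) u / ((1 + Q u)(1 + u))], and [1 + Q u <= Q (1 + u)]. *)
have step i : x i / (1 + x i) ^+ 2 <= Q / (Q - 1) * (Phi (x i.+1) - Phi (x i)).
  have a0 := x0 i; have b0 := x0 i.+1; have ab := xQ i.
  set u := x i in a0 ab *; set v := x i.+1 in b0 ab *.
  have u1 : 0 < 1 + u by lra.
  have v1 : 0 < 1 + v by lra.
  have Qu1 : 0 < 1 + Q * u by nra.
  have mono : Phi (Q * u) <= Phi v.
    rewrite /Phi ler_pdivrMr// mulrAC ler_pdivlMr//; nra.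
  apply: (@le_trans _ _ (Q / (Q - 1) * (Phi (Q * u) - Phi u))); last first.
    by rewrite ler_wpM2l ?lerB// divr_ge0 ?(ltW Qp)//; lra.
  have -> : Q / (Q - 1) * (Phi (Q * u) - Phi u) = (Q * u) / ((1 + Q * u) * (1 + u)).
    by rewrite /Phi; field; rewrite !gt_eqF.
  rewrite ler_pdivrMr ?exprn_gt0// mulrAC ler_pdivlMr ?mulr_gt0//.
  have : 0 <= u * (1 + u) * (Q - 1) by apply: mulr_ge0; [apply: mulr_ge0; lra|lra].
  nra.
apply: (@le_trans _ _ (Q / (Q - 1) * (Phi (x n) - Phi (x 0%N)))).
  elim: n => [|n ih]; first by rewrite big_ord0 subrr mulr0.
  rewrite big_ord_recr /=; have := step n; have := ih; lra.
rewrite ler_piMr ?divr_ge0 ?(ltW Qp)//; first lra.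
have p0 : 0 <= Phi (x 0%N) by rewrite divr_ge0// addr_ge0.
have p1 : Phi (x n) <= 1 by rewrite ler_pdivrMr ?mul1r ?lerDr// ltr_pwDl.
lra.
Qed.

(** * Dyadic dilations and sums over scales *)

Section multiscale.
Context (R : realType) (d : nat) (a : 'rV[R]_d).
Hypothesis a_gt0 : forall j, 0 < a ord0 j.

Definition scale (t : R) : 'rV[R]_d := \row_j t `^ (- a ord0 j).

Lemma scale_gt0 t j : 0 < t -> 0 < scale t ord0 j.
Proof. by move=> t0; rewrite mxE powR_gt0. Qed.

Lemma dil_affine t xi : dil a t xi = affine (scale t) 0 xi.
Proof. by apply/rowP => j; rewrite !mxE addr0. Qed.

Lemma scale_prod t : 0 < t -> \prod_j scale t ord0 j = t `^ (- \sum_j a ord0 j).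
Proof.
move=> t0; under eq_bigr do rewrite mxE.
rewrite /powR; under eq_bigr do rewrite gt_eqF//.
by rewrite gt_eqF// -expR_sum -mulr_suml sumrN.
Qed.

(* The shift by [N] lets sums over [i < n] range over both small and large
   scales. *)
Definition dyadic (N i : nat) : R := 2 `^ (i%:R - N%:R).

Lemma dyadic_gt0 N i : 0 < dyadic N i.
Proof. exact: powR_gt0. Qed.

Lemma dyadicS N i : dyadic N i.+1 = 2 * dyadic N i.
Proof.
rewrite /dyadic (_ : i.+1%:R - N%:R = 1 + (i%:R - N%:R)); last by rewrite -natr1; ring.
by rewrite powRD ?pnatr_eq0 ?implybT// powRr1.
Qed.

Lemma enorm_expanding (m : R) (u v : 'rV[R]_d) : (forall j, m <= a ord0 j) ->
  (forall j, v ord0 j = 2 `^ a ord0 j * u ord0 j) -> 2 `^ m * enorm u <= enorm v.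
Proof.
move=> ma uv; have m2 : 0 <= 2 `^ m by exact: powR_ge0.
suff : (2 `^ m * enorm u) ^+ 2 <= enorm v ^+ 2.
  by rewrite ler_pXn2r// nnegrE ?enorm_ge0// mulr_ge0// enorm_ge0.
rewrite exprMn !sqr_enormE mulr_sumr; apply: ler_sum => j _.
rewrite uv exprMn ler_wpM2r ?sqr_ge0// lerXn2r ?nnegrE ?powR_ge0//.
by rewrite ler_powR// ler1n.
Qed.

(** The inverse dilation, which is how dilations act on the dual variable: by [fourier_dilation] the
    dilate of [F], normalized by its Jacobian, has transform [fourier F (undil t z)] at [z]. *)
Definition undil t (z : 'rV[R]_d) : 'rV[R]_d := \row_j (z ord0 j / scale t ord0 j).

Lemma undilE t z j : undil t z ord0 j = z ord0 j / t `^ (- a ord0 j).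
Proof. by rewrite /undil mxE mxE. Qed.

Lemma undil_double t z j : 0 < t ->
  undil (2 * t) z ord0 j = 2 `^ a ord0 j * undil t z ord0 j.
Proof.
move=> t0; rewrite undilE [in RHS]undilE powRM ?(ltW t0)// invfM powRN invrK.
exact: mulrCA.
Qed.

(** One dyadic step multiplies [|undil t z|] by at least [2^m], hence its power [b] by
    [Q = 2^(m b) > 1]. The telescoping bound depends on [Q] alone, so it is uniform in [N], [n] and
    [z]. *)
Lemma multiscale_bound (b : R) : 0 < b -> exists2 C : R, 0 <= C & forall N n z,
  \sum_(i < n) (enorm (undil (dyadic N i) z) `^ b /
    (1 + enorm (undil (dyadic N i) z) `^ b) ^+ 2) <= C.
Proof.
move=> b0; have [m0 ma] := exponent_minP a_gt0.
move: (exponent_min a) m0 ma => m m0 ma.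
pose Q : R := 2 `^ (m * b).
have Q1 : 1 < Q.
  by rewrite /Q /powR gt_eqF// -[ltLHS]expR0 ltr_expR mulr_gt0 ?mulr_gt0// ln_gt0// ltr1n.
exists (Q / (Q - 1)); first by rewrite divr_ge0//; lra.
move=> N n z.
apply: (telescoping_bound (x := fun i => enorm (undil (dyadic N i) z) `^ b)) => // i.
  exact: powR_ge0.
have := enorm_expanding ma (fun j => undil_double z j (dyadic_gt0 N i)).
rewrite -dyadicS => uv.
rewrite /Q powRrM -powRM ?powR_ge0 ?enorm_ge0//.
by rewrite ge0_ler_powR ?nnegrE ?mulr_ge0 ?powR_ge0 ?enorm_ge0// ltW.
Qed.

End multiscale.

(** * Projection off a subspace *)

Section complement_projection.
Context (R : realType) (l : nat).
Implicit Types (L : {vspace 'rV[R[i]]_l}) (v : 'rV[R[i]]_l).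

Definition basis_mx L : 'M[R[i]]_(\dim L, l) := \matrix_(i < \dim L) (vbasis L)`_i.

Lemma sub_basis_mx L v : (v <= basis_mx L)%MS = (v \in L).
Proof.
apply/idP/idP => [/submxP[D ->]|vL].
  rewrite mulmx_sum_row; apply: memv_suml => i _; apply: memvZ.
  by rewrite rowK; apply: vbasis_mem; rewrite mem_nth// size_tuple.
apply/submxP; exists (\row_i coord (vbasis L) i v).
rewrite mulmx_sum_row {1}(coord_vbasis vL); apply: eq_bigr => i _.
by rewrite mxE rowK.
Qed.

Definition coproj L : 'M[R[i]]_l := 1%:M - ortho_proj L.

Lemma mul_coproj L v : v *m coproj L = v - v *m ortho_proj L.
Proof. by rewrite mulmxBr mulmx1. Qed.

Lemma coproj_eq0 L v : (v *m coproj L == 0) = (v \in L).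
Proof.
rewrite -sub_basis_mx mul_coproj subr_eq0; apply/eqP/idP => [->|vL].
  exact: proj_ortho_sub.
by rewrite proj_ortho_id.
Qed.

(** [v P] is orthogonal to the component of [v] in [L], so [<v P, v> = |v P|^2]. The left side is
    linear in the entries of [P] and can be integrated entry by entry. *)
Lemma coproj_quadratic L v :
  \sum_j (v *m coproj L) ord0 j * conjc (v ord0 j) =
  ((\sum_j cnormsq ((v *m coproj L) ord0 j))%:C)%C.
Proof.
set u := v *m coproj L.
have orth : \sum_j u ord0 j * conjc ((v *m ortho_proj L) ord0 j) = 0.
  have : (u <= orthomx Num.conj (mx_of_hermitian (hermitian1mx _)) (v *m ortho_proj L))%MS.
    rewrite orthomx_sym; apply: (submx_trans (proj_ortho_sub _ _)).
    by rewrite orthomx_sym /u mul_coproj; exact: proj_ortho_compl_sub.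
  rewrite orthomx1E => /eqP/matrixP/(_ ord0 ord0); rewrite !mxE => h.
  rewrite -[RHS]h; apply: eq_bigr => j _; by rewrite !mxE.
have vE : v = u + v *m ortho_proj L by rewrite /u mul_coproj subrK.
transitivity (\sum_j u ord0 j * conjc (u ord0 j)).
  rewrite -[RHS]addr0 -[X in _ = _ + X]orth -big_split /=; apply: eq_bigr => j _.
  have vj : v ord0 j = u ord0 j + (v *m ortho_proj L) ord0 j by rewrite {1}vE mxE.
  by rewrite {1}vj conjcD mulrDr.
by rewrite rmorph_sum /=; apply: eq_bigr => j _; exact: mulcJ.
Qed.

(** By [coproj_quadratic] on a basis vector, the diagonal entry [D] is the squared norm of its row.
    Hence [D^2 <= D], so [D <= 1], and every entry of the row has modulus at most 1. *)
Lemma coproj_bound L i j : cnorm1 (coproj L i j) <= 2.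
Proof.
pose D := \sum_j cnormsq (coproj L i j).
have rE j' : ((delta_mx ord0 i : 'rV[R[i]]_l) *m coproj L) ord0 j' = coproj L i j'.
  by rewrite -rowE mxE.
have e : coproj L i i = (D%:C)%C.
  have -> : (D%:C)%C = \sum_j' ((delta_mx ord0 i : 'rV[R[i]]_l) *m coproj L) ord0 j' *
      conjc ((delta_mx ord0 i : 'rV[R[i]]_l) ord0 j').
    rewrite coproj_quadratic; apply: (f_equal (fun t => (t%:C)%C)).
    by apply: eq_bigr => k _; rewrite rE.
  rewrite (bigD1 i)//= big1 ?addr0 => [|k ki].
    by rewrite rE !mxE !eqxx /= oppr0 mulr1.
  have -> : (delta_mx ord0 i : 'rV[R[i]]_l) ord0 k = 0 by rewrite mxE (negbTE ki) andbF.
  by rewrite (rmorph0 (@conjc R)) mulr0.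
have term k : cnormsq (coproj L i k) <= D.
  by rewrite /D (bigD1 k)//= lerDl sumr_ge0// => k' _; exact: cnormsq_ge0.
have D1 : D <= 1.
  have := term i; rewrite e /cnormsq /= expr0n addr0; nra.
have := cnorm1_sqr_le (coproj L i j); have := term j; have := cnorm1_ge0 (coproj L i j); nra.
Qed.

Lemma coproj_dist L1 L2 i j : cnorm1 (coproj L1 i j - coproj L2 i j) <= 2 * grass_dist L1 L2.
Proof.
have -> : coproj L1 i j - coproj L2 i j = - (ortho_proj L1 - ortho_proj L2) i j.
  rewrite /coproj; move: (ortho_proj L1) (ortho_proj L2) => A B.
  by rewrite !mxE; ring.
rewrite cnorm1N /grass_dist; move: (ortho_proj L1 - ortho_proj L2) => A.
have nz m : 0 <= \sum_i cnormsq (A m i) by apply: sumr_ge0 => ? _; exact: cnormsq_ge0.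
have hE : hs_norm A ^+ 2 = \sum_i \sum_j cnormsq (A i j).
  by rewrite /hs_norm sqr_sqrtr//; apply: sumr_ge0 => m _; exact: nz.
have term : cnormsq (A i j) <= hs_norm A ^+ 2.
  rewrite hE (bigD1 i)//= (bigD1 j)//= -addrA lerDl addr_ge0 ?sumr_ge0// => ? _.
  exact: cnormsq_ge0.
have h0 : 0 <= hs_norm A by exact: sqrtr_ge0.
rewrite -(@ler_pXn2r _ 2) ?nnegrE ?cnorm1_ge0 ?mulr_ge0//.
by have := cnorm1_sqr_le (A i j); rewrite exprMn; nra.
Qed.

End complement_projection.

(** * Compactly supported Hoelder symbols and the radial cutoff *)

Section admissible_symbols.
Context (R : realType) (d : nat) (b : R).
Hypotheses (b_gt0 : 0 < b) (b_le1 : b <= 1).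
Local Notation mu := (lebesgue_rv R d).
Implicit Types F G : 'rV[R]_d -> R[i].

Lemma hoelder_continuous_rv (f : 'rV[R]_d -> R) (B : R) :
  (forall x y, enorm (x - y) <= 1 -> `|f x - f y| <= B * enorm (x - y) `^ b) ->
  continuous f.
Proof.
move=> H x; have FF : Filter (nbhs x) by exact: nbhs_filter.
apply/(@cvgrPdist_lt _ _ _ (nbhs x) FF) => e e0.
pose c : R := (e / (`|B| + 1)) `^ b^-1.
have B1 : 0 < `|B| + 1 by rewrite ltr_wpDl.
have c0 : 0 < c by rewrite powR_gt0// divr_gt0.
(* Neighborhoods of row vectors are sup-norm balls; dividing by [d.+1] keeps the sum of the [d]
   coordinate differences, hence [enorm], below [Num.min 1 c]. *)
pose s : R := Num.min 1 c / d.+1%:R.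
have m0 : 0 < Num.min 1 c by rewrite lt_min ltr01.
have s0 : 0 < s by rewrite divr_gt0.
apply/nbhs_ballP; exists s => //= y [_ xy].
have xy' : enorm (x - y) <= Num.min 1 c.
  apply: le_trans (enorm_le_sum _) _.
  apply: (@le_trans _ _ (\sum_(j < d) s)).
    apply: ler_sum => j _; have := xy ord0 j; rewrite /ball /= => /ltW h.
    by rewrite (_ : (x - y) ord0 j = x ord0 j - y ord0 j)// !mxE.
  rewrite sumr_const card_ord -mulr_natr /s -mulrA ler_piMr ?(ltW m0)//.
  by rewrite mulrC ler_pdivrMr// mul1r ler_nat.
move: xy'; rewrite le_min => /andP[e1 ec].
apply: le_lt_trans (H _ _ e1) _.
have hb : enorm (x - y) `^ b <= e / (`|B| + 1).
  have -> : e / (`|B| + 1) = c `^ b.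
    by rewrite /c -powRrM mulVf ?gt_eqF// powRr1// divr_ge0 ?ltW.
  by rewrite ge0_ler_powR ?nnegrE ?enorm_ge0 ?(ltW c0)// ltW.
apply: (@le_lt_trans _ _ (`|B| * (e / (`|B| + 1)))).
  apply: (@le_trans _ _ (`|B| * enorm (x - y) `^ b)); last by rewrite ler_wpM2l.
  by rewrite ler_wpM2r ?powR_ge0// ler_norm.
by rewrite mulrA ltr_pdivrMr// mulrC ltr_pM2l// ltrDl.
Qed.

(** One unspecified constant serves as sup bound and Hoelder bound, which keeps the class stable
    under sums and scalar multiples. *)
Definition admissible (r : R) F := (forall x, r < enorm x -> F x = 0) /\
  exists2 B : R, 0 <= B & (forall x, cnorm1 (F x) <= B) /\
    (forall x y, enorm (x - y) <= 1 -> cnorm1 (F x - F y) <= B * enorm (x - y) `^ b).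

Lemma admissible_continuous r F : admissible r F ->
  continuous (fun x => complex.Re (F x)) /\ continuous (fun x => complex.Im (F x)).
Proof.
move=> [_ [B B0 [_ FH]]]; split; apply: (@hoelder_continuous_rv _ B) => x y xy;
  apply: le_trans _ (FH x y xy); rewrite /cnorm1 -raddfB/=.
  by rewrite lerDl.
by rewrite lerDr.
Qed.

Lemma admissible_cmeasurable r F : admissible r F -> cmeasurable F.
Proof.
by move=> /admissible_continuous[c1 c2]; split; exact: continuous_measurable_rv.
Qed.

Lemma admissible_cintegrable r F : admissible r F -> cintegrable mu F.
Proof.
move=> aF; have mF := admissible_cmeasurable aF; case: aF => F0 [B B0 [FB _]].
by have [] := cnorm1_cint_eball mF F0 (fun x _ => FB x).
Qed.

Lemma admissible0 r : admissible r (fun=> 0).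
Proof.
split=> //; exists 0 => //; split=> [x|x y _]; by rewrite ?subrr cnorm1_0// mul0r.
Qed.

Lemma admissibleD r F G : admissible r F -> admissible r G ->
  admissible r (fun x => F x + G x).
Proof.
move=> [F0 [B B0 [FB FH]]] [G0 [C C0 [GC GH]]]; split=> [x rx|].
  by rewrite F0// G0// addr0.
exists (B + C); first exact: addr_ge0.
split=> [x|x y xy]; first by rewrite (le_trans (cnorm1D _ _))// lerD.
rewrite opprD addrACA (le_trans (cnorm1D _ _))// mulrDl.
by rewrite lerD// ?FH// GH.
Qed.

Lemma admissibleZ r F c : admissible r F -> admissible r (fun x => F x * c).
Proof.
move=> [F0 [B B0 [FB FH]]]; split=> [x rx|]; first by rewrite F0// mul0r.
exists (B * cnorm1 c); first by rewrite mulr_ge0// cnorm1_ge0.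
split=> [x|x y xy]; first by rewrite (le_trans (cnorm1M _ _))// ler_wpM2r ?cnorm1_ge0.
rewrite -mulrBl (le_trans (cnorm1M _ _))// mulrAC ler_wpM2r ?cnorm1_ge0//.
exact: FH.
Qed.

Lemma admissible_sum r I (s : seq I) (F : I -> 'rV[R]_d -> R[i]) :
  (forall i, admissible r (F i)) -> admissible r (fun x => \sum_(i <- s) F i x).
Proof.
move=> aF; elim: s => [|i s ih].
  rewrite (_ : (fun _ => _) = fun=> 0); first exact: admissible0.
  by apply/funext => x; rewrite big_nil.
rewrite (_ : (fun _ => _) = fun x => F i x + \sum_(i <- s) F i x).
  exact: admissibleD.
by apply/funext => x; rewrite big_cons.
Qed.

Lemma admissible_fourier_decay r F : 0 <= r -> admissible r F -> cint mu F = 0 ->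
  exists2 C : R, 0 <= C & forall z, cnorm1 (fourier F z) <=
    C * (enorm z `^ b / (1 + enorm z `^ b) ^+ 2).
Proof.
move=> r0 aF; have mF := admissible_cmeasurable aF; case: aF => F0 [B B0 [FB FH]].
by apply: (@fourier_decay R d F r B B b) => //; rewrite b_gt0.
Qed.

(** By continuity, a positive value at [x] would keep [f] above [f x / 2] on a whole box around [x],
    whose measure is positive. *)
Lemma admissible_integral_eq0 r (f : 'rV[R]_d -> R) : admissible r (fun x => (f x)%:C)%C ->
  (forall x, 0 <= f x) -> cint mu (fun x => (f x)%:C)%C = 0 -> forall x, f x = 0.
Proof.
move=> af f0 intf x; apply/eqP; apply/negP => /negP fx0.
have [cf _] := admissible_continuous af; rewrite /= in cf.
have fx : 0 < f x by rewrite lt_neqAle eq_sym fx0 f0.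
have mf : measurable_fun setT f by exact: continuous_measurable_rv.
have /cvgrPdist_lt/(_ (f x / 2)) := cf x; rewrite divr_gt0// => /(_ isT) /nbhs_ballP[s /= s0 hs].
pose A := [set y : 'rV[R]_d | forall i : 'I_d, (`]x ord0 i - s, x ord0 i + s[%classic : set R) (y ord0 i)].
have mA : measurable A.
  rewrite (_ : A = \bigcap_(i in [set: 'I_d])
      ((fun y : 'rV[R]_d => y ord0 i) @^-1` `]x ord0 i - s, x ord0 i + s[%classic)).
    apply: fin_bigcap_measurable => [|i _]; first exact: finite_finset.
    by rewrite -[X in measurable X]setTI; apply: measurable_coord.
  by apply/seteqP; split => y By i => [_|]; exact: By.
have muA : (0 < mu A)%E.
  rewrite /A (@lebesgue_rv_box R d (fun i => `]x ord0 i - s, x ord0 i + s[%classic))//.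
  elim/big_ind : _ => [|u v u0 v0|j _]; [exact: lte01|exact: mule_gt0|].
  rewrite lebesgue_measure_itv/= lte_fin -subr_gt0 -EFinD.
  have -> : x ord0 j + s - (x ord0 j - s) = 2 * s by ring.
  by rewrite mulr_gt0// lte_fin mulr_gt0.
have fA y : A y -> f x / 2 <= f y.
  move=> Ay; have /hs : ball x s y.
    split => // i j; rewrite (ord1 i) /ball /=.
    by have := Ay j; rewrite /= in_itv/= -ltr_distlC.
  rewrite /= => /ltr_normlW; lra.
have [_ ] : (0 <= (f x / 2)%:E * mu A)%E /\ ((f x / 2)%:E * mu A <= 0)%E.
  split; first by rewrite mule_ge0// lee_fin divr_ge0// ltW.
  have -> : ((f x / 2)%:E * mu A = \int[mu]_(y in A) (f x / 2)%:E)%E by rewrite integral_cst.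
  apply: (@le_trans _ _ (\int[mu]_y (f y)%:E)%E).
    apply: (@le_trans _ _ (\int[mu]_(y in A) (f y)%:E)%E).
      apply: ge0_le_integral => //; first by move=> y _; rewrite lee_fin divr_ge0// ltW.
        by apply/measurable_EFinP; exact: measurable_funTS.
    apply: ge0_subset_integral => //; last by move=> y _; rewrite lee_fin.
    by apply/measurable_EFinP.
  have [iRe _] := admissible_cintegrable af; move: intf => [intf _].
  rewrite -[leLHS]fineK ?lee_fin; last exact: integrable_fin_num.
  by rewrite [leLHS]intf.
by rewrite leNgt mule_gt0// lte_fin divr_gt0.
Qed.

(** A trapezoid in [|x|] with slopes 2 and -1. Vanishing for [|x| <= 1/2] removes a neighborhood of
    the origin, where [spherical] has no continuous extension in general. *)
Definition cutoff (rho : R) (x : 'rV[R]_d) : R :=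
  Num.max 0 (Num.min 1 (Num.min (2 * enorm x - 1) (rho + 1 - enorm x))).

Lemma dist_min (x y u v K : R) : `|x - u| <= K -> `|y - v| <= K ->
  `|Num.min x y - Num.min u v| <= K.
Proof.
rewrite !ler_norml => /andP[h1 h2] /andP[h3 h4].
have [xy|xy] := leP x y; have [uv|uv] := leP u v; apply/andP; split; lra.
Qed.

Lemma dist_max (x y u v K : R) : `|x - u| <= K -> `|y - v| <= K ->
  `|Num.max x y - Num.max u v| <= K.
Proof.
rewrite !ler_norml => /andP[h1 h2] /andP[h3 h4].
have [xy|xy] := leP x y; have [uv|uv] := leP u v; apply/andP; split; lra.
Qed.

Lemma cutoff_ge0 rho x : 0 <= cutoff rho x.
Proof. by rewrite /cutoff le_max lexx. Qed.

Lemma cutoff_le1 rho x : cutoff rho x <= 1.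
Proof. by rewrite /cutoff ge_max ler01 ge_min lexx. Qed.

Lemma cutoff_eq0 rho x : ~~ (2^-1 <= enorm x <= rho + 1) -> cutoff rho x = 0.
Proof.
move=> h; rewrite /cutoff; apply/max_idPl; rewrite !ge_min.
move: h; rewrite negb_and -!ltNge => /orP[h|h]; apply/orP; right; apply/orP; [left|right]; lra.
Qed.

Lemma cutoff_eq1 rho x : 1 <= enorm x <= rho -> cutoff rho x = 1.
Proof.
move=> /andP[h1 h2]; rewrite /cutoff.
have -> : Num.min 1 (Num.min (2 * enorm x - 1) (rho + 1 - enorm x)) = 1.
  by apply/min_idPl; rewrite le_min; apply/andP; split; lra.
by apply/max_idPr.
Qed.

Lemma cutoff_lipschitz rho x y : `|cutoff rho x - cutoff rho y| <= 2 * enorm (x - y).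
Proof.
have e0 := enorm_ge0 (x - y).
have : `|enorm x - enorm y| <= enorm (x - y) by exact: ler_dist_enorm.
rewrite ler_norml => /andP[h1 h2].
apply: dist_max; first by rewrite subrr normr0 mulr_ge0.
apply: dist_min; first by rewrite subrr normr0 mulr_ge0.
by apply: dist_min; rewrite ler_norml; apply/andP; split; lra.
Qed.

(** [G] is controlled on the shell only. If just one of the two points lies in the shell, the cutoff
    vanishes at the other, so its Lipschitz bound makes it at most [2 |x - y|] at the first. *)
Lemma admissible_cutoff rho G (B H : R) : 0 <= B -> 0 <= H ->
  (forall x, 2^-1 <= enorm x <= rho + 1 -> cnorm1 (G x) <= B) ->
  (forall x y, 2^-1 <= enorm x <= rho + 1 -> 2^-1 <= enorm y <= rho + 1 ->
    enorm (x - y) <= 1 -> cnorm1 (G x - G y) <= H * enorm (x - y) `^ b) ->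
  admissible (rho + 1) (fun x => (cutoff rho x)%:C%C * G x).
Proof.
move=> B0 H0 GB GH; split=> [x rx|].
  by rewrite cutoff_eq0 ?mul0r// negb_and -!ltNge rx orbT.
have Fb x : cnorm1 ((cutoff rho x)%:C%C * G x) <= B.
  have [sx|/cutoff_eq0 ->] := boolP (2^-1 <= enorm x <= rho + 1); last first.
    by rewrite mul0r cnorm1_0.
  rewrite (le_trans (cnorm1M _ _))// cnorm1_real ger0_norm ?cutoff_ge0//.
  have := GB _ sx; have := cutoff_le1 rho x; have := cutoff_ge0 rho x.
  have := cnorm1_ge0 (G x); nra.
exists (2 * B + H); first by rewrite addr_ge0// mulr_ge0.
split=> [x|x y xy]; first by rewrite (le_trans (Fb x))//; lra.
(* For distances at most 1 a Lipschitz bound is also a Hoelder bound of exponent [b <= 1]. *)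
have eb : enorm (x - y) <= enorm (x - y) `^ b.
  by apply: powR_unit_ge => //; rewrite enorm_ge0.
have e0 := enorm_ge0 (x - y).
have lip := cutoff_lipschitz rho x y.
have wG (z : R) u : 2^-1 <= enorm u <= rho + 1 -> `|z| <= 2 * enorm (x - y) ->
    cnorm1 (z%:C%C * G u) <= 2 * B * enorm (x - y) `^ b.
  move=> su hz; rewrite (le_trans (cnorm1M _ _))// cnorm1_real.
  apply: (@le_trans _ _ (2 * enorm (x - y) * B)).
    by apply: ler_pM; rewrite ?cnorm1_ge0 ?GB.
  by rewrite mulrAC ler_wpM2l// mulr_ge0.
have Hb : 0 <= H * enorm (x - y) `^ b by rewrite mulr_ge0// powR_ge0.
have [sx|nx] := boolP (2^-1 <= enorm x <= rho + 1); last first.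
  rewrite (cutoff_eq0 nx) mul0r sub0r cnorm1N.
  have [sy|/cutoff_eq0 ->] := boolP (2^-1 <= enorm y <= rho + 1); last first.
    by rewrite mul0r cnorm1_0 mulr_ge0 ?powR_ge0 ?addr_ge0 ?mulr_ge0.
  rewrite mulrDl (le_trans (wG _ _ sy _)) ?lerDl//.
  by move: lip; rewrite (cutoff_eq0 nx) sub0r normrN.
have [sy|ny] := boolP (2^-1 <= enorm y <= rho + 1); last first.
  rewrite (cutoff_eq0 ny) mul0r subr0.
  rewrite mulrDl (le_trans (wG _ _ sx _)) ?lerDl//.
  by move: lip; rewrite (cutoff_eq0 ny) subr0.
have -> : (cutoff rho x)%:C%C * G x - (cutoff rho y)%:C%C * G y =
    (cutoff rho x - cutoff rho y)%:C%C * G x + (cutoff rho y)%:C%C * (G x - G y).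
  by rewrite rmorphB; ring.
rewrite mulrDl (le_trans (cnorm1D _ _))// lerD ?wG//.
rewrite (le_trans (cnorm1M _ _))// cnorm1_real ger0_norm ?cutoff_ge0//.
rewrite (le_trans _ (GH _ _ sx sy xy))// ler_piMl ?cnorm1_ge0//.
exact: cutoff_le1.
Qed.

End admissible_symbols.

(** * The multiplier supplied by cancellation *)

Lemma cnormsq_eq0 (R : realType) (z : R[i]) : cnormsq z = 0 -> z = 0.
Proof.
case: z => x y; rewrite /cnormsq /= => /eqP; rewrite paddr_eq0 ?sqr_ge0//.
by rewrite !sqrf_eq0 => /andP[/eqP -> /eqP ->].
Qed.

Section cancelling_multiplier.
Context (R : realType) (d l : nat) (a : 'rV[R]_d).
Hypothesis a_gt0 : forall j, 0 < a ord0 j.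
Context (Omega : 'rV[R]_d -> {vspace 'rV[R[i]]_l}).
Hypothesis Omega_hoelder : hoelder_continuous (fun x y => enorm (x - y))
  (@grass_dist R l) (@unit_sphere R d) Omega.
Hypothesis Omega_canceling :
  \bigcap_(zeta in @unit_sphere R d) [set` Omega zeta] = [set 0].
Local Notation mu := (lebesgue_rv R d).

(** The bound is needed for all pairs of points, since [spherical] may stretch distances beyond 1.
    For distant pairs the entries are bounded by 2 each, whence the 4. *)
Lemma coproj_hoelder : exists b : R, [/\ 0 < b, b <= 1 & exists2 H : R, 0 <= H &
  forall x y i j, unit_sphere x -> unit_sphere y ->
  cnorm1 (coproj (Omega x) i j - coproj (Omega y) i j) <= H * enorm (x - y) `^ b].
Proof.
have [alpha alpha0 [C HC]] := Omega_hoelder.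
(* An exponent at most 1 allows the Lipschitz cutoff to be absorbed into the Hoelder class. *)
pose b := Num.min alpha 1.
have b0 : 0 < b by rewrite lt_min alpha0 ltr01.
have b1 : b <= 1 by rewrite ge_min lexx orbT.
exists b; split => //; exists (4 + 2 * `|C|); first by rewrite addr_ge0// mulr_ge0.
move=> x y i j sx sy; rewrite mulrDl.
have e0 := enorm_ge0 (x - y).
have p0 : 0 <= enorm (x - y) `^ b by exact: powR_ge0.
have [xy|xy] := leP (enorm (x - y)) 1; last first.
  have p1 : 1 <= enorm (x - y) `^ b.
    have p1 : (1 : R) `^ b = 1 by rewrite powR1.
    by rewrite -[leLHS]p1 ge0_ler_powR ?nnegrE ?e0 ?(ltW b0)// ltW.
  have h u v : cnorm1 u <= 2 -> cnorm1 v <= 2 ->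
      cnorm1 (u - v) <= 4 * enorm (x - y) `^ b + 2 * `|C| * enorm (x - y) `^ b.
    have := cnorm1B u v; have : 0 <= 2 * `|C| * enorm (x - y) `^ b by rewrite !mulr_ge0.
    lra.
  exact: h (coproj_bound _ _ _) (coproj_bound _ _ _).
have pp : enorm (x - y) `^ alpha <= enorm (x - y) `^ b.
  have [z|z] := eqVneq (enorm (x - y)) 0.
    by rewrite z !powR0 ?gt_eqF.
  have zp : 0 < enorm (x - y) by rewrite lt_neqAle eq_sym z.
  rewrite /powR (negbTE z) ler_expR ler_wnM2r ?ln_le0//.
  by rewrite ge_min lexx.
have h := le_trans (coproj_dist (Omega x) (Omega y) i j) (ler_wpM2l (ler0n R 2) (HC _ _ sx sy xy)).
apply: (le_trans h); rewrite -[leLHS]add0r lerD ?mulr_ge0// -mulrA ler_wpM2l//.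
apply: (@le_trans _ _ (`|C| * enorm (x - y) `^ alpha)).
  by rewrite ler_wpM2r ?powR_ge0// ler_norm.
by rewrite ler_wpM2l.
Qed.

Let Pm xi := coproj (Omega (spherical a xi)).

Lemma coproj_admissible (rho : R) : exists b : R, [/\ 0 < b, b <= 1 &
  forall i j, admissible b (rho + 1) (fun xi => (cutoff rho xi)%:C%C * Pm xi i j)].
Proof.
have [b [b0 b1 [H H0 HP]]] := coproj_hoelder; exists b; split => // i j.
have [L L0 HL] := spherical_lipschitz a_gt0 (rho + 1).
have nz (x : 'rV[R]_d) : 2^-1 <= enorm x <= rho + 1 -> x != 0.
  by move=> /andP[xh _]; apply: contraTneq xh => ->; rewrite enorm0 -ltNge invr_gt0.
apply: (@admissible_cutoff R d b b1 rho _ 2 (H * L `^ b)) => //.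
- by rewrite mulr_ge0// powR_ge0.
- by move=> x _; exact: coproj_bound.
move=> x y sx sy xy.
have h := HP _ _ i j (spherical_unit a_gt0 (nz _ sx)) (spherical_unit a_gt0 (nz _ sy)).
suff h' : H * enorm (spherical a x - spherical a y) `^ b <= H * L `^ b * enorm (x - y) `^ b.
  exact: le_trans h h'.
have := HL _ _ sx sy; have := enorm_ge0 (x - y); have := enorm_ge0 (spherical a x - spherical a y).
move: (enorm (x - y)) (enorm (spherical a x - spherical a y)) => s t t0 s0 ts.
rewrite -mulrA ler_wpM2l// -powRM//.
by rewrite ge0_ler_powR ?nnegrE ?(ltW b0) ?mulr_ge0.
Qed.

Lemma cutoff_admissible (b rho : R) : 0 < b -> b <= 1 ->
  admissible b (rho + 1) (fun xi : 'rV[R]_d => (cutoff rho xi)%:C%C).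
Proof.
move=> b0 b1; rewrite (_ : (fun _ => _) = fun xi => (cutoff rho xi)%:C%C * 1).
  apply: (@admissible_cutoff R d b b1 rho _ 2 0) => // [x _|x y _ _ _].
    by rewrite /cnorm1 /= normr0 normr1 addr0 ler1n.
  by rewrite subrr cnorm1_0 mul0r.
by apply/funext => x; rewrite mulr1.
Qed.

Variable rho : R.
Hypothesis rho_ge1 : 1 <= rho.

Let A : 'M[R[i]]_l := \matrix_(p, q) cint mu (fun xi => (cutoff rho xi)%:C%C * Pm xi p q).

(* A left null vector [v] of [A] satisfies [\int w |v P|^2 = 0]. *)
Lemma mean_coproj_unit : A \in unitmx.
Proof.
have [b [b0 b1 aP]] := coproj_admissible rho.
have iP p q := admissible_cintegrable b0 (aP p q).
rewrite -row_free_unit -kermx_eq0; apply/eqP/row_matrixP => m; rewrite row0.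
set v := row m (kermx A).
have vA : v *m A = 0 by apply/sub_kermxP; rewrite row_sub.
pose S xi := \sum_j cnormsq ((v *m Pm xi) ord0 j).
(* The quadratic form is rewritten through the entries of [w P], so that admissibility and
   integration apply to each entry. *)
have SE xi : ((cutoff rho xi * S xi)%:C)%C = \sum_q (\sum_p ((cutoff rho xi)%:C%C * Pm xi p q) *
     v ord0 p) * conjc (v ord0 q).
  rewrite rmorphM /= -coproj_quadratic mulr_sumr; apply: eq_bigr => q _.
  rewrite mulrA; congr (_ * _); rewrite mxE mulr_sumr; apply: eq_bigr => p _.
  by rewrite mulrCA mulrC.
have aS : admissible b (rho + 1) (fun xi => ((cutoff rho xi * S xi)%:C)%C).
  rewrite (funext SE); apply: admissible_sum => q; apply: admissibleZ.
  by apply: admissible_sum => p; apply: admissibleZ.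
have S0 xi : 0 <= S xi by apply: sumr_ge0 => j _; exact: cnormsq_ge0.
have intS : cint mu (fun xi => ((cutoff rho xi * S xi)%:C)%C) = 0.
  rewrite (funext SE) cint_sum; last first.
    move=> q _; apply: (admissible_cintegrable b0 (r := rho + 1)); apply: admissibleZ.
    by apply: admissible_sum => p; apply: admissibleZ.
  rewrite big1// => q _.
  rewrite (_ : (fun _ => _) = fun xi => conjc (v ord0 q) * \sum_p v ord0 p * ((cutoff rho xi)%:C%C * Pm xi p q)).
    rewrite cintZ; last first.
      by apply: cintegrable_sum => p _; exact: cintegrableZ.
    rewrite cint_sum; last by move=> p _; exact: cintegrableZ.
    have h : (v *m A) ord0 q = 0 by rewrite vA mxE.
    rewrite mxE in h.
    rewrite (_ : \sum_p _ = 0) ?mulr0// -[RHS]h; apply: eq_bigr => p _.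
    by rewrite cintZ// [A p q]mxE.
  apply/funext => xi; rewrite mulrC; congr (_ * _); apply: eq_bigr => p _.
  exact: mulrC.
have S_eq0 := admissible_integral_eq0 b0 aS (fun x => mulr_ge0 (cutoff_ge0 rho x) (S0 x)) intS.
(* On the unit sphere the cutoff is 1, as [rho >= 1], and [spherical] is the identity. So
   [S zeta = 0], which puts [v] in every [Omega zeta]. *)
have : (\bigcap_(zeta in @unit_sphere R d) [set` Omega zeta]) v.
  move=> zeta z1 /=; rewrite -coproj_eq0; apply/eqP/rowP => j.
  have := S_eq0 zeta; rewrite cutoff_eq1 ?mul1r; last by rewrite z1 lexx.
  rewrite /S /Pm spherical_id// => /psumr_eq0P => /(_ (fun j _ => cnormsq_ge0 _) j isT).
  move: ((v *m _) ord0 j) => u uv; rewrite [RHS]mxE.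
  exact: cnormsq_eq0.
by rewrite Omega_canceling.
Qed.

(** The correction [w P B] integrates to [A B = (\int w) 1], which balances the scalar part, and it
    is invisible on [Omega] because [v P = 0] is formed before multiplying by [B]. The vanishing at
    0 is recorded because dilations fix the origin, where the transform of [f] is not
    constrained. *)
Lemma cancelling_multiplier : exists b : R, [/\ 0 < b, b <= 1 &
  exists M : 'I_l -> 'I_l -> 'rV[R]_d -> R[i],
  [/\ forall p q, admissible b (rho + 1) (M p q),
      forall p q, cint mu (M p q) = 0,
      forall p q, M p q 0 = 0 &
      forall xi (v : 'rV[R[i]]_l), xi != 0 -> v \in Omega (spherical a xi) ->
        forall q, \sum_p v ord0 p * M p q xi = (cutoff rho xi)%:C%C * v ord0 q]].
Proof.
have [b [b0 b1 aP]] := coproj_admissible rho; exists b; split => //.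
have aW := cutoff_admissible rho b0 b1.
pose W := cint mu (fun xi : 'rV[R]_d => (cutoff rho xi)%:C%C).
pose B := W *: invmx A.
pose N p q xi := \sum_r ((cutoff rho xi)%:C%C * Pm xi p r) * B r q.
have aN p q : admissible b (rho + 1) (N p q).
  by apply: admissible_sum => r; exact: admissibleZ.
exists (fun p q xi => (cutoff rho xi)%:C%C * (p == q)%:R + N p q xi * -1); split.
- by move=> p q; apply: admissibleD; apply: admissibleZ.
- move=> p q; rewrite cintD; try by apply: (admissible_cintegrable b0 (r := rho + 1)); exact: admissibleZ.
  rewrite (_ : cint mu (fun x => (cutoff rho x)%:C%C * _) = W * (p == q)%:R); last first.
    rewrite mulrC -cintZ; first by apply: eq_cint => x; rewrite mulrC.
    exact: (admissible_cintegrable b0 aW).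
  rewrite (_ : cint mu (fun x => N p q x * -1) = - (A *m B) p q); last first.
    transitivity (-1 * cint mu (N p q)).
      rewrite -cintZ; last exact: (admissible_cintegrable b0 (aN p q)).
      by apply: eq_cint => x; rewrite mulrN1 mulN1r.
    rewrite mulN1r; congr (- _); rewrite [RHS]mxE cint_sum; last first.
      by move=> r _; apply: (admissible_cintegrable b0 (r := rho + 1)); exact: admissibleZ.
    apply: eq_bigr => r _; rewrite [A p r]mxE [RHS]mulrC -cintZ; last exact: (admissible_cintegrable b0 (aP p r)).
    by apply: eq_cint => x; exact: mulrC.
  by rewrite /B -scalemxAr mulmxV ?mean_coproj_unit// !mxE subrr.
- move=> p q; have w0 : cutoff rho (0 : 'rV[R]_d) = 0.
    by apply: cutoff_eq0; rewrite enorm0 leNgt invr_gt0 ltr0n.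
  by rewrite w0 mul0r add0r /N big1 ?mul0r// => r _; rewrite w0 !mul0r.
move=> xi v xi0 vO q.
under eq_bigr do rewrite mulrDr.
rewrite big_split /= (bigD1 q)//= [X in _ + X + _]big1 => [|p pq]; last first.
  by rewrite (negbTE pq) !mulr0.
rewrite eqxx mulr1 addr0 mulrC -[RHS]addr0; congr (_ + _).
under eq_bigr do rewrite mulrN1 mulrN.
rewrite sumrN -[RHS]oppr0; congr (- _).
under eq_bigr do rewrite mulr_sumr.
rewrite exchange_big big1//= => r _.
transitivity (\sum_p (v ord0 p * Pm xi p r) * ((cutoff rho xi)%:C%C * B r q)).
  by apply: eq_bigr => p _; ring.
have /eqP/rowP/(_ r) : v *m Pm xi == 0 by rewrite coproj_eq0.
by rewrite !mxE -mulr_suml => ->; rewrite mul0r.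
Qed.

End cancelling_multiplier.

(** * The multiscale kernel and its scalar weight *)

Section multiscale_kernel.
Context (R : realType) (d : nat) (a : 'rV[R]_d) (b : R).
Hypotheses (a_gt0 : forall j, 0 < a ord0 j) (b_gt0 : 0 < b) (b_le1 : b <= 1).
Local Notation mu := (lebesgue_rv R d).

(** The Jacobian in front of each dilate is what makes [fourier_multiscale] a sum of values of
    [fourier F] without factors. *)
Definition multiscale (N n : nat) (F : 'rV[R]_d -> R[i]) (xi : 'rV[R]_d) : R[i] :=
  \sum_(i < n) ((\prod_j scale a (dyadic R N i) ord0 j)%:C)%C * F (dil a (dyadic R N i) xi).

Lemma cintegrable_dil t F : 0 < t -> cintegrable mu F ->
  cintegrable mu (fun xi => F (dil a t xi)).
Proof.
move=> t0 iF; rewrite (_ : (fun _ => _) = fun xi => F (affine (scale a t) 0 xi)).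
  by apply: cintegrable_affine => // j; exact: scale_gt0.
by apply/funext => xi; rewrite dil_affine.
Qed.

Lemma cintegrable_multiscale N n F : cintegrable mu F -> cintegrable mu (multiscale N n F).
Proof.
move=> iF; apply: cintegrable_sum => i _; apply: cintegrableZ.
by apply: cintegrable_dil => //; exact: dyadic_gt0.
Qed.

Lemma fourier_multiscale N n F z : cintegrable mu F ->
  fourier (multiscale N n F) z = \sum_(i < n) fourier F (undil a (dyadic R N i) z).
Proof.
move=> iF; rewrite fourierE.
transitivity (cint mu (fun xi => \sum_(i < n) ((\prod_j scale a (dyadic R N i) ord0 j)%:C)%C *
    (F (dil a (dyadic R N i) xi) * wave xi z))).
  by apply: eq_cint => xi; rewrite /multiscale mulr_suml; apply: eq_bigr => i _; rewrite mulrA.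
have iFi (i : nat) : cintegrable mu (fun xi => F (dil a (dyadic R N i) xi)).
  by apply: cintegrable_dil => //; exact: dyadic_gt0.
rewrite cint_sum; last by move=> i _; apply: cintegrableZ; exact: cintegrable_wave.
apply: eq_bigr => i _; rewrite cintZ; last exact: cintegrable_wave.
rewrite -fourierE -(fourier_dilation z (fun j => scale_gt0 a j (dyadic_gt0 R N i)) iF).
have -> // : (fun xi => F (dil a (dyadic R N i) xi)) =
  (fun xi => F (affine (scale a (dyadic R N i)) 0 xi)).
by apply/funext => xi; rewrite dil_affine.
Qed.

Lemma fourier_multiscale_bound r F : 0 <= r -> admissible b r F -> cint mu F = 0 ->
  exists2 K : R, 0 <= K & forall N n z, cnorm1 (fourier (multiscale N n F) z) <= K.
Proof.
move=> r0 aF F0; have iF := admissible_cintegrable b_gt0 aF.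
have [C C0 HC] := admissible_fourier_decay b_gt0 b_le1 r0 aF F0.
have [K K0 HK] := multiscale_bound a_gt0 b_gt0.
exists (C * K); first exact: mulr_ge0.
move=> N n z; rewrite fourier_multiscale// (le_trans (cnorm1_sum _ _ _))//.
apply: le_trans (ler_wpM2l C0 (HK N n z)); rewrite mulr_sumr.
by apply: ler_sum => i _; exact: HC.
Qed.

(** The multiscale sum with the cutoff as profile; on vectors of [Omega] the multiscale sum of the
    cancelling multiplier acts as multiplication by it. *)
Definition weight (rho : R) N n (xi : 'rV[R]_d) : R :=
  \sum_(i < n) (\prod_j scale a (dyadic R N i) ord0 j) * cutoff rho (dil a (dyadic R N i) xi).

Lemma weight_ge0 rho N n xi : 0 <= weight rho N n xi.
Proof.
apply: sumr_ge0 => i _; rewrite mulr_ge0 ?cutoff_ge0// prodr_ge0// => j _.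
by rewrite ltW// scale_gt0// dyadic_gt0.
Qed.

Lemma dyadic_bracket N n (e : R) : dyadic R N 0 <= e -> e < dyadic R N n ->
  exists2 i, (i < n)%N & dyadic R N i <= e < dyadic R N i.+1.
Proof.
move=> e0; elim: n => [|n ih]; first by rewrite ltNge e0.
move=> en; have [/ih[i ni hi]|ne] := ltP e (dyadic R N n); first by exists i => //; exact: leqW.
by exists n; rewrite // ne.
Qed.

Lemma dyadic_range (e : R) : 0 < e ->
  exists N0, forall N, (N0 <= N)%N -> dyadic R N 0 <= e /\ e < dyadic R N (N + N).
Proof.
move=> e0; have l2 : 0 < ln 2 :> R by rewrite ln_gt0// ltr1n.
(* Then [|ln e| < N * ln 2], while [dyadic N 0] is [2^-N] and [dyadic N (N + N)] is [2^N]. *)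
exists (Num.bound (`|ln e| / ln 2)) => N hN.
have : `|ln e| < N%:R * ln 2.
  rewrite -ltr_pdivrMr//; apply: lt_le_trans (archi_boundP _) _; first by rewrite divr_ge0// ltW.
  by rewrite ler_nat.
rewrite ltr_norml => /andP[h1 h2]; rewrite /dyadic /powR gt_eqF//.
rewrite natrD addrK sub0r -[X in X <= _ /\ _]/(expR _); split.
  by rewrite -[leRHS](lnK e0) ler_expR mulNr ltW.
by rewrite -[ltLHS](lnK e0) ltr_expR.
Qed.

(** A single term suffices. For [t = 2^(i - N) <= eta < 2 t] the dilated point has [eta] in [[1,
    2[], where the cutoff is 1, and the Jacobian [t] to the power [- \sum_j a_j] is at least the
    same power of [eta]. *)
Lemma weight_lower xi : xi != 0 -> exists N0, forall N, (N0 <= N)%N ->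
  Defs.eta a xi `^ (- \sum_j a ord0 j) <= weight (expR ((\sum_j a ord0 j) * ln 2)) N (N + N) xi.
Proof.
move=> xi0; have [e0 _] := eta_spec a_gt0 xi0.
have [N0 HN] := dyadic_range e0; exists N0 => N /HN[h1 h2].
have [i iN /andP[i1 i2]] := dyadic_bracket h1 h2.
have t0 := dyadic_gt0 R N i.
rewrite /weight (bigD1 (Ordinal iN))//= -[leLHS]addr0 lerD//; last first.
  apply: sumr_ge0 => j _; rewrite mulr_ge0 ?cutoff_ge0// prodr_ge0// => j' _.
  by rewrite ltW// scale_gt0// dyadic_gt0.
have dn0 := dil_neq0 a t0 xi0.
have ed := eta_dil a_gt0 t0 xi0.
rewrite cutoff_eq1 ?mulr1; last first.
  apply/andP; split.
    by apply: (enorm_ge1 a_gt0) => //; rewrite ed ler_pdivlMr ?mul1r.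
  by apply: (enorm_le_eta2 a_gt0) => //; rewrite ed ler_pdivrMr// -dyadicS ltW.
rewrite scale_prod// !powRN lef_pV2 ?posrE ?powR_gt0//.
by rewrite ge0_ler_powR ?nnegrE ?(ltW t0) ?(ltW e0)// sumr_ge0// => j _; exact: ltW.
Qed.

(** Away from the origin and for [t > 0], monotonicity of [level] turns [t <= eta xi] into
    [1 <= level xi (ln t)], a condition measurable in [xi]. The origin, where [eta] has its default
    value, is treated apart as the ball of radius 0. *)
Lemma measurable_eta : measurable_fun setT (Defs.eta a).
Proof.
have mlevel s : measurable_fun setT (fun xi : 'rV[R]_d => level a xi s).
  apply: measurable_sum => j; apply: measurable_funM; last exact: measurable_cst.
  by apply: measurable_funX; exact: measurable_coord.
have m0 : measurable (eball 0 : set 'rV[R]_d) by exact: measurable_eball.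
have e0 (xi : 'rV[R]_d) : eball 0 xi <-> xi = 0.
  rewrite /eball /=; split=> [h|->]; last by rewrite enorm0.
  by apply: enorm_eq0; apply/le_anti; rewrite h enorm_ge0.
apply: (measurability _ (RGenCInfty.measurableE R)) => _ [_ [t ->] <-].
rewrite setTI; pose P := [set xi : 'rV[R]_d | t <= 0 \/ 1 <= level a xi (ln t)].
have mP : measurable P.
  rewrite (_ : P = [set _ | t <= 0] `|` ((fun xi : 'rV[R]_d => level a xi (ln t)) @^-1` `[1, +oo[%classic)).
    apply: measurableU; first by have [t0|t0] := boolP (t <= 0);
      rewrite (_ : mkset _ = if t <= 0 then setT else set0) ?t0 ?(negbTE t0)//; apply/seteqP; split.
    by rewrite -[X in measurable X]setTI; exact: mlevel.
  by apply/seteqP; split => xi [h|h]; [left|right|left|right] => //; move: h; rewrite /= in_itv/= andbT.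
pose Q := [set _ : 'rV[R]_d | t <= Defs.eta a 0].
have mQ : measurable Q.
  by have [t0|t0] := boolP (t <= Defs.eta a 0);
    rewrite (_ : Q = if t <= Defs.eta a 0 then setT else set0) /Q ?t0 ?(negbTE t0)//; apply/seteqP; split.
rewrite (_ : _ @^-1` _ = (~` eball 0 `&` P) `|` (eball 0 `&` Q)).
  by apply: measurableU; apply: measurableI => //; exact: measurableC.
have key (xi : 'rV[R]_d) : xi <> 0 -> t <= Defs.eta a xi <-> P xi.
  move=> /eqP xi0; have [ep el] := eta_spec a_gt0 xi0; have [mp _] := exponent_minP a_gt0.
  have [t0|t0] := leP t 0; first by split=> _; [left|rewrite (le_trans t0)// ltW].
  split=> [te|[|h]]; [right| by rewrite leNgt t0|].
    have := level_decreasing a_gt0 xi (_ : ln t <= ln (Defs.eta a xi)).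
    rewrite ler_ln ?posrE// te el mulr1 => /(_ isT); apply: le_trans.
    by rewrite -expR0 ler_expR !mulr_ge0 ?(ltW mp)// subr_ge0 ler_ln ?posrE.
  rewrite leNgt; apply/negP => et.
  have lt : ln (Defs.eta a xi) < ln t by rewrite ltr_ln ?posrE.
  have := level_decreasing a_gt0 xi (ltW lt); rewrite el leNgt => /negP; apply.
  apply: lt_le_trans (_ : expR (2 * exponent_min a * (ln t - ln (Defs.eta a xi))) <= _).
    by rewrite -[ltLHS]expR0 ltr_expR !mulr_gt0// subr_gt0.
  by rewrite ler_peMr ?expR_ge0.
apply/seteqP; split => xi; rewrite /= in_itv/= andbT.
  have [->|/eqP x0] := eqVneq xi 0; first by right; split => //; exact/e0.
  by move=> /(key _ x0) h; left; split => // /e0.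
move=> [[x0 h]|[/e0 -> //]].
by apply/key => // x0'; apply: x0; apply/e0.
Qed.

End multiscale_kernel.

(** * The weighted [L_2] estimate for the Fourier transform *)

Lemma sesquilinear_bound (R : realType) (d : nat) (M f g : 'rV[R]_d -> R[i]) (K : R) :
  0 <= K -> (forall z, cnorm1 (fourier M z) <= K) ->
  cintegrable (lebesgue_rv R d) M -> cintegrable (lebesgue_rv R d) f ->
  cintegrable (lebesgue_rv R d) g ->
  cnorm1 (cint (lebesgue_rv R d) (fun xi => fourier f xi * (M xi * conjc (fourier g xi)))) <=
  K * (\int[lebesgue_rv R d]_x cnorm1 (f x)) * (\int[lebesgue_rv R d]_x cnorm1 (g x)).
Proof.
move=> K0 MK iM fi ig; set mu := lebesgue_rv R d in iM fi ig *.
have mf := cmeasurable_cnorm1 (cintegrable_cmeasurable fi).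
have mg := cmeasurable_cnorm1 (cintegrable_cmeasurable ig).
have mFM := cmeasurable_cnorm1 (cmeasurable_fourier (cintegrable_cmeasurable iM)).
have IE (h : 'rV[R]_d -> R[i]) : cintegrable mu h ->
    (\int[mu]_x (cnorm1 (h x))%:E)%E = (\int[mu]_x cnorm1 (h x))%:E.
  by move=> ih; rewrite fineK//; apply: integrable_fin_num => //; exact: cintegrable_cnorm1.
have m1 : measurable_fun setT (fun p : 'rV[R]_d * 'rV[R]_d =>
    (cnorm1 (f p.1) * (cnorm1 (g p.2) * cnorm1 (fourier M (p.1 - p.2))))%:E).
  apply/measurable_EFinP/measurable_funM; first exact: measurableT_comp mf measurable_fst.
  apply: measurable_funM; first exact: measurableT_comp mg measurable_snd.
  exact: measurableT_comp mFM (@measurable_sub_rv _ _).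
have m2 : measurable_fun setT (fun p : 'rV[R]_d * 'rV[R]_d =>
    (K * cnorm1 (f p.1) * cnorm1 (g p.2))%:E).
  apply/measurable_EFinP/measurable_funM; last exact: measurableT_comp mg measurable_snd.
  by apply: measurable_funM => //; exact: measurableT_comp mf measurable_fst.
rewrite -lee_fin; apply: le_trans (fourier_sesquilinear iM fi ig) _.
apply: (@le_trans _ _ (\int[mu]_x \int[mu]_y (K * cnorm1 (f x) * cnorm1 (g y))%:E)%E).
  apply: ge0_le_integral => //.
  - by move=> x _; apply: integral_ge0 => y _; rewrite lee_fin !mulr_ge0 ?cnorm1_ge0.
  - by apply: (measurable_fun_fubini_tonelli_F _ m1) => p; rewrite lee_fin !mulr_ge0 ?cnorm1_ge0.
  - by apply: (measurable_fun_fubini_tonelli_F _ m2) => p; rewrite lee_fin !mulr_ge0 ?cnorm1_ge0.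
  move=> x _; apply: ge0_le_integral => //.
  - by move=> y _; rewrite lee_fin !mulr_ge0 ?cnorm1_ge0.
  - exact: measurableT_comp m1 (pair1_measurable x).
  - exact: measurableT_comp m2 (pair1_measurable x).
  move=> y _; rewrite lee_fin.
  have := ler_wpM2l (mulr_ge0 (cnorm1_ge0 (f x)) (cnorm1_ge0 (g y))) (MK (x - y)).
  by rewrite -!mulrA [X in _ -> _ <= X]mulrC !mulrA.
under eq_integral => x _.
  under eq_integral do rewrite EFinM.
  rewrite ge0_integralZl//; last 3 first.
  - exact/measurable_EFinP.
  - by move=> y _; rewrite lee_fin cnorm1_ge0.
  - by rewrite lee_fin mulr_ge0 ?cnorm1_ge0.
  rewrite IE// muleC EFinM muleA.
  over.
rewrite ge0_integralZl//; last 3 first.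
- exact/measurable_EFinP.
- by move=> y _; rewrite lee_fin cnorm1_ge0.
- by rewrite -EFinM lee_fin mulr_ge0// Rintegral_ge0// => x _; exact: cnorm1_ge0.
by rewrite IE// -!EFinM lee_fin le_eqVlt; apply/orP; left; apply/eqP; ring.
Qed.

Section weighted_estimate.
Context (R : realType) (d l : nat) (a : 'rV[R]_d).
Hypotheses (d_gt0 : (0 < d)%N) (a_gt0 : forall j, 0 < a ord0 j).
Context (Omega : 'rV[R]_d -> {vspace 'rV[R[i]]_l}).
Hypothesis Omega_hoelder : hoelder_continuous (fun x y => enorm (x - y))
  (@grass_dist R l) (@unit_sphere R d) Omega.
Hypothesis Omega_canceling :
  \bigcap_(zeta in @unit_sphere R d) [set` Omega zeta] = [set 0].
Local Notation mu := (lebesgue_rv R d).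
Implicit Types f : 'rV[R]_d -> 'rV[R[i]]_l.

Let energy f xi : R := \sum_q cnormsq (vect_fourier f xi ord0 q).
Let mass f : R := \sum_q \int[mu]_x cnorm1 (f x ord0 q).
(** This is 2 to the power [\sum_j a_j], the radius of [enorm_le_eta2]: the cutoff is then 1 on the
    whole dyadic shell. *)
Let rho := expR ((\sum_j a ord0 j) * ln 2).

Lemma dil0 t : dil a t 0 = 0.
Proof. by apply/rowP => j; rewrite !mxE mulr0. Qed.

(** Positivity of [d] enters here: on [R^0] the measure is the Dirac mass at the only point. *)
Lemma lebesgue_rv_0 : mu [set 0] = 0%E.
Proof.
have -> : [set 0 : 'rV[R]_d] = [set x : 'rV[R]_d | forall i, [set 0] (x ord0 i)].
  apply/seteqP; split => [x -> i|x h] /=; first by rewrite mxE.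
  by apply/rowP => i; rewrite mxE; exact: h.
rewrite (@lebesgue_rv_box R d (fun=> [set 0]))//; case: d d_gt0 => // d' _.
by rewrite big_ord_recl lebesgue_measure_set1 mul0e.
Qed.

Lemma dyadic_weighted_estimate : exists2 C : R, 0 <= C & forall f,
  (forall q, cintegrable mu (fun x => f x ord0 q)) ->
  (forall xi, xi != 0 -> vect_fourier f xi \in Omega (spherical a xi)) ->
  forall N n, (\int[mu]_xi (weight a rho N n xi * energy f xi)%:E <= (C * mass f ^+ 2)%:E)%E.
Proof.
have rho1 : 1 <= rho.
  by rewrite /rho -[leLHS]expR0 ler_expR mulr_ge0 ?sumr_ge0 ?ln_ge0 ?ler1n// => j _; exact: ltW.
have [b [b0 b1 [M [aM M0 Mz MO]]]] := cancelling_multiplier a_gt0 Omega_hoelder Omega_canceling rho1.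
have r0 : 0 <= rho + 1 by lra.
have /choice[K HK] : forall pq : 'I_l * 'I_l, exists K : R, 0 <= K /\
    forall N n z, cnorm1 (fourier (multiscale a N n (M pq.1 pq.2)) z) <= K.
  move=> pq; have [K K0 HK] := fourier_multiscale_bound a_gt0 b0 b1 r0 (aM pq.1 pq.2) (M0 _ _).
  by exists K.
pose C := \sum_pq K pq.
have KC pq : K pq <= C.
  by rewrite /C (bigD1 pq)//= lerDl sumr_ge0// => i _; have [] := HK i.
have C0 : 0 <= C by apply: sumr_ge0 => i _; have [] := HK i.
clearbody C.
exists C => // f fi fO N n.
pose I q : R := \int[mu]_x cnorm1 (f x ord0 q).
have I0 q : 0 <= I q by apply: Rintegral_ge0 => x _; exact: cnorm1_ge0.
pose fh q xi := fourier (fun x => f x ord0 q) xi.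
have fhE q xi : vect_fourier f xi ord0 q = fh q xi by rewrite mxE.
pose MS p q := multiscale a N n (M p q).
have iMS p q : cintegrable mu (MS p q).
  apply: cintegrable_multiscale; exact: (admissible_cintegrable b0 (aM p q)).
pose T p q xi := fh p xi * (MS p q xi * conjc (fh q xi)).
have iT p q : cintegrable mu (T p q).
  have mT s : cmeasurable (fh s) by apply: cmeasurable_fourier; exact: cintegrable_cmeasurable.
  rewrite (_ : T p q = fun xi => MS p q xi * (fh p xi * conjc (fh q xi))); last first.
    by apply/funext => xi; rewrite /T; ring.
  apply: (cintegrable_bounded_mul (iMS p q) (M := (2 * I p) * (2 * I q))).
    by apply: cmeasurableM => //; exact: cmeasurableJ.
  move=> xi; rewrite (le_trans (cnorm1M _ _))// cnorm1J.
  by apply: ler_pM; rewrite ?cnorm1_ge0//; exact: cnorm1_fourier.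
(* [spherical] is constant along dilation orbits, so the vector [vect_fourier f xi] lies in the
   subspace attached to each dilate of [xi]. Every term of the matrix sum therefore acts on it as
   the scalar cutoff. At [xi = 0] both sides vanish. *)
have sumT xi : \sum_p \sum_q T p q xi = ((weight a rho N n xi * energy f xi)%:C)%C.
  have [->|xi0] := eqVneq xi 0.
    rewrite big1 => [|p _]; last first.
      rewrite big1// => q _; rewrite /T /MS /multiscale big1 => [|i _].
        by rewrite mul0r mulr0.
      by rewrite dil0 Mz mulr0.
    rewrite /weight big1 ?mul0r// => i _.
    by rewrite dil0 cutoff_eq0 ?mulr0// enorm0 leNgt invr_gt0 ltr0n.
  rewrite exchange_big /= /energy mulr_sumr rmorph_sum /=; apply: eq_bigr => q _.
  rewrite rmorphM /= -mulcJ fhE mulrA.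
  transitivity ((\sum_p fh p xi * MS p q xi) * conjc (fh q xi)).
    by rewrite mulr_suml; apply: eq_bigr => p _; rewrite /T mulrA.
  congr (_ * _); rewrite /MS /multiscale /weight rmorph_sum mulr_suml /=.
  under eq_bigr do rewrite mulr_sumr.
  rewrite exchange_big /=; apply: eq_bigr => i _.
  have t0 := dyadic_gt0 R N i.
  rewrite rmorphM /= -mulrA -[fh q xi]fhE.
  rewrite -(MO (dil a (dyadic R N i) xi) _ (dil_neq0 a t0 xi0)); last first.
    by rewrite spherical_dil//; exact: fO.
  rewrite mulr_sumr; apply: eq_bigr => p _; rewrite fhE; ring.
have iG : cintegrable mu (fun xi => ((weight a rho N n xi * energy f xi)%:C)%C).
  rewrite -(funext sumT); apply: cintegrable_sum => p _; apply: cintegrable_sum => q _.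
  exact: iT.
rewrite -[leLHS]fineK; last first.
  by case: iG => iR _; apply: integrable_fin_num => //; exact: iR.
rewrite lee_fin.
apply: (@le_trans _ _ (cnorm1 (cint mu (fun xi => ((weight a rho N n xi * energy f xi)%:C)%C)))).
  by rewrite /cnorm1 /cint /= /Rintegral (le_trans (ler_norm _))// lerDl.
rewrite -(funext sumT) cint_sum; last by move=> p _; apply: cintegrable_sum => q _; exact: iT.
rewrite (le_trans (cnorm1_sum _ _ _))//.
have -> : C * mass f ^+ 2 = \sum_p \sum_q C * I p * I q.
  rewrite expr2 mulrCA mulr_suml; apply: eq_bigr => p _.
  by rewrite mulrA mulr_sumr; apply: eq_bigr => q _; rewrite [_ * C]mulrC.
apply: ler_sum => p _; rewrite cint_sum; last by move=> q _; exact: iT.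
rewrite (le_trans (cnorm1_sum _ _ _))//; apply: ler_sum => q _.
by apply: sesquilinear_bound => // z; apply: le_trans (KC (p, q)); exact: (HK (p, q)).2.
Qed.

Lemma weighted_estimate : exists2 C : R, 0 <= C & forall f,
  (forall q, cintegrable mu (fun x => f x ord0 q)) ->
  (forall xi, xi != 0 -> vect_fourier f xi \in Omega (spherical a xi)) ->
  (\int[mu]_xi (Defs.eta a xi `^ (- \sum_j a ord0 j) *
     \sum_q cnormsq (vect_fourier f xi ord0 q))%:E <=
   (C * (\sum_q \int[mu]_x cnorm1 (f x ord0 q)) ^+ 2)%:E)%E.
Proof.
have [C C0 HC] := dyadic_weighted_estimate; exists C => // f fi fO.
have mE : measurable_fun setT (energy f).
  apply: measurable_sum => q; under eq_fun do rewrite mxE; apply: cmeasurable_cnormsq.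
  by apply: cmeasurable_fourier; exact: cintegrable_cmeasurable.
have E0 xi : 0 <= energy f xi by apply: sumr_ge0 => q _; exact: cnormsq_ge0.
pose h xi := Defs.eta a xi `^ (- \sum_j a ord0 j) * energy f xi.
have h0 xi : 0 <= h xi by rewrite mulr_ge0// powR_ge0.
have mh : measurable_fun setT h.
  apply: measurable_funM => //.
  exact: measurableT_comp (measurable_powR _) (measurable_eta a_gt0).
have mZ : measurable ([set 0] : set 'rV[R]_d).
  rewrite (_ : [set 0] = eball 0); first exact: measurable_eball.
  apply/seteqP; split => [x -> /=|x /= x0]; rewrite /eball/= ?enorm0//.
  by apply: enorm_eq0; apply/le_anti; rewrite x0 enorm_ge0.
(* The origin is removed: there [eta] is a default value, so [h] may be positive although every
   [weight] vanishes. *)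
pose h' xi := h xi * \1_(~` [set 0]) xi.
have h'0 xi : 0 <= h' xi by rewrite mulr_ge0.
have mh' : measurable_fun setT h'.
  by apply: measurable_funM => //; apply: measurable_indic; exact: measurableC.
have -> : (\int[mu]_xi (h xi)%:E = \int[mu]_xi (h' xi)%:E)%E.
  apply: ge0_ae_eq_integral => //; [exact/measurable_EFinP|exact/measurable_EFinP| | |].
  - by move=> x _; rewrite lee_fin.
  - by move=> x _; rewrite lee_fin mulr_ge0.
  exists [set 0]; split => //; first exact: lebesgue_rv_0.
  move=> x /=; apply: contra_notP => x0 _; rewrite /h' indicE mem_set ?mulr1//.
have w0 N n xi := weight_ge0 a rho N n xi.
have mw N : measurable_fun setT (weight a rho N (N + N)).
  apply: measurable_sum => i; apply: measurable_funM => //.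
  under eq_fun do rewrite dil_affine.
  apply: measurableT_comp (measurable_affine _ _); apply: continuous_measurable_rv.
  have [c _] := admissible_continuous ltr01 (cutoff_admissible d rho ltr01 (lexx 1)).
  exact: c.
(* The weights are only known to dominate eventually, not to converge to the desired weight. Their
   minimum with [h'] is eventually equal to [h'] at each point, which is what Fatou's lemma
   requires. *)
apply: (@fatou_le _ _ _ _ (fun N xi => Num.min (weight a rho N (N + N) xi * energy f xi) (h' xi))).
- move=> N; apply: measurable_minr => //; exact: measurable_funM.
- by move=> N xi; rewrite le_min h'0 andbT mulr_ge0.
- move=> xi; apply: (@cvg_near_cst) => //.
  have [->|xi0] := eqVneq xi 0.
    near=> N; rewrite /h' indicE memNset ?mulr0; last by move=> /(_ erefl).
    by apply/min_idPr; rewrite mulr_ge0.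
  have [N0 HN] := weight_lower a_gt0 xi0.
  exists N0 => // N /= /HN hw; apply/min_idPr.
  by rewrite /h' indicE mem_set ?mulr1 ?ler_wpM2r//; exact/eqP.
move=> N; apply: le_trans (HC f fi fO N (N + N)%N).
apply: ge0_le_integral => //.
- by move=> x _; rewrite lee_fin le_min h'0 andbT mulr_ge0.
- by apply/measurable_EFinP; apply: measurable_minr => //; exact: measurable_funM.
- by apply/measurable_EFinP; exact: measurable_funM.
- by move=> x _; rewrite lee_fin ge_min lexx.
Unshelve. all: by end_near.
Qed.

End weighted_estimate.

(** * Norms of vector-valued functions and the final estimate *)

Section hermitian_norm.
Context (R : realType) (d l : nat).
Local Notation mu := (lebesgue_rv R d).
Implicit Types f : 'rV[R]_d -> 'rV[R[i]]_l.

Lemma sqr_hs_norm (v : 'rV[R[i]]_l) : hs_norm v ^+ 2 = \sum_j cnormsq (v ord0 j).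
Proof.
rewrite /hs_norm sqr_sqrtr big_ord1//; apply: sumr_ge0 => j _.
exact: cnormsq_ge0.
Qed.

Lemma hs_norm_ge0 (v : 'rV[R[i]]_l) : 0 <= hs_norm v.
Proof. exact: sqrtr_ge0. Qed.

Lemma cnorm1_le_hs_norm (v : 'rV[R[i]]_l) j : cnorm1 (v ord0 j) <= 2 * hs_norm v.
Proof.
rewrite -(@ler_pXn2r _ 2) ?nnegrE ?cnorm1_ge0 ?mulr_ge0 ?hs_norm_ge0//.
rewrite exprMn sqr_hs_norm; have := cnorm1_sqr_le (v ord0 j).
have : cnormsq (v ord0 j) <= \sum_j cnormsq (v ord0 j).
  by rewrite [leRHS](bigD1 j)//= lerDl sumr_ge0// => i _; exact: cnormsq_ge0.
have := cnormsq_ge0 (v ord0 j); lra.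
Qed.

Lemma measurable_cvectP f : measurable_cvect f <-> forall j, cmeasurable (fun x => f x ord0 j).
Proof. by split => mf j; have [] := mf j. Qed.

Lemma measurable_hs_norm f : measurable_cvect f -> measurable_fun setT (fun x => hs_norm (f x)).
Proof.
move=> /measurable_cvectP mf.
rewrite (_ : (fun _ => _) = fun x => Num.sqrt (\sum_j cnormsq (f x ord0 j))).
  apply: (measurableT_comp (continuous_measurable_fun (@sqrt_continuous R))); apply: measurable_sum => j.
  exact: cmeasurable_cnormsq.
by apply/funext => x; rewrite -sqr_hs_norm sqrtr_sqr ger0_norm ?hs_norm_ge0.
Qed.

Lemma Lp1_cintegrable f : Lp 1 f -> (forall q, cintegrable mu (fun x => f x ord0 q)) /\
  \sum_q \int[mu]_x cnorm1 (f x ord0 q) <= l%:R * (2 * fine (Lp_norm 1 f)).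
Proof.
move=> [mf]; have mh := measurable_hs_norm mf; move/measurable_cvectP : mf => mf.
have -> : Lp_norm 1 f = (\int[mu]_x (hs_norm (f x))%:E)%E.
  rewrite /Lp_norm Lnorm1; apply: eq_integral => x _ /=.
  by rewrite ger0_norm ?hs_norm_ge0.
move=> fo; have ih : mu.-integrable setT (EFin \o (fun x => hs_norm (f x))).
  apply/integrableP; split; first exact/measurable_EFinP.
  by under eq_integral do rewrite /= ger0_norm ?hs_norm_ge0//.
have i2 := integrableZl_EFin 2 ih.
have fi q : cintegrable mu (fun x => f x ord0 q).
  by apply: (cintegrable_dominated (mf q) i2) => x; exact: cnorm1_le_hs_norm.
split => //.
have -> : l%:R * (2 * fine (\int[mu]_x (hs_norm (f x))%:E)%E) =
    \sum_(q < l) (2 * fine (\int[mu]_x (hs_norm (f x))%:E)%E).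
  by rewrite sumr_const card_ord mulr_natl.
apply: ler_sum => q _; rewrite -/(Rintegral mu setT (fun x => hs_norm (f x))) -RintegralZl//.
apply: le_Rintegral => //; first exact: cintegrable_cnorm1.
by move=> x _; exact: cnorm1_le_hs_norm.
Qed.

Lemma Lp2_norm_le f (B : R) : measurable_cvect f -> 0 <= B ->
  (\int[mu]_x (\sum_j cnormsq (f x ord0 j))%:E <= (B ^+ 2)%:E)%E ->
  (Lp_norm 2%:E f <= B%:E)%E.
Proof.
move=> mf B0 fB.
have -> : Lp_norm 2%:E f = ((\int[mu]_x (\sum_j cnormsq (f x ord0 j))%:E) `^ 2^-1)%E.
  rewrite /Lp_norm unlock; congr (_ `^ _)%E; apply: eq_integral => x _ /=.
  by rewrite ger0_norm ?hs_norm_ge0// powR_mulrn ?hs_norm_ge0// sqr_hs_norm.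
have -> : B%:E = ((B ^+ 2)%:E `^ 2^-1)%E.
  by rewrite poweR_EFin -powR_mulrn// -powRrM mulfV// powRr1.
have i0 : (0 <= \int[mu]_x (\sum_j cnormsq (f x ord0 j))%:E)%E.
  by apply: integral_ge0 => x _; rewrite lee_fin sumr_ge0// => j _; exact: cnormsq_ge0.
by apply: gt0_ler_poweR => //; rewrite in_itv /= ?i0 ?lee_fin ?sqr_ge0 leey.
Qed.

End hermitian_norm.

Theorem theorem2p2 (R : realType) (d l k : nat)
    (d_gt0 : (0 < d)%N) (l_gt0 : (0 < l)%N) (k_gt0 : (0 < k)%N)
    (k_le_l : (k <= l)%N)
    (a : 'rV[R]_d)
    (a_gt0 : forall j, 0 < a ord0 j)
    (a_sum : \sum_j a ord0 j = d%:R)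
    (Omega : {fun @unit_sphere R d >-> @grassmannian R l k})
    (Omega_hoelder : hoelder_continuous (fun x y => enorm (x - y))
       (@grass_dist R l) (@unit_sphere R d) Omega)
    (Omega_canceling :
       \bigcap_(zeta in @unit_sphere R d) [set` Omega zeta] = [set 0]) :
  exists C : R, forall f, W1 Omega a f ->
    exists g : 'rV[R]_d -> 'rV[R[i]]_l,
      [/\ Lp 2%:E g,
          eq_distr (riesz_potential a (d%:R / 2) f)
            (regular_distr g)
        & (Lp_norm 2%:E g <= C%:E * Lp_norm 1 f)%E].
Proof.
have [C C0 HC] := weighted_estimate d_gt0 a_gt0 Omega_hoelder Omega_canceling.
have [D D0 HD] := l2_inv_fourier R d.
pose mu := lebesgue_rv R d.
(* [C] and [D] bound squared norms, hence the root; [l * 2] compares the coordinatewise [cnorm1]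
   mass of [f] with its [L_1] norm. *)
pose A : R := Num.sqrt (D * C) * (l%:R * 2).
have A0 : 0 <= A by rewrite mulr_ge0 ?sqrtr_ge0// mulr_ge0.
exists A => f [f1 fO]; have [fi fm] := Lp1_cintegrable f1.
have {}HC := HC f fi fO.
set m := \sum_q _ in fm HC; rewrite a_sum in HC.
have m0 : 0 <= m.
  by apply: sumr_ge0 => q _; apply: Rintegral_ge0 => x _; exact: cnorm1_ge0.
pose h j xi := Complex (Defs.eta a xi `^ (- (d%:R / 2))) 0 * vect_fourier f xi ord0 j.
have mh j : cmeasurable (h j).
  apply: cmeasurableM.
    apply: cmeasurable_real.
    exact: measurableT_comp (measurable_powR _) (measurable_eta a_gt0).
  under eq_fun do rewrite mxE.
  by apply: cmeasurable_fourier; exact: cintegrable_cmeasurable.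
(* Squaring [eta^(-d/2)] gives [eta^-d], which is the weight of [weighted_estimate] because the
   exponents sum to [d]. *)
have hE j xi : cnormsq (h j xi) = Defs.eta a xi `^ (- d%:R) * cnormsq (vect_fourier f xi ord0 j).
  rewrite /h cnormsq_realM -powR_mulrn ?powR_ge0// -powRrM.
  by congr (_ `^ _ * _); field.
have sumh : (\sum_j \int[mu]_xi (cnormsq (h j xi))%:E <= (C * m ^+ 2)%:E)%E.
  rewrite -ge0_integral_sum//.
  - rewrite (le_trans _ HC)// le_eqVlt; apply/orP; left; apply/eqP.
    apply: eq_integral => xi _; rewrite sumEFin mulr_sumr; congr EFin.
    by apply: eq_bigr => j _.
  - by move=> j; apply/measurable_EFinP; exact: cmeasurable_cnormsq.
  - by move=> j xi _; rewrite lee_fin cnormsq_ge0.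
have h2 j : (\int[mu]_xi (cnormsq (h j xi))%:E < +oo)%E.
  apply: le_lt_trans (ltry (C * m ^+ 2)); apply: le_trans sumh.
  rewrite [leRHS](bigD1 j)//= leeDl// sume_ge0// => i _; apply: integral_ge0 => x _.
  by rewrite lee_fin cnormsq_ge0.
have /choice[g Hg] : forall j, exists g : 'rV[R]_d -> R[i], [/\ cmeasurable g,
    (\int[mu]_x (cnormsq (g x))%:E <= D%:E * \int[mu]_x (cnormsq (h j x))%:E)%E &
    forall phi, cintegrable mu phi -> (\int[mu]_x (cnormsq (phi x))%:E < +oo)%E ->
      cint mu (fun x => h j x * inv_fourier phi x) = cint mu (fun x => g x * phi x)].
  by move=> j; have [g mg [gh gphi]] := HD _ (mh j) (h2 j); exists g.
have mg : measurable_cvect (fun x => \row_j g j x).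
  apply/measurable_cvectP => j; under eq_fun do rewrite mxE; by have [] := Hg j.
have Lg : (Lp_norm 2%:E (fun x => \row_j g j x) <= A%:E * Lp_norm 1 f)%E.
  have f0 : (0 <= Lp_norm 1 f)%E by exact: Lnorm_ge0.
  have f_fin : Lp_norm 1 f \is a fin_num by rewrite ge0_fin_numE//; case: f1.
  rewrite -[X in (_ * X)%E]fineK// -EFinM.
  apply: (@le_trans _ _ (Num.sqrt (D * C) * m)%:E); last first.
    by rewrite lee_fin /A -mulrA ler_wpM2l ?sqrtr_ge0// -mulrA.
  apply: Lp2_norm_le => //; first by rewrite mulr_ge0 ?sqrtr_ge0.
  under eq_integral do (under eq_bigr do rewrite mxE); under eq_integral do rewrite -sumEFin.
  rewrite ge0_integral_sum//.
  - rewrite exprMn sqr_sqrtr ?mulr_ge0// -mulrA EFinM.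
    apply: le_trans (lee_wpmul2l _ sumh); rewrite ?lee_fin//.
    rewrite ge0_sume_distrr; last by move=> j _; apply: integral_ge0 => x _; rewrite lee_fin cnormsq_ge0.
    by apply: lee_sum => j _; have [] := Hg j.
  - by move=> j; apply/measurable_EFinP; apply: cmeasurable_cnormsq; have [] := Hg j.
  - by move=> j x _; rewrite lee_fin cnormsq_ge0.
exists (fun x => \row_j g j x); split => //.
  split => //; apply: le_lt_trans Lg _.
  by rewrite lte_mul_pinfty//; case: f1.
(* A Schwartz function is integrable and square integrable, so the pairing identity for [g j]
   applies; coordinate by coordinate it is the asserted equality of distributions. *)
move=> phi /schwartz_integrable[iphi phi2]; apply/rowP => j; rewrite !mxE.
have [_ _ /(_ phi iphi phi2)] := Hg j.
rewrite /cintegral -/(cint _ _) => E.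
transitivity (cint mu (fun x => h j x * inv_fourier phi x)).
  by apply: eq_cint => x; rewrite mxE.
by rewrite E; apply: eq_cint => x; rewrite mxE.
Qed.
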